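(* Let $\mathcal V(L)$ be a link vector arrangement corresponding to a planar projection of an oriented link $L$ in the three-sphere, let $w(L)=n_0-n_1$ be the writhe, where $n_0$ and $n_1$ are the numbers of positive and negative crossings of the projection, and let $Kh^\bullet(L)$ denote the reduced odd Khovanov homology of $L$ (with coefficients in $\Bbbk$). Then $$H_{Kh}^\bullet(\mathcal V(L))\cong Kh^\bullet(L)\bigl[-\tfrac12w(L)\bigr]\bigl\{-\tfrac32w(L)\bigr\},$$ where $[\cdot]$ and $\{\cdot\}$ denote shifts in the homological grading and the $q$-grading, respectively.
   Context: Let $\Bbbk$ be a field of characteristic zero. Homology of signed arrangements. A signed vector arrangement $\mathcal V=\{V;\nu_1,\dots,\nu_n\}$ is a finite-dimensional $\Bbbk$-vector space $V$ with an inner product, a list of vectors $\nu_i\in V$ (zero allowed) and a sign for each $\nu_i$, giving a partition $[n]=[n]_+\sqcup[n]_-$. For $S\subseteq[n]$: $H_S=\bigcap_{s\in S}\nu_s^\perp$ ($H_\emptyset=V$), $V_S=\mathrm{span}\{\nu_s\}_{s\in S}$, $W=\{w\in\Bbbk^n:\sum w_i\nu_i=0\}$ with inner product induced from the standard one on $\Bbbk^n$, $W_S=\{w\in W:w_r=0\text{ for }r\notin S\}$, $\widetilde S=(S\cap[n]_+)\cup([n]_-\setminus S)$. The vector $\nu_r^\vee\in W$ is the orthogonal projection of the $r$-th standard basis vector of $\Bbbk^n$ to $W$. Inner products are understood to restrict non-degenerately to all subspaces onto which orthogonal projections are taken. $\mathcal T(\mathcal V)=\bigoplus_{S\subseteq[n]}T_S$,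 $T_S=\bigwedge^\bullet H_{\widetilde S}\otimes\bigwedge^\bullet W_{\widetilde S}$, with $\deg(\bigwedge^iH_{\widetilde S}\otimes\bigwedge^jW_{\widetilde S})=(|S|-n/2,\ |S|+\dim H_{\widetilde S}+\dim W_{\widetilde S}-2(i+j)-n/2)$ (homological degree, $q$-degree). For $r\notin S$, $\delta_{S,r}:T_S\to T_{S\cup r}$ is: (1) if $r\in[n]_+$, $\nu_r\notin V_{\widetilde S}$: (map induced by orthogonal projection $H_{\widetilde S}\to H_{\widetilde S\cup r}$) $\otimes$ (inclusion $W_{\widetilde S}\subseteq W_{\widetilde S\cup r}$); (2) if $r\in[n]_+$, $\nu_r\in V_{\widetilde S}$: (projection) $\otimes$ (inclusion into $\bigwedge^\bullet W_{\widetilde S\cup r}$ followed by left wedge with the projection of $\nu_r^\vee$ to $W_{\widetilde S\cup r}$); (3) if $r\in[n]_-$, $\nu_r\in V_{\widetilde S-r}$: (inclusion $H_{\widetilde S}\subseteq H_{\widetilde S-r}$) $\otimes$ (orthogonal projection $W_{\widetilde S}\to W_{\widetilde S-r}$); (4) if $r\in[n]_-$, $\nu_r\notin V_{\widetilde S-r}$: (inclusion into $\bigwedge^\bullet H_{\widetilde S-r}$ followed by left wedge with the projection of $\nu_r$ to $H_{\widetilde S-r}$) $\otimes$ (projection). The differential is $\bigoplus_{S,\,r\notin S}\epsilon_{S,r}\delta_{S,r}$ for a choice of nonzero scalars $\epsilon_{S,r}$ making every square of the cube anticommute (such a choice exists, and the homology does not depend on it). $H_{Kh}^\bullet(\mathcal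 V)$ is the bigraded homology. Arrangement of a link diagram. Let $D$ be a planar diagram of an oriented link. If $D$ is connected, choose a checkerboard coloring; the Tait graph has a vertex for each shaded region and an edge for each crossing, joining the shaded regions meeting there. If $D$ is disconnected as a planar graph, do this separately for each connected component and take the disjoint union of graphs. Each edge gets a shaded sign: $+$ if the $1$-smoothing of the crossing joins the two shaded regions at the crossing, $-$ if the $0$-smoothing does (standard Khovanov smoothings; the $0$-smoothing of a positive crossing is the oriented smoothing). Order and orient the edges, and let $x_1,\dots,x_k$ be the standard basis of $\Bbbk^k$, $k$ the number of vertices. The link vector arrangement consists of the vectors $x_i-x_j$, one per edge from vertex $i$ to vertex $j$, with the sign of the edge, in the reduced ambient space $\Bbbk^k/\Bbbk(1,\dots,1)$, identified with the orthogonal complement of $(1,\dots,1)$ in $\Bbbk^k$. Reduced odd Khovanov homology is that of Ozsváth–Rasmussen–Szabó, with gradings normalized so that the chain group at a subset $S$ of crossings lies in homological degree $|S|-n_1$ and its graded Euler characteristic is the normalized Jones polynomial $\sum_{S\subseteq[n]}(-1)^{|S|+n_1}q^{|S|+n_0-2n_1}(q+q^{-1})^{c(S)-1}$, $c(S)$ being the number of circles obtained by $1$-smoothing the crossings in $S$ and $0$-smoothing the others. A shift $[a]$ or $\{a\}$ raises the corresponding degree by $a$. *)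

(* Defs.v *)
From HB Require Import structures.
From mathcomp Require Import all_boot all_order all_fingroup all_algebra.
From mathcomp Require Import generic_quotient ring_quotient sesquilinear.

Set Implicit Arguments.
Unset Strict Implicit.
Unset Printing Implicit Defensive.

Import GRing.Theory.
Local Open Scope ring_scope.

(* F^J, the vector space with basis indexed by the finite type J *)
Notation freev F J := {ffun J -> F^o}.

Definition basisv (F : fieldType) (J : finType) (j : J) : freev F J :=
  [ffun i => (i == j)%:R].

Section DotProduct.
Variables (F : fieldType) (J : finType).

Definition dotp (u v : freev F J) : F := \sum_j u j * v j.

Fact dotp_bilinear :
  bilinear_for (GRing.Scale.Law.clone _ _ ( *%R ) _)
    (GRing.Scale.Law.clone _ _ (idfun \; *%R ) _) dotp.
Proof.
split=> [w|w] a u v; rewrite /dotp /= mulr_sumr -big_split /=.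
  by apply: eq_bigr => j _; rewrite !ffunE mulrDl mulrA.
by apply: eq_bigr => j _; rewrite !ffunE mulrDr mulrCA.
Qed.
HB.instance Definition _ :=
  @bilinear_isBilinear.Build F (freev F J) (freev F J) F _ _ dotp
    dotp_bilinear.

Fact dotp_sym u v : dotp u v = (-1) ^+ false * idfun (dotp v u).
Proof. by rewrite mul1r /=; apply: eq_bigr => j _; rewrite mulrC. Qed.
HB.instance Definition _ :=
  @isHermitianSesquilinear.Build F (freev F J) false idfun dotp dotp_sym.

End DotProduct.

Section RestrictedForm.
Variables (F : fieldType) (V : vectType F).
Variables (form : {symmetric V}) (U : {vspace V}).

Definition restr_form (u v : subvs_of U) : F := form (vsval u) (vsval v).

Fact restr_form_bilinear :
  bilinear_for (GRing.Scale.Law.clone _ _ ( *%R ) _)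
    (GRing.Scale.Law.clone _ _ (idfun \; *%R ) _) restr_form.
Proof.
by split=> [w|w] a u v; rewrite /restr_form linearP //= linearPl.
Qed.
HB.instance Definition _ :=
  @bilinear_isBilinear.Build F (subvs_of U) (subvs_of U) F _ _ restr_form
    restr_form_bilinear.

Fact restr_form_sym u v :
  restr_form u v = (-1) ^+ false * idfun (restr_form v u).
Proof. exact: hermC. Qed.
HB.instance Definition _ :=
  @isHermitianSesquilinear.Build F (subvs_of U) false idfun restr_form
    restr_form_sym.

End RestrictedForm.

(* The orthogonal projection onto U, as long as form is non-degenerate on U.
   This holds wherever it is applied to the arrangement of a link: form is then
   the dot product, and U is spanned by vectors with rational coordinates. *)
Definition orth_proj (F : fieldType) (V : vectType F) (form : {symmetric V})
    (U : {vspace V}) : 'End(V) :=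
  daddv_pi U (orthov form U).

Section QuotientSpace.
Variables (F : fieldType) (V : vectType F) (U : {vspace V}).
Local Open Scope quotient_scope.

Definition quotv := Quotient.quot (pred_of_vspace U).
HB.instance Definition _ := GRing.Zmodule.on quotv.

Definition quotv_scale (a : F) : quotv -> quotv :=
  fun x => \pi_quotv (a *: repr x).

Fact quotv_piE (a : F) (x : V) :
  quotv_scale a (\pi_quotv x) = \pi_quotv (a *: x).
Proof.
have IE y z : (y - z \in U) = (\pi_quotv y == \pi_quotv z).
  exact: (Quotient.idealrBE (pred_of_vspace U)).
apply/eqP; rewrite -IE -scalerBr memvZ // IE; exact/eqP/reprK.
Qed.

Fact quotv_piD (x y : V) : \pi_quotv (x + y) = \pi_quotv x + \pi_quotv y.
Proof. exact: Quotient.pi_add. Qed.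

Fact quotv_scaleA a b v :
  quotv_scale a (quotv_scale b v) = quotv_scale (a * b) v.
Proof.
by elim/quotW: v => x; rewrite (quotv_piE b x) !quotv_piE scalerA.
Qed.
Fact quotv_scale1 : left_id 1 quotv_scale.
Proof. by elim/quotW=> x; rewrite quotv_piE scale1r. Qed.
Fact quotv_scaleDr : right_distributive quotv_scale +%R.
Proof.
move=> a; elim/quotW=> x; elim/quotW=> y.
by rewrite -quotv_piD !quotv_piE scalerDr quotv_piD.
Qed.
Fact quotv_scaleDl v : {morph quotv_scale^~ v : a b / a + b}.
Proof. by elim/quotW: v => x a b; rewrite !quotv_piE scalerDl quotv_piD. Qed.
HB.instance Definition _ :=
  GRing.Zmodule_isLmodule.Build F quotv
    quotv_scaleA quotv_scale1 quotv_scaleDr quotv_scaleDl.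

End QuotientSpace.

Definition subquotient (F : fieldType) (V : vectType F) (Z B : {vspace V}) :
    lmodType F :=
  quotv (linfun (@vsval F V Z) @^-1: B)%VS.

(* Exterior algebras. In ext V, the basis vector indexed by
   A = {a_1 < ... < a_k} is e_(a_1) /\ ... /\ e_(a_k), where e is the basis
   vbasis {:V} of V. *)
Notation ext_basis V := {set 'I_(\dim {:V})}.
Notation ext F V := (freev F (ext_basis V)).

Section ExteriorAlgebra.
Variable F : fieldType.

Definition ext_one (V : vectType F) : ext F V := basisv F set0.

(* The coefficient of e_B in v /\ x, from e_i /\ e_A = (-1)^m e_(A + i) for
   i not in A, where m is the number of elements of A below i. *)
Definition wedge (V : vectType F) (v : V) (x : ext F V) : ext F V :=
  [ffun B : ext_basis V => \sum_(i in B)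
     (-1) ^+ #|[set j in B | (j < i)%N]| * coord (vbasis {:V}) i v
       * x (B :\ i)].

(* The algebra morphism induced by the linear map f; the enumeration of A is
   increasing *)
Definition ext_map (U V : vectType F) (f : U -> V) (x : ext F U) : ext F V :=
  \sum_(A : ext_basis U) (x A : F) *:
    foldr (@wedge V) (ext_one V) [seq f (tnth (vbasis {:U}) i) | i <- enum A].

(* The tensor product of two linear maps, on F^I (x) F^J = F^(I * J) *)
Definition tensor_map (I J I' J' : finType)
    (f : freev F I -> freev F I') (g : freev F J -> freev F J')
    (x : freev F (I * J)%type) : freev F (I' * J')%type :=
  \sum_p (x p : F) *:
    [ffun p' => f (basisv F p.1) p'.1 * g (basisv F p.2) p'.2].

End ExteriorAlgebra.

(* A cube of based, bigraded vector spaces. The map along the edge from S to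
   r |: S is cube_map r S (r |: S): the target is a separate argument so that
   no transport along equalities of sets is needed, and the values of cube_map
   at other arguments are not used. *)
Record cube (F : fieldType) (n : nat) := Cube {
  cube_basis : {set 'I_n} -> finType;
  cube_deg : forall S, cube_basis S -> rat * rat;
  cube_map : 'I_n -> forall S T,
    freev F (cube_basis S) -> freev F (cube_basis T)
}.
Arguments cube_map {F n} c r {S} T x.

Definition bigraded (F : fieldType) := rat -> rat -> lmodType F.

Definition bigraded_iso (F : fieldType) (M N : bigraded F) : Prop :=
  forall h q, exists f : {linear M h q -> N h q}, bijective f.

(* M[a]{b} *)
Definition shift (F : fieldType) (M : bigraded F) (a b : rat) : bigraded F :=
  fun h q => M (h - a) (q - b).

Section CubeHomology.
Variables (F : fieldType) (n : nat) (C : cube F n).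

Definition total_basis : finType := {S : {set 'I_n} & cube_basis C S}.

Definition component (x : freev F total_basis) (S : {set 'I_n}) :
    freev F (cube_basis C S) :=
  [ffun j => x (Tagged (cube_basis C) j)].

Definition anticommuting_scalars (eps : {set 'I_n} -> 'I_n -> F) : Prop :=
  (forall (S : {set 'I_n}) r, r \notin S -> eps S r != 0) /\
  (forall (S : {set 'I_n}) r s, r \notin S -> s \notin S -> r != s ->
   forall x : freev F (cube_basis C S),
     (eps S r * eps (r |: S) s) *:
        cube_map C s (s |: (r |: S)) (cube_map C r (r |: S) x)
   + (eps S s * eps (s |: S) r) *:
        cube_map C r (s |: (r |: S)) (cube_map C s (s |: S) x) = 0).

Variable eps : {set 'I_n} -> 'I_n -> F.

Definition differential (x : freev F total_basis) : freev F total_basis :=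
  [ffun u : total_basis => \sum_(r in tag u)
     eps (tag u :\ r) r *
     cube_map C r (tag u) (component x (tag u :\ r)) (tagged u)].

Definition chains (h q : rat) : {vspace freev F total_basis} :=
  <<[seq basisv F u
      | u in [pred u : total_basis | cube_deg (tagged u) == (h, q)]]>>%VS.

Definition cycles (h q : rat) : {vspace freev F total_basis} :=
  (chains h q :&: lker (linfun differential))%VS.

Definition boundaries (h q : rat) : {vspace freev F total_basis} :=
  (linfun differential @: chains (h - 1) q)%VS.

Definition cube_homology : bigraded F :=
  fun h q => subquotient (cycles h q) (boundaries h q).

End CubeHomology.

Record signed_arrangement (F : fieldType) (n : nat) := SignedArrangement {
  sa_space : vectType F;
  sa_form : {symmetric sa_space};
  sa_nondegenerate : nondegenerate sa_form;
  sa_vec : 'I_n -> sa_space;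
  sa_pos : {set 'I_n}
}.

Section Arrangement.
Variables (F : fieldType) (n : nat) (A : signed_arrangement F n).

Local Notation V := (sa_space A).
Local Notation form := (sa_form A).
Local Notation nu := (@sa_vec F n A).
Local Notation pos := (sa_pos A).

Definition sa_H (S : {set 'I_n}) : {vspace V} :=
  (\bigcap_(s in S) orthov form <[nu s]>)%VS.

Definition sa_span (S : {set 'I_n}) : {vspace V} := (\sum_(s in S) <[nu s]>)%VS.

Definition sa_relations : {vspace freev F 'I_n} :=
  lker (linfun (fun w : freev F 'I_n => \sum_i (w i : F) *: nu i)).

Definition sa_W (S : {set 'I_n}) : {vspace freev F 'I_n} :=
  (sa_relations :&:
   \bigcap_(r | r \notin S) lker (linfun (fun w : freev F 'I_n => w r)))%VS.

Definition sa_tilde (S : {set 'I_n}) : {set 'I_n} :=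
  (S :&: pos) :|: (~: pos :\: S).

Definition sa_coproj (U : {vspace freev F 'I_n}) : 'End(freev F 'I_n) :=
  orth_proj (@dotp F 'I_n) U.

Definition sa_dual (r : 'I_n) : freev F 'I_n :=
  sa_coproj sa_relations (basisv F r).

Definition sub_proj_H (S T : {set 'I_n}) (u : subvs_of (sa_H S)) :
    subvs_of (sa_H T) :=
  vsproj (sa_H T) (orth_proj form (sa_H T) (vsval u)).
Definition sub_incl_H (S T : {set 'I_n}) (u : subvs_of (sa_H S)) :
    subvs_of (sa_H T) :=
  vsproj (sa_H T) (vsval u).
Definition sub_proj_W (S T : {set 'I_n}) (u : subvs_of (sa_W S)) :
    subvs_of (sa_W T) :=
  vsproj (sa_W T) (sa_coproj (sa_W T) (vsval u)).
Definition sub_incl_W (S T : {set 'I_n}) (u : subvs_of (sa_W S)) :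
    subvs_of (sa_W T) :=
  vsproj (sa_W T) (vsval u).

Definition sa_basis (S : {set 'I_n}) : finType :=
  (ext_basis (subvs_of (sa_H (sa_tilde S))) *
   ext_basis (subvs_of (sa_W (sa_tilde S))))%type.

Definition sa_deg (S : {set 'I_n}) (p : sa_basis S) : rat * rat :=
  (#|S|%:R - n%:R / 2,
   #|S|%:R + (\dim (sa_H (sa_tilde S)))%:R + (\dim (sa_W (sa_tilde S)))%:R
     - 2 * (#|p.1|%:R + #|p.2|%:R) - n%:R / 2).

Definition sa_delta (r : 'I_n) (S T : {set 'I_n}) :
    freev F (sa_basis S) -> freev F (sa_basis T) :=
  let S' := sa_tilde S in let T' := sa_tilde T in
  if r \in pos then
    if nu r \notin sa_span S' then
      tensor_map (ext_map (@sub_proj_H S' T')) (ext_map (@sub_incl_W S' T'))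
    else
      tensor_map (ext_map (@sub_proj_H S' T'))
        (wedge (vsproj (sa_W T') (sa_coproj (sa_W T') (sa_dual r)))
           \o ext_map (@sub_incl_W S' T'))
  else
    if nu r \in sa_span (S' :\ r) then
      tensor_map (ext_map (@sub_incl_H S' T')) (ext_map (@sub_proj_W S' T'))
    else
      tensor_map
        (wedge (vsproj (sa_H T') (orth_proj form (sa_H T') (nu r)))
           \o ext_map (@sub_incl_H S' T'))
        (ext_map (@sub_proj_W S' T')).

Definition sa_cube : cube F n := Cube sa_deg sa_delta.

Definition arrangement_homology (eps : {set 'I_n} -> 'I_n -> F) : bigraded F :=
  cube_homology sa_cube eps.

End Arrangement.

(* Oriented link diagrams on the sphere. The half-edges at a crossing c are
   (c, 0), ..., (c, 3), counterclockwise, where (c, 0) is the incoming half of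
   the strand that passes under (hence (c, 2) is its outgoing half). The
   crossing is positive iff the strand that passes over runs from (c, 3) to
   (c, 1). *)
Definition dart (n : nat) : finType := ('I_n * 'Z_4)%type.

Definition turn (n : nat) (k : 'Z_4) (x : dart n) : dart n := (x.1, x.2 + k).

Definition incoming (n : nat) (positive : {set 'I_n}) (x : dart n) : bool :=
  (x.2 == 0) || (x.2 == if x.1 \in positive then 3 else 1).

(* The sector between the half-edges (c, j) and (c, j + 1) is also denoted by
   (c, j). A region of the diagram is an orbit of next_sector, which follows
   its boundary with the region on the left. *)
Definition next_sector (n : nat) (glue : dart n -> dart n) (x : dart n) :
    dart n :=
  turn (-1) (glue x).

Definition adjacent (n : nat) (glue : dart n -> dart n) : rel (dart n) :=
  [rel x y | (y == turn 1 x) || (y == glue x)].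

(* glue exchanges the two half-edges of an edge. Components of the link
   without crossings are only counted, in nfree, and the position of the
   connected components of the diagram relative to each other is not
   recorded. ld_planar is Euler's formula, summed over the components of the
   4-valent graph, which has 2 * ncross edges. *)
Record link_diagram := LinkDiagram {
  ncross : nat;
  nfree : nat;
  positive : {set 'I_ncross};
  glue : dart ncross -> dart ncross;
  glueK : involutive glue;
  glue_oriented : forall x,
    incoming positive (glue x) = ~~ incoming positive x;
  ld_planar : fcard (next_sector glue) predT =
    (ncross + 2 * n_comp (adjacent glue) predT)%N;
  ld_nonempty : (0 < ncross + nfree)%N
}.

Section Diagram.
Variable D : link_diagram.
Local Notation n := (ncross D).
Local Notation glue := (@glue D).

Definition num_pos : nat := #|positive D|.
Definition num_neg : nat := #|~: positive D|.
Definition writhe : rat := num_pos%:R - num_neg%:R.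

(* The 0-smoothing joins (c, 0) to (c, 1) and (c, 2) to (c, 3); the
   1-smoothing joins (c, 1) to (c, 2) and (c, 3) to (c, 0). *)
Definition smooth (S : {set 'I_n}) (x : dart n) : dart n :=
  turn (if (x.1 \in S) (+) odd x.2 then -1 else 1) x.

Definition circle_rel (S : {set 'I_n}) : rel (dart n) :=
  [rel x y | (y == smooth S x) || (y == glue x)].

(* The circle through x is represented by the half-edge
   fingraph.root (circle_rel S) x. *)
Definition circle (S : {set 'I_n}) : finType :=
  ({x : dart n | roots (circle_rel S) x} + 'I_(nfree D))%type.

(* The arrow at a crossing c joins the two strands of its 0-smoothing, from
   the one that contains tail arrows c to the other. *)
Definition tail (arrows : 'I_n -> bool) (c : 'I_n) : dart n :=
  (c, if arrows c then 0 else 2).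

Section OddKhovanov.
Variables (F : fieldType) (arrows : 'I_n -> bool).

Local Notation CV S := (freev F (circle S)).

Definition circle_through (S : {set 'I_n}) (x : dart n) : CV S :=
  [ffun a : circle S =>
    (if a is inl y then (val y == fingraph.root (circle_rel S) x)%:R
     else 0) : F^o].

(* If two circles merge, this is the identification map on circles. If a
   circle splits, it is sent to one of the two new circles: which one is
   irrelevant after the product with the difference of the two. *)
Definition transfer (S T : {set 'I_n}) (v : CV S) : CV T :=
  \sum_a (v a : F) *:
    match a with
    | inl y => circle_through T (val y)
    | inr i => basisv F (inr i : circle T)
    end.

Definition splits (c : 'I_n) (S : {set 'I_n}) : bool :=
  fingraph.root (circle_rel S) (c, 0) == fingraph.root (circle_rel S) (c, 2).

(* The arrow of the 1-smoothing of c is that of the 0-smoothing, rotated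
   counterclockwise by a right angle; this is its tail minus its head. *)
Definition split_vec (c : 'I_n) (T : {set 'I_n}) : CV T :=
  circle_through T (turn 1 (tail arrows c)) -
  circle_through T (turn 3 (tail arrows c)).

Definition odd_map (c : 'I_n) (S T : {set 'I_n}) (x : ext F (CV S)) :
    ext F (CV T) :=
  let y := ext_map (@transfer S T) x in
  if splits c S then wedge (split_vec c T) y else y.

(* First c, then d *)
Definition odd_map2 (c d : 'I_n) (S T : {set 'I_n}) (x : ext F (CV S)) :
    ext F (CV T) :=
  @odd_map d (c |: S) T (@odd_map c S (c |: S) x).

(* The faces of the cube, in the classification of Ozsvath, Rasmussen and
   Szabo: type A if the two compositions anticommute, C if they commute, and
   X or Y if both vanish; the latter are told apart below. *)
Definition face_type_A (S : {set 'I_n}) (c d : 'I_n) : Prop :=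
  let T := c |: (d |: S) in
  (forall x : ext F (CV S), odd_map2 c d T x = - odd_map2 d c T x) /\
  (exists x : ext F (CV S), odd_map2 c d T x != 0).

Definition face_type_C (S : {set 'I_n}) (c d : 'I_n) : Prop :=
  let T := c |: (d |: S) in
  (forall x : ext F (CV S), odd_map2 c d T x = odd_map2 d c T x) /\
  (exists x : ext F (CV S), odd_map2 c d T x != 0).

(* Following the circles, by half-edges at which they enter a crossing *)
Definition walk (S : {set 'I_n}) (x : dart n) : dart n := glue (smooth S x).

Definition cyclic_order4 (S : {set 'I_n}) (x y z t : dart n) : bool :=
  let i := findex (walk S) x in
  [&& i y < i z, i z < i t & i t < fingraph.order (walk S) x]%N.

(* In types X and Y, the two arrows of c and d lie on opposite sides of one circle
   and their ends alternate on it. The circle is followed with the arrow of c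
   on its left: it then enters c at even, and d at odd half-edges. *)
Definition face_type_X (S : {set 'I_n}) (c d : 'I_n) : bool :=
  cyclic_order4 S (tail arrows c) (turn 1 (tail arrows d))
                  (turn 2 (tail arrows c)) (turn 3 (tail arrows d)).

Definition face_type_Y (S : {set 'I_n}) (c d : 'I_n) : bool :=
  cyclic_order4 S (tail arrows c) (turn 3 (tail arrows d))
                  (turn 2 (tail arrows c)) (turn 1 (tail arrows d)).

(* The edge (S, c) of the cube has the sign (-1)^(sgn S c). Edge assignments
   of type X are those with kind = false, and of type Y those with
   kind = true: exchanging the names of X and Y amounts to negating kind. *)
Definition edge_assignment (kind : bool) (sgn : {set 'I_n} -> 'I_n -> bool) :
    Prop :=
  forall (S : {set 'I_n}) c d, c \notin S -> d \notin S -> c != d ->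
  let parity := sgn S c (+) sgn (c |: S) d (+) sgn S d (+) sgn (d |: S) c in
  [/\ face_type_A S c d -> parity = false,
      face_type_C S c d -> parity = true,
      face_type_X S c d -> parity = kind
    & face_type_Y S c d -> parity = ~~ kind].

(* The reduced complex at S is the subalgebra of the exterior algebra of CV S
   generated by the differences of circles; it is the exterior algebra of the
   space of vectors whose coordinates sum to zero. *)
Definition reduced (S : {set 'I_n}) : {vspace CV S} :=
  lker (linfun (fun v : CV S => \sum_a v a : F^o)).

Definition reduced_basis (S : {set 'I_n}) : finType :=
  ext_basis (subvs_of (reduced S)).

Definition reduced_deg (S : {set 'I_n}) (A : reduced_basis S) : rat * rat :=
  (#|S|%:R - num_neg%:R,
   #|S|%:R + num_pos%:R - 2 * num_neg%:R + (#|circle S|%:R - 1) - 2 * #|A|%:R).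

Definition reduced_transfer (S T : {set 'I_n}) (v : subvs_of (reduced S)) :
    subvs_of (reduced T) :=
  vsproj (reduced T) (transfer T (vsval v)).

Definition reduced_map (c : 'I_n) (S T : {set 'I_n})
    (x : freev F (reduced_basis S)) : freev F (reduced_basis T) :=
  let y := ext_map (@reduced_transfer S T) x in
  if splits c S then wedge (vsproj (reduced T) (split_vec c T)) y else y.

Definition reduced_cube : cube F n := Cube reduced_deg reduced_map.

Definition reduced_odd_Kh (sgn : {set 'I_n} -> 'I_n -> bool) : bigraded F :=
  cube_homology reduced_cube (fun S c => (-1) ^+ sgn S c).

End OddKhovanov.

(* shade x tells whether the region of the sector x is shaded. *)
Record checkerboard := Checkerboard {
  shade :> dart n -> bool;
  shade_region : forall x, shade (next_sector glue x) = shade x;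
  shade_adjacent : forall x, shade (turn 1 x) = ~~ shade x
}.

Section LinkArrangement.
Variables (F : fieldType) (charF : [pchar F] =i pred0).
Variables (shaded : checkerboard) (edge_dir : 'I_n -> bool).

(* One shaded region for each component of the link without crossings *)
Definition tait_vertex : finType :=
  ({x : dart n | froots (next_sector glue) x && shaded x} + 'I_(nfree D))%type.

Definition region_vec (x : dart n) : freev F tait_vertex :=
  [ffun v : tait_vertex =>
    (if v is inl y then (val y == froot (next_sector glue) x)%:R
     else 0) : F^o].

(* The shaded sectors at c are either (c, 0) and (c, 2), or (c, 1) and
   (c, 3). *)
Definition edge_source (c : 'I_n) : dart n :=
  turn (if shaded (c, 0) then 0 else 1) (c, if edge_dir c then 0 else 2).

Definition edge_vec (c : 'I_n) : freev F tait_vertex :=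
  region_vec (edge_source c) - region_vec (turn 2 (edge_source c)).

(* The 1-smoothing of c joins the sectors (c, 0) and (c, 2). *)
Definition positive_edges : {set 'I_n} := [set c | shaded (c, 0)].

Definition tait_space : {vspace freev F tait_vertex} :=
  orthov (@dotp F tait_vertex) <[[ffun=> 1] : freev F tait_vertex]>%VS.

Fact tait_nondegenerate :
  nondegenerate (restr_form (@dotp F tait_vertex) (U := tait_space)).
Proof.
have dotB (u : freev F tait_vertex) v : dotp u (basisv F v) = u v.
  rewrite /dotp (bigD1 v) //= ffunE eqxx mulr1 big1 ?addr0 // => w /negPf wv.
  by rewrite ffunE wv mulr0.
have inT u : (u \in tait_space) = (\sum_v u v == 0).
  rewrite mem_orthov1; congr (_ == _); apply: eq_bigr => v _.
  by rewrite ffunE mulr1.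
rewrite /nondegenerate -subv0; apply/subvP => u /mem_orthovP uP.
have uE v w : vsval u v = vsval u w.
  have dT : basisv F v - basisv F w \in tait_space.
    rewrite inT; under eq_bigr => z _ do rewrite !ffunE.
    rewrite sumrB (bigD1 v) //= eqxx big1 ?addr0; last by move=> z /negPf ->.
    rewrite (bigD1 w) //= eqxx big1 ?addr0 ?subrr //.
    by move=> z /negPf ->.
  have /= := uP (vsproj tait_space (basisv F v - basisv F w)) (memvf _).
  rewrite /restr_form vsprojK //= linearBr /= !dotB => /eqP.
  by rewrite subr_eq0 => /eqP.
rewrite memv0; apply/eqP/val_inj/ffunP => v; rewrite [RHS]ffunE /=.
have := subvsP u; rewrite inT.
rewrite (eq_bigr (fun=> vsval u v)) => [|w _]; last exact: uE.
rewrite sumr_const -mulr_natr mulf_eq0 => /orP[/eqP //|].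
have /pcharf0P -> : [pchar F] =i pred0 := charF.
by rewrite -cardsT cards_eq0 => /eqP/setP/(_ v); rewrite !inE.
Qed.

Definition link_arrangement : signed_arrangement F n :=
  SignedArrangement tait_nondegenerate
    (fun c => vsproj tait_space (edge_vec c)) positive_edges.

End LinkArrangement.

End Diagram.

(* Main.v *)
From HB Require Import structures.
Require Import Defs.
From mathcomp Require Import all_boot all_order all_fingroup all_algebra.
From mathcomp Require Import generic_quotient ring_quotient sesquilinear.
From mathcomp Require Import zify ring.

Set Implicit Arguments.
Unset Strict Implicit.
Unset Printing Implicit Defensive.

Import GRing.Theory.
Local Open Scope ring_scope.

(** Both complexes live on the same cube, so it is enough to find at every vertex
    S of the cube a graded isomorphism from T_S onto the reduced odd Khovanov
    group, compatible with the maps along the edges; [cube_homology_iso] then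
    passes to homology and shifts the degrees.

    At a vertex, let T be the set of edges of the Tait graph along which the
    smoothing S joins shaded regions. Every circle of S runs between a shaded
    and an unshaded side. Send it to the pair of the shaded region, projected
    to H_T, and of the unshaded region, projected to W_T by means of a potential
    on the unshaded regions whose jump across an edge e is the coordinate w_e
    on the cycle space. The potential exists because the diagram is planar, so
    that cycles of the Tait graph bound ([dual_potential]). Along a circle the
    shaded region changes by nu_e for e in T only, which vanishes in H_T, and
    the potential changes by w_e for e outside T only, which vanishes on W_T;
    so the pair is well defined ([zeta_connect]). The resulting map theta, from
    the space spanned by differences of circles to H_T + W_T, is onto, and the
    number of circles is dim H_T + dim W_T + 1, so theta is bijective
    ([theta_red_bij]). Passing to exterior algebras identifies the groups.

    Along an edge, theta turns the mergers and splittings of circles into the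
    projections and inclusions between the H_T and the W_T, modulo the vector
    of a splitting, and it sends that vector to the one which the arrangement
    complex multiplies by. Therefore the maps of the two complexes agree up to
    a scalar on each edge ([chain_isoE]).

    It remains to make these scalars 1 by rescaling at the vertices. In the odd
    cube the two compositions along a face agree up to a sign and do not
    vanish, unless each path splits a circle and merges it again ([face_signP]).
    Hence the ratio of the two families of scalars is a 1-cochain on the cube
    whose holonomy is trivial around all faces but these. The latter are the
    faces in the directions of two edges of opposite signs that are parallel
    after contraction of T; there anticommutation says nothing about the
    scalars. But triviality around the other faces forces the holonomy to
    depend only on a circuit through the two edges, and to be the same for
    circuits that meet ([circuit_holonomy_meet]); here it matters that graphs
    are unimodular. So the holonomy is a function lam of the edges that is
    constant on circuits ([gauge]). Such a function preserves the relations
    between the nu_e, and there is an automorphism g of the ambient space which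
    scales every nu_e by the inverse of lam e ([scaled_automorphism]). Using g
    in the definition of theta absorbs the holonomy, and the remaining scalars
    form a coboundary. *)

(** * Exterior algebras *)

Section FreeSpace.
Variables (F : fieldType) (J : finType).

Lemma basisvE (i j : J) : basisv F i j = (j == i)%:R.
Proof. by rewrite ffunE. Qed.

Lemma freev_sum (x : freev F J) : x = \sum_j (x j : F) *: basisv F j.
Proof.
apply/ffunP=> i; rewrite sum_ffunE (bigD1 i) //= big1 ?addr0 => [|j ji].
  by rewrite !ffunE eqxx [_ *: _]mulr1.
by rewrite !ffunE eq_sym (negPf ji) [_ *: _]mulr0.
Qed.

Lemma linear_freev_eq (V : lmodType F) (f g : {linear freev F J -> V}) :
  (forall j, f (basisv F j) = g (basisv F j)) -> f =1 g.
Proof.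
move=> fg x; rewrite [x]freev_sum !linear_sum.
by apply: eq_bigr => j _; rewrite !linearZ /= fg.
Qed.

End FreeSpace.

Lemma char0_natr_eq0 (F : fieldType) (charF : [pchar F] =i pred0) k :
  (k%:R == 0 :> F) = (k == 0)%N.
Proof. by move/GRing.pcharf0P: charF => ->. Qed.

Lemma char0_eqN0 (F : fieldType) (charF : [pchar F] =i pred0)
  (V : lmodType F) (x : V) : x = - x -> x = 0.
Proof.
move=> /eqP; rewrite -addr_eq0 -mulr2n -scaler_nat scaler_eq0.
by rewrite char0_natr_eq0 // => /eqP.
Qed.

Lemma eq_sign_parity (R : pzRingType) m n :
  odd m = odd n -> (-1) ^+ m = (-1) ^+ n :> R.
Proof. by move=> mn; rewrite -signr_odd mn signr_odd. Qed.

Section Wedge.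
Variable F : fieldType.
Hypothesis charF : [pchar F] =i pred0.

Section OneSpace.
Variable V : vectType F.
Notation b := (tnth (vbasis {:V})).
Implicit Types (u v w : V) (x y z : ext F V).

Fact wedge_is_linear v : linear (wedge v).
Proof.
move=> a x y; apply/ffunP => B; rewrite !ffunE scaler_sumr -big_split /=.
apply: eq_bigr => i _; rewrite !ffunE mulrDr; congr (_ + _).
by rewrite -[a *: x _]/(a * x _) mulrCA.
Qed.
HB.instance Definition _ v :=
  GRing.isLinear.Build F (ext F V) (ext F V) *:%R (wedge v)
    (wedge_is_linear v).

Lemma wedge_linear_l x a u v : wedge (a *: u + v) x = a *: wedge u x + wedge v x.
Proof.
apply/ffunP => B; rewrite !ffunE scaler_sumr -big_split /=.
apply: eq_bigr => i _; rewrite linearP /= mulrDr mulrDl; congr (_ + _).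
by rewrite mulrCA -!mulrA.
Qed.

Lemma wedge0l x : wedge 0 x = 0.
Proof.
by apply/ffunP => B; rewrite !ffunE big1 // => i _; rewrite linear0 mulr0 mul0r.
Qed.

Lemma wedgeZl a u x : wedge (a *: u) x = a *: wedge u x.
Proof. by rewrite -[a *: u]addr0 wedge_linear_l wedge0l addr0. Qed.

Lemma wedgeDl u v x : wedge (u + v) x = wedge u x + wedge v x.
Proof. by rewrite -[u]scale1r wedge_linear_l !scale1r. Qed.

Lemma wedge_suml (I : Type) (r : seq I) (P : pred I) (f : I -> V) x :
  wedge (\sum_(i <- r | P i) f i) x = \sum_(i <- r | P i) wedge (f i) x.
Proof.
elim/big_rec2: _ => [|i u y _ <-]; first exact: wedge0l.
exact: wedgeDl.
Qed.

(** Removing two elements i and j from a basis set in either order costs the same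
    two counting signs, except that the second count sees one element less
    when i < j: this is the sign. *)
Lemma wedgeC u v x : wedge u (wedge v x) = - wedge v (wedge u x).
Proof.
pose p (B : ext_basis V) (i j : 'I_(\dim {:V})) : F :=
  (-1) ^+ (#|[set k in B | (k < i)%N]| + #|[set k in B | (k < j)%N]| + (i < j)%N).
have wE u' v' : wedge u' (wedge v' x) = [ffun B : ext_basis V =>
    \sum_(i in B) \sum_(j in B | j != i) p B i j
      * (coord (vbasis {:V}) i u' * coord (vbasis {:V}) j v' * x (B :\ i :\ j))].
  apply/ffunP => B; rewrite !ffunE; apply: eq_bigr => i iB.
  rewrite !ffunE mulr_sumr.
  rewrite (eq_bigl (fun j => (j \in B) && (j != i))); last first.
    by move=> j; rewrite !inE andbC.
  apply: eq_bigr => j /andP[jB ji].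
  rewrite !mulrA; congr (_ * _ * _).
  rewrite mulrAC; congr (_ * _); rewrite /p -exprD.
  have -> : #|[set k in B | (k < j)%N]| =
            ((i < j) + #|[set k in B :\ i | (k < j)%N]|)%N.
    rewrite (cardsD1 i) !inE iB /=; congr (_ + _)%N.
    by apply: eq_card => k; rewrite !inE andbA.
  apply: eq_sign_parity; rewrite !oddD !oddb.
  by case: (i < j)%N; do 2!case: (odd _).
apply/ffunP => B; rewrite !wE !ffunE -sumrN.
rewrite (exchange_big_dep (mem B)) /=; last by move=> i j _ /andP[].
apply: eq_bigr => j jB; rewrite -sumrN.
rewrite (eq_bigl (fun i => (i \in B) && (i != j))); last first.
  by move=> i; rewrite jB andTb eq_sym.
apply: eq_bigr => i /andP[iB ij]; rewrite -mulNr.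
have -> : - p B j i = p B i j.
  rewrite /p -[LHS]mulN1r -exprS; apply: eq_sign_parity.
  have -> : (i < j)%N = ~~ (j < i)%N.
    by case: (ltngtP i j) ij => // /val_inj ->; rewrite eqxx.
  rewrite oddS !oddD !oddb.
  by case: (j < i)%N; do 2!case: (odd _).
congr (_ * (_ * x _)); first by rewrite mulrC.
by rewrite !setDDl setUC.
Qed.

Lemma wedgevv v x : wedge v (wedge v x) = 0.
Proof. by apply: (char0_eqN0 charF); rewrite -wedgeC. Qed.

Lemma coord_vbasis_tnth i k : coord (vbasis {:V}) i (b k) = (i == k)%:R.
Proof.
by rewrite (tnth_nth 0) coord_free 1?eq_sym //; apply: basis_free (vbasisP _).
Qed.

Lemma wedge_basis i (A : ext_basis V) : wedge (b i) (basisv F A) =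
  if i \in A then 0
  else (-1) ^+ #|[set j in A | (j < i)%N]| *: basisv F (i |: A).
Proof.
apply/ffunP => B; rewrite !ffunE.
have -> : \sum_(j in B) (-1) ^+ #|[set k in B | (k < j)%N]|
   * coord (vbasis {:V}) j (b i) * basisv F A (B :\ j) =
   (if i \in B then (-1) ^+ #|[set k in B | (k < i)%N]| * (B :\ i == A)%:R else 0 : F).
  case: ifP => iB; last first.
    rewrite big1 // => j jB; rewrite coord_vbasis_tnth.
    by case: eqVneq jB => [->|]; rewrite ?iB // mulr0 mul0r.
  rewrite (bigD1 i) //= coord_vbasis_tnth eqxx mulr1 basisvE big1 ?addr0 // => j.
  by case/andP=> _ /negPf ji; rewrite coord_vbasis_tnth ji mulr0 mul0r.
case: (boolP (i \in A)) => iA.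
  rewrite [RHS]ffunE; case: ifP => // iB.
  case: eqP => [BA|_]; last by rewrite mulr0.
  by move: iA; rewrite -BA !inE eqxx.
rewrite !ffunE; case: ifP => iB; last first.
  by case: eqP => [BA|_]; [rewrite BA setU11 in iB | rewrite scaler0].
have -> : (B :\ i == A) = (B == i |: A).
  apply/eqP/eqP => [<-|->]; first by rewrite setD1K.
  by rewrite setU1K.
case: eqP => [->|_]; last by rewrite scaler0 mulr0.
rewrite [LHS]mulr1 [RHS]mulr1; congr ((-1) ^+ _).
apply: eq_card => k; rewrite !inE.
by case: eqP => [->|]//=; rewrite ltnn andbF.
Qed.

Definition wedges (l : seq V) z := foldr (@wedge F V) z l.

Fact wedges_is_linear l : linear (wedges l).
Proof. by elim: l => [|v l IH] a x y //=; rewrite IH linearP. Qed.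
HB.instance Definition _ l :=
  GRing.isLinear.Build F (ext F V) (ext F V) *:%R (wedges l)
    (wedges_is_linear l).

Lemma wedges_cat l1 l2 z : wedges (l1 ++ l2) z = wedges l1 (wedges l2 z).
Proof. exact: foldr_cat. Qed.

Lemma wedges_move v l z : wedges l (wedge v z) = (-1) ^+ size l *: wedge v (wedges l z).
Proof.
elim: l => [|u l IH] /=; first by rewrite scale1r.
by rewrite IH linearZ /= wedgeC exprS mulN1r scaleNr scalerN.
Qed.

Lemma wedge_wedges_mem v l z : v \in l -> wedge v (wedges l z) = 0.
Proof.
elim: l => [|u l IH] //=; rewrite inE => /predU1P[->|/IH vl]; first exact: wedgevv.
by rewrite wedgeC vl linear0 oppr0.
Qed.

End OneSpace.
End Wedge.

(** Inserting i in an increasing enumeration: the number of elements before it is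
    the exponent in the sign of [wedge_basis]. *)
Lemma enum_setU1 n (A : {set 'I_n}) i : i \notin A ->
  exists l1 l2, [/\ enum A = l1 ++ l2, enum (i |: A) = l1 ++ i :: l2
    & size l1 = #|[set j in A | (j < i)%N]| ].
Proof.
move=> iA; pose e := enum 'I_n.
have ue : uniq e by exact: enum_uniq.
have szi : (i < size e)%N by rewrite size_enum_ord.
have eE : e = take i e ++ i :: drop i.+1 e.
  by rewrite -[LHS](cat_take_drop i) (drop_nth i) // nth_ord_enum.
have ip1 : i \notin take i e.
  by rewrite in_take ?mem_enum // index_enum_ord ltnn.
have ip2 : i \notin drop i.+1 e.
  by move: ue; rewrite {1}eE cat_uniq => /and3P[_ _ /=/andP[]].
have enumE (B : {set 'I_n}) : enum B = filter (mem B) e.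
  by rewrite /e enumT.
exists (filter (mem A) (take i e)), (filter (mem A) (drop i.+1 e)); split.
- by rewrite enumE {1}eE filter_cat /= (negPf iA).
- rewrite enumE {1}eE filter_cat /= setU11; congr (_ ++ _ :: _).
    apply: eq_in_filter => j jp; rewrite /= !inE.
    by case: eqP jp ip1 => // -> ->.
  apply: eq_in_filter => j jp; rewrite /= !inE.
  by case: eqP jp ip2 => // -> ->.
- rewrite -(card_uniqP _); last by rewrite filter_uniq ?take_uniq.
  apply: eq_card => j; rewrite !inE mem_filter; congr (_ && _).
  by rewrite in_take ?mem_enum // index_enum_ord.
Qed.

Section ExteriorMultiplication.
Variable F : fieldType.
Hypothesis charF : [pchar F] =i pred0.

(** Left multiplication by the image of x under the algebra morphism that f
    induces. Keeping the right factor z as an argument avoids a product on the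
    exterior algebra. *)
Definition extmul (U V : vectType F) (f : U -> V) (x : ext F U) (z : ext F V) :
    ext F V :=
  \sum_(A : ext_basis U) (x A : F) *:
    wedges [seq f (tnth (vbasis {:U}) i) | i <- enum A] z.

Fact extmul_is_linear_l (U V : vectType F) (f : U -> V) (z : ext F V) :
  linear (fun x : ext F U => extmul f x z).
Proof.
move=> a x y; rewrite /extmul scaler_sumr -big_split /=.
by apply: eq_bigr => A _; rewrite !ffunE scalerDl scalerA.
Qed.

Fact ext_map_is_linear (U V : vectType F) (f : U -> V) : linear (ext_map f).
Proof. exact: extmul_is_linear_l. Qed.
HB.instance Definition _ (U V : vectType F) (f : U -> V) :=
  GRing.isLinear.Build F (ext F U) (ext F V) *:%R (@ext_map F U V f)
    (ext_map_is_linear f).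

Definition extmulr (U V : vectType F) (f : U -> V) z x := extmul f x z.
HB.instance Definition _ (U V : vectType F) (f : U -> V) (z : ext F V) :=
  GRing.isLinear.Build F (ext F U) (ext F V) *:%R (@extmulr U V f z)
    (extmul_is_linear_l f z).

Fact extmul_is_linear (U V : vectType F) (f : U -> V) (x : ext F U) :
  linear (extmul f x).
Proof.
move=> a y z; rewrite /extmul scaler_sumr -big_split /=.
by apply: eq_bigr => A _; rewrite linearP /= scalerDr !scalerA mulrC.
Qed.
HB.instance Definition _ (U V : vectType F) (f : U -> V) (x : ext F U) :=
  GRing.isLinear.Build F (ext F V) (ext F V) *:%R (extmul f x)
    (extmul_is_linear f x).

Lemma extmul_basis (U V : vectType F) (f : U -> V) A z :
  extmul f (basisv F A) z =
    wedges [seq f (tnth (vbasis {:U}) i) | i <- enum A] z.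
Proof.
rewrite /extmul (bigD1 A) //= basisvE eqxx scale1r big1 ?addr0 // => B BA.
by rewrite basisvE (negPf BA) scale0r.
Qed.

Lemma vbasis_sum (U : vectType F) (u : U) :
  u = \sum_i coord (vbasis {:U}) i u *: tnth (vbasis {:U}) i.
Proof.
rewrite {1}(coord_vbasis (memvf u)).
by apply: eq_bigr => i _; rewrite (tnth_nth 0).
Qed.

(** The induced map is multiplicative. On basis elements, moving f e_i to its
    place among the factors costs the sign that [wedge] puts on e_i /\ e_A. *)
Lemma extmul_wedge (U V : vectType F) (f : {linear U -> V}) u x z :
  extmul f (wedge u x) z = wedge (f u) (extmul f x z).
Proof.
have keyE i (A : ext_basis U) :
  extmul f (wedge (tnth (vbasis {:U}) i) (basisv F A)) z =
  wedge (f (tnth (vbasis {:U}) i)) (extmul f (basisv F A) z).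
  rewrite wedge_basis extmul_basis; case: ifP => iA.
    rewrite -/(extmulr f z _) linear0 wedge_wedges_mem //.
    by apply: map_f; rewrite mem_enum.
  have [l1 [l2 [-> e2 <-]]] := enum_setU1 (negbT iA).
  rewrite -/(extmulr f z _) linearZ /= /extmulr extmul_basis e2.
  rewrite !map_cat /= !wedges_cat /= wedges_move // size_map scalerA.
  by rewrite -exprD -signr_odd addnn odd_double scale1r.
pose g1 : {linear ext F U -> ext F V} := extmulr f z \o wedge u.
pose g2 : {linear ext F U -> ext F V} := wedge (f u) \o extmulr f z.
rewrite -[LHS]/(g1 x) -[RHS]/(g2 x); apply: linear_freev_eq => A {x}.
rewrite -[LHS]/(extmulr f z (wedge u (basisv F A))).
rewrite -[RHS]/(wedge (f u) (extmul f (basisv F A) z)).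
have -> : f u = \sum_i coord (vbasis {:U}) i u *: f (tnth (vbasis {:U}) i).
  by rewrite {1}[u]vbasis_sum linear_sum; apply: eq_bigr => i _; rewrite linearZ.
rewrite {1}[u]vbasis_sum !wedge_suml linear_sum; apply: eq_bigr => i _.
by rewrite !wedgeZl linearZ /= /extmulr keyE.
Qed.

Lemma extmul_ext_one (U V : vectType F) (f : U -> V) z :
  extmul f (ext_one U) z = z.
Proof. by rewrite extmul_basis enum_set0. Qed.

Lemma ext_map1 (U V : vectType F) (f : U -> V) : ext_map f (ext_one U) = ext_one V.
Proof. exact: extmul_ext_one. Qed.

Lemma ext_map_wedge (U V : vectType F) (f : {linear U -> V}) u x :
  ext_map f (wedge u x) = wedge (f u) (ext_map f x).
Proof. exact: extmul_wedge. Qed.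

Lemma ext_map_wedges (U V : vectType F) (f : {linear U -> V}) l x :
  ext_map f (wedges l x) = wedges (map f l) (ext_map f x).
Proof. by elim: l => [|u l IH] //=; rewrite ext_map_wedge IH. Qed.

Lemma ext_map_extmul (U V W : vectType F) (f : U -> V) (g : {linear V -> W}) x z :
  ext_map g (extmul f x z) = extmul (g \o f) x (ext_map g z).
Proof.
rewrite /extmul linear_sum; apply: eq_bigr => A _.
by rewrite linearZ /= ext_map_wedges -map_comp.
Qed.

Lemma extmul_comp (U V W : vectType F) (f : U -> V) (g : {linear V -> W}) x z :
  extmul g (ext_map f x) z = extmul (g \o f) x z.
Proof.
rewrite -[LHS]/(extmulr g z (extmul f x (ext_one V))) [in LHS]/extmul linear_sum.
apply: eq_bigr => A _; rewrite linearZ /= /extmulr; congr (_ *: _).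
elim: (enum A) => [|i l IH] /=; first exact: extmul_ext_one.
by rewrite extmul_wedge IH.
Qed.

Lemma ext_map_comp (U V W : vectType F) (f : U -> V) (g : {linear V -> W}) x :
  ext_map g (ext_map f x) = ext_map (g \o f) x.
Proof. exact: extmul_comp. Qed.

Lemma eq_extmul (U V : vectType F) (f g : U -> V) : f =1 g -> extmul f =2 extmul g.
Proof.
by move=> fg x z; apply: eq_bigr => A _; rewrite (eq_map (fun i => fg _)).
Qed.

Lemma eq_ext_map (U V : vectType F) (f g : U -> V) : f =1 g -> ext_map f =1 ext_map g.
Proof. by move=> fg x; apply: eq_extmul. Qed.

Lemma wedges_vbasis (U : vectType F) (A : ext_basis U) :
  wedges [seq tnth (vbasis {:U}) i | i <- enum A] (ext_one U) = basisv F A.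
Proof.
have [k le_k] := ubnP #|A|; elim: k => // k IH in A le_k *.
have [->|[i0 i0A]] := set_0Vmem A; first by rewrite enum_set0.
have [i iA imin] := @arg_minnP _ i0 (mem A) val i0A.
pose B := A :\ i; have iB : i \notin B by rewrite !inE eqxx.
have AE : A = i |: B by rewrite setD1K.
have [l1 [l2 [e1 e2 sz]]] := enum_setU1 iB.
have nomin : [set j in B | (j < i)%N] = set0.
  apply/setP => j; rewrite !inE; apply/negP => /andP[/andP[_ jA] ji].
  by have := imin j jA; rewrite leqNgt ji.
have l1E : l1 = [::] by apply/nilP; rewrite /nilp sz nomin cards0.
rewrite AE e2 l1E /= -[l2]/([::] ++ l2) -l1E -e1 IH; last first.
  by rewrite AE cardsU1 iB in le_k.
by rewrite wedge_basis (negPf iB) nomin cards0 scale1r.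
Qed.

(** Graded commutativity. *)
Lemma wedge_extmul (U V : vectType F) (f : U -> V) v k (x : ext F U) z :
  (forall A, x A != 0 -> #|A| = k) ->
  extmul f x (wedge v z) = (-1) ^+ k *: wedge v (extmul f x z).
Proof.
move=> hx; rewrite /extmul linear_sum scaler_sumr; apply: eq_bigr => A _.
rewrite linearZ /= wedges_move // size_map -cardE !scalerA mulrC.
by have [->|/hx ->] := eqVneq (x A) 0; first by rewrite !mulr0 !scale0r.
Qed.

(** A product with v depends on the other factors only modulo v. This lets the
    maps of the cube be computed modulo the vector of a splitting. *)
Lemma wedge_extmul_congr (U V : vectType F) (f g : U -> V) v x z :
  (forall u, exists c, f u = g u + c *: v) ->
  wedge v (extmul f x z) = wedge v (extmul g x z).
Proof.
move=> fg; rewrite /extmul !linear_sum; apply: eq_bigr => A _.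
rewrite !linearZ /=; congr (_ *: _).
elim: (enum A) => [|i l IH] //=.
have [c ->] := fg (tnth (vbasis {:U}) i).
rewrite wedgeDl wedgeZl linearD linearZ /= wedgevv // scaler0 addr0.
by rewrite wedgeC IH -wedgeC.
Qed.

(** Homogeneous of degree k; 0 is homogeneous of every degree. *)
Definition homogeneous (V : vectType F) k (x : ext F V) :=
  forall A : ext_basis V, x A != 0 -> #|A| = k.

Lemma homogeneous_one (V : vectType F) : homogeneous 0 (ext_one V).
Proof.
by move=> A; rewrite basisvE; case: (eqVneq A) => [->|_]; rewrite ?cards0 ?eqxx.
Qed.

Lemma homogeneous_basis (V : vectType F) (A : ext_basis V) :
  homogeneous #|A| (basisv F A).
Proof. by move=> B; rewrite basisvE; case: (eqVneq B) => [->|_]; rewrite ?eqxx. Qed.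

Lemma homogeneous_wedge (V : vectType F) v k (x : ext F V) :
  homogeneous k x -> homogeneous k.+1 (wedge v x).
Proof.
move=> hx B; rewrite ffunE => nz.
have [i iB] : exists2 i, i \in B & x (B :\ i) != 0.
  apply/exists_inP; apply: contraNT nz; rewrite negb_exists_in => /forall_inP xB.
  by rewrite big1 // => i /xB; rewrite negbK => /eqP ->; rewrite mulr0.
by move=> /hx; rewrite (cardsD1 i B) iB => ->.
Qed.

Lemma homogeneous_wedges (V : vectType F) l k (x : ext F V) :
  homogeneous k x -> homogeneous (size l + k) (wedges l x).
Proof. by move=> hx; elim: l => [|v l IH] //=; apply: homogeneous_wedge. Qed.

Lemma homogeneousZ (V : vectType F) a k (x : ext F V) :
  homogeneous k x -> homogeneous k (a *: x).
Proof. by move=> hx A; rewrite ffunE mulf_eq0 negb_or => /andP[_ /hx]. Qed.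

Lemma homogeneous_sum (V : vectType F) (I : finType) (P : pred I)
    (f : I -> ext F V) k :
  (forall i, P i -> homogeneous k (f i)) -> homogeneous k (\sum_(i | P i) f i).
Proof.
move=> hf A; rewrite sum_ffunE => nz.
have [i Pi] : exists2 i, P i & f i A != 0.
  apply/exists_inP; apply: contraNT nz; rewrite negb_exists_in => /forall_inP fA.
  by rewrite big1 // => i /fA; rewrite negbK => /eqP ->.
exact: hf.
Qed.

Lemma homogeneous_extmul (U V : vectType F) (f : U -> V) j k x z :
  homogeneous j x -> homogeneous k z -> homogeneous (j + k) (extmul f x z).
Proof.
move=> hx hz; apply: homogeneous_sum => A _.
have [->|/hx Aj] := eqVneq (x A) 0.
  by move=> B; rewrite scale0r ffunE eqxx.
apply: homogeneousZ; rewrite -Aj cardE -(size_map (fun i => f (tnth (vbasis {:U}) i))).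
exact: homogeneous_wedges.
Qed.

Lemma homogeneous_ext_map (U V : vectType F) (f : U -> V) j x :
  homogeneous j x -> homogeneous j (ext_map f x).
Proof.
by move=> hx; rewrite -[j]addn0; apply: homogeneous_extmul; last exact: homogeneous_one.
Qed.

End ExteriorMultiplication.

(** * The exterior algebra of a direct sum *)

Lemma dim_freev (F : fieldType) (J : finType) : \dim {:freev F J} = #|J|.
Proof. by rewrite dimvf /dim /= muln1. Qed.

Lemma card_ext_basis (F : fieldType) (V : vectType F) :
  #|{: ext_basis V}| = (2 ^ \dim {:V})%N.
Proof. by rewrite -cardsT -powersetT card_powerset cardsT card_ord. Qed.

Lemma surj_dim_bij (F : fieldType) (U V : vectType F) (f : {linear U -> V}) :
  (forall v, exists u, v = f u) -> (\dim {:U} <= \dim {:V})%N -> bijective f.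
Proof.
move=> fsurj dUV.
have im : limg (linfun f) = fullv.
  apply/vspaceP => v; rewrite memvf; have [u ->] := fsurj v.
  by rewrite -[f u]lfunE memv_img ?memvf.
have ker : lker (linfun f) == 0%VS.
  have := limg_ker_dim (linfun f) fullv; rewrite im capfv => e.
  by rewrite -dimv_eq0 -leqn0 -(leq_add2r (\dim {:V})) e add0n.
exists (linfun f)^-1%VF => x; first by rewrite -[f x]lfunE lker0_lfunK.
by rewrite -[LHS]lfunE limg_lfunVK // im memvf.
Qed.

Section TensorExt.
Variable F : fieldType.
Hypothesis charF : [pchar F] =i pred0.
Variables (U W E : vectType F) (f : {linear U -> E}) (g : {linear W -> E}).
Variable s : nat -> nat.

(** The map e_A (x) e_B |-> f(e_A) /\ g(e_B) from the tensor product of two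
    exterior algebras, with a sign that depends on the degree of e_A. *)
Definition tens_ext (x : freev F (ext_basis U * ext_basis W)%type) : ext F E :=
  \sum_p (x p : F) *:
    ((-1) ^+ s #|p.1| *: extmul f (basisv F p.1) (ext_map g (basisv F p.2))).

Fact tens_ext_is_linear : linear tens_ext.
Proof.
move=> a x y; rewrite /tens_ext scaler_sumr -big_split /=.
by apply: eq_bigr => A _; rewrite !ffunE scalerDl [in RHS]scalerA.
Qed.
HB.instance Definition _ :=
  GRing.isLinear.Build F (freev F (ext_basis U * ext_basis W)%type) (ext F E) *:%R
    tens_ext tens_ext_is_linear.

Lemma tens_ext_basis p : tens_ext (basisv F p) =
  (-1) ^+ s #|p.1| *: extmul f (basisv F p.1) (ext_map g (basisv F p.2)).
Proof.
rewrite /tens_ext (bigD1 p) //= basisvE eqxx scale1r big1 ?addr0 // => B BA.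
by rewrite basisvE (negPf BA) scale0r.
Qed.

Lemma tens_ext_prod i (x : ext F U) (y : ext F W) : homogeneous i x ->
  tens_ext [ffun p : ext_basis U * ext_basis W => (x p.1 : F) * y p.2] =
  (-1) ^+ s i *: extmul f x (ext_map g y).
Proof.
move=> hx; rewrite /tens_ext.
under eq_bigr do rewrite ffunE.
rewrite -(pair_bigA_idem _ (fun A B => (x A * y B : F) *: ((-1) ^+ s #|A| *:
   extmul f (basisv F A) (ext_map g (basisv F B))))) /=; last by rewrite addr0.
have -> : extmul f x (ext_map g y) =
   \sum_A (x A : F) *: extmul f (basisv F A) (ext_map g y).
  by rewrite {1}/extmul; apply: eq_bigr => A _; rewrite extmul_basis.
rewrite scaler_sumr; apply: eq_bigr => A _.
have [->|/hx <-] := eqVneq (x A) 0.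
  by rewrite scale0r scaler0 big1 // => B _; rewrite mul0r scale0r.
have -> : extmul f (basisv F A) (ext_map g y) =
   \sum_B (y B : F) *: extmul f (basisv F A) (ext_map g (basisv F B)).
  rewrite {1}[y]freev_sum [ext_map g _]linear_sum [LHS]linear_sum.
  by apply: eq_bigr => B _ /=; rewrite [ext_map g (_ *: _)]linearZ [LHS]linearZ.
rewrite !scaler_sumr; apply: eq_bigr => B _.
by rewrite !scalerA; congr (_ *: _); rewrite mulrC mulrA.
Qed.

Lemma homogeneous_tens_ext (p : (ext_basis U * ext_basis W)%type) :
  homogeneous (#|p.1| + #|p.2|) (tens_ext (basisv F p)).
Proof.
rewrite tens_ext_basis; apply/homogeneousZ/homogeneous_extmul.
  exact: homogeneous_basis.
exact/homogeneous_ext_map/homogeneous_basis.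
Qed.

Hypothesis fg_surj : forall e, exists u w, e = f u + g w.
Hypothesis fg_dim : (\dim {:U} + \dim {:W} = \dim {:E})%N.

(** The dimensions agree, and the image contains 1 and is stable under products
    with vectors of E = f U + g W: a vector g w moves past f(e_A) at the cost
    of a sign. *)
Lemma tens_ext_bij : bijective tens_ext.
Proof.
apply: surj_dim_bij; last first.
  by rewrite !dim_freev card_prod !card_ext_basis -expnD fg_dim.
move=> z; pose I := limg (linfun tens_ext).
suff : z \in I by case/memv_imgP => x _ ->; exists x; rewrite lfunE.
have Ibas A y : extmul f (basisv F A) (ext_map g y) \in I.
  rewrite [y]freev_sum [ext_map g _]linear_sum linear_sum /=.
  apply: memv_suml => B _.
  rewrite /= [ext_map g (_ *: _)]linearZ linearZ memvZ //=.
  have -> : extmul f (basisv F A) (ext_map g (basisv F B)) =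
     linfun tens_ext ((-1) ^+ s #|A| *: basisv F (A, B)).
    by rewrite lfunE linearZ /= tens_ext_basis /= scalerA -exprD -signr_odd
               addnn odd_double scale1r.
  by rewrite memv_img ?memvf.
have Imul x y : extmul f x (ext_map g y) \in I.
  have -> : extmul f x (ext_map g y) =
     \sum_A (x A : F) *: extmul f (basisv F A) (ext_map g y).
    by rewrite {1}/extmul; apply: eq_bigr => A _; rewrite extmul_basis.
  by rewrite memv_suml // => A _; rewrite memvZ.
have Iwedge v x : x \in I -> wedge v x \in I.
  case/memv_imgP => {}x _ ->; rewrite lfunE /= /tens_ext linear_sum memv_suml //.
  move=> p _; rewrite !linearZ /= !memvZ //.
  have [u [w ->]] := fg_surj v; rewrite wedgeDl memvD //.
    by rewrite -extmul_wedge.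
  have := wedge_extmul f (g w) (ext_map g (basisv F p.2))
            (@homogeneous_basis F U p.1).
  move/(congr1 (fun t => (-1) ^+ #|p.1| *: t)).
  rewrite scalerA -expr2 sqrr_sign scale1r => <-.
  by rewrite memvZ // -ext_map_wedge.
have I1 : ext_one E \in I.
  by rewrite -(extmul_ext_one f (ext_one E)) -(ext_map1 g).
rewrite [z]freev_sum memv_suml // => A _; rewrite memvZ // -wedges_vbasis.
by elim: [seq _ | _ <- _] => [|v l IH] //=; apply: Iwedge.
Qed.

End TensorExt.

Section TensorMaps.
Variable F : fieldType.

Fact tensor_map_is_linear (I J I' J' : finType)
  (f : freev F I -> freev F I') (g : freev F J -> freev F J') : linear (tensor_map f g).
Proof.
move=> a x y; rewrite /tensor_map scaler_sumr -big_split /=.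
by apply: eq_bigr => p _; rewrite !ffunE scalerDl [in RHS]scalerA.
Qed.
HB.instance Definition _ (I J I' J' : finType)
  (f : freev F I -> freev F I') (g : freev F J -> freev F J') :=
  GRing.isLinear.Build F (freev F (I * J)%type) (freev F (I' * J')%type) *:%R
    (tensor_map f g) (tensor_map_is_linear f g).

Lemma tensor_map_basis (I J I' J' : finType)
  (f : freev F I -> freev F I') (g : freev F J -> freev F J') p :
  tensor_map f g (basisv F p) =
    [ffun p' : I' * J' => f (basisv F p.1) p'.1 * g (basisv F p.2) p'.2].
Proof.
rewrite /tensor_map (bigD1 p) //= basisvE eqxx scale1r big1 ?addr0 // => q qp.
by rewrite basisvE (negPf qp) scale0r.
Qed.

Variables (H W E H' W' E' : vectType F).
Variables (f : {linear H -> E}) (g : {linear W -> E}).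
Variables (f' : {linear H' -> E'}) (g' : {linear W' -> E'}).
Variables (p : {linear H -> H'}) (q : {linear W -> W'}) (t : {linear E -> E'}).
Variables s s' : nat -> nat.
Hypothesis charF : [pchar F] =i pred0.

(** The three lemmas below compare edge maps of the two cubes. If the diagrams for
    f and g commute, so does the one for [tens_ext]. *)
Lemma tens_ext_merge :
  (forall u, f' (p u) = t (f u)) -> (forall w, g' (q w) = t (g w)) ->
  (forall k, (-1) ^+ s' k = (-1) ^+ s k :> F) ->
  forall x, tens_ext f' g' s' (tensor_map (ext_map p) (ext_map q) x) =
    ext_map t (tens_ext f g s x).
Proof.
move=> fp gq ss x.
pose h1 : {linear _ -> _} := tens_ext f' g' s' \o tensor_map (ext_map p) (ext_map q).
pose h2 : {linear _ -> _} := ext_map t \o tens_ext f g s.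
rewrite -[LHS]/(h1 x) -[RHS]/(h2 x); apply: linear_freev_eq => {x} b.
rewrite -[LHS]/(tens_ext f' g' s' (tensor_map (ext_map p) (ext_map q) (basisv F b))).
rewrite -[RHS]/(ext_map t (tens_ext f g s (basisv F b))).
have hA : homogeneous #|b.1| (ext_map p (basisv F b.1)).
  exact/homogeneous_ext_map/homogeneous_basis.
rewrite tensor_map_basis (tens_ext_prod f' g' s' _ hA).
rewrite tens_ext_basis linearZ /= ss; congr (_ *: _).
rewrite (extmul_comp charF) (ext_map_extmul charF) !(ext_map_comp charF).
by rewrite (eq_ext_map (g := t \o g)) // (eq_extmul (g := t \o f)).
Qed.

Variables (v : E') (eta kappa : F).
Hypothesis fp : forall u, exists c, f' (p u) = t (f u) + c *: v.
Hypothesis gq : forall w, exists c, g' (q w) = t (g w) + c *: v.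

(** Both factors may be changed modulo v in front of v. *)
Lemma wedge_tens_congr (A : ext_basis H) (B : ext_basis W) :
  wedge v (extmul f' (ext_map p (basisv F A)) (ext_map g' (ext_map q (basisv F B)))) =
  wedge v (ext_map t (extmul f (basisv F A) (ext_map g (basisv F B)))).
Proof.
rewrite (extmul_comp charF) (ext_map_extmul charF) !(ext_map_comp charF).
rewrite (wedge_extmul_congr charF (g := t \o f)) //.
set m := [seq (t \o f) (tnth (vbasis {:H}) i) | i <- enum A].
rewrite !extmul_basis -/m.
have mv z z' : wedge v z = wedge v z' -> wedge v (wedges m z) = wedge v (wedges m z').
  by move=> zz; elim: m => [|u m IH] //=; rewrite wedgeC IH -wedgeC.
by apply: mv; apply: wedge_extmul_congr.
Qed.

(** The product with w0 acts on the second tensor factor, past f(e_A): hence the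
    sign (-1) ^+ k, which the exponents s and s' have to absorb. *)
Lemma tens_ext_split_r (w0 : W') : g' w0 = eta *: v ->
  (forall k, (-1) ^+ s' k * (-1) ^+ k = kappa * (-1) ^+ s k) ->
  forall x, tens_ext f' g' s' (tensor_map (ext_map p) (wedge w0 \o ext_map q) x) =
    (kappa * eta) *: wedge v (ext_map t (tens_ext f g s x)).
Proof.
move=> w0E ss x.
pose h1 : {linear _ -> _} :=
  tens_ext f' g' s' \o tensor_map (ext_map p) (wedge w0 \o ext_map q).
pose h2 : {linear _ -> _} :=
  (kappa * eta) \*: (wedge v \o (ext_map t \o tens_ext f g s)).
rewrite -[LHS]/(h1 x) -[RHS]/(h2 x); apply: linear_freev_eq => {x} b.
rewrite -[LHS]/(tens_ext f' g' s' (tensor_map (ext_map p) (wedge w0 \o ext_map q) (basisv F b))).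
rewrite -[RHS]/((kappa * eta) *: wedge v (ext_map t (tens_ext f g s (basisv F b)))).
have hA : homogeneous #|b.1| (ext_map p (basisv F b.1)).
  exact/homogeneous_ext_map/homogeneous_basis.
rewrite tensor_map_basis (tens_ext_prod f' g' s' _ hA) /= (ext_map_wedge charF) w0E wedgeZl.
rewrite linearZ /= (wedge_extmul _ _ _ hA) tens_ext_basis !linearZ /= -wedge_tens_congr.
rewrite !scalerA; congr (_ *: _).
by rewrite -mulrA (mulrC (_ ^+ #|_|)) ss mulrCA [RHS]mulrCA [eta * _]mulrC.
Qed.

Lemma tens_ext_split_l (u0 : H') : f' u0 = eta *: v ->
  (forall k, (-1) ^+ s' k.+1 = kappa * (-1) ^+ s k) ->
  forall x, tens_ext f' g' s' (tensor_map (wedge u0 \o ext_map p) (ext_map q) x) =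
    (kappa * eta) *: wedge v (ext_map t (tens_ext f g s x)).
Proof.
move=> u0E ss x.
pose h1 : {linear _ -> _} :=
  tens_ext f' g' s' \o tensor_map (wedge u0 \o ext_map p) (ext_map q).
pose h2 : {linear _ -> _} :=
  (kappa * eta) \*: (wedge v \o (ext_map t \o tens_ext f g s)).
rewrite -[LHS]/(h1 x) -[RHS]/(h2 x); apply: linear_freev_eq => {x} b.
rewrite -[LHS]/(tens_ext f' g' s' (tensor_map (wedge u0 \o ext_map p) (ext_map q) (basisv F b))).
rewrite -[RHS]/((kappa * eta) *: wedge v (ext_map t (tens_ext f g s (basisv F b)))).
have hA : homogeneous #|b.1|.+1 (wedge u0 (ext_map p (basisv F b.1))).
  exact/homogeneous_wedge/homogeneous_ext_map/homogeneous_basis.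
rewrite tensor_map_basis (tens_ext_prod f' g' s' _ hA) /= (extmul_wedge charF) u0E wedgeZl.
rewrite tens_ext_basis !linearZ /= -wedge_tens_congr ss.
by rewrite !scalerA; congr (_ *: _); rewrite mulrCA [RHS]mulrCA [eta * _]mulrC.
Qed.

End TensorMaps.

(** * Scalars on the edges of a cube *)

Section Cochains.
Variables (F : fieldType) (I : finType).
Implicit Types (T : {set I}) (e f : I).

(** The scalars on the edges of the cube form a 1-cochain c, and c T e is its value
    on the edge from T to e |: T. The holonomy of c around a square face is 1. *)
Definition trivial_face (c : {set I} -> I -> F) T e f :=
  c T e * c (e |: T) f = c T f * c (f |: T) e.

(** A cochain without holonomy in the directions of l is a coboundary there, since
    the cube is simply connected: u is extended one direction at a time. *)
Lemma cube_potential (c : {set I} -> I -> F) (l : seq I) :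
  (forall T e, e \notin T -> c T e != 0) -> uniq l ->
  (forall T e f, e \in l -> f \in l -> e \notin T -> f \notin T -> e != f ->
     trivial_face c T e f) ->
  exists2 u : {set I} -> F, forall T, u T != 0 &
    forall T e, e \in l -> e \notin T -> u (e |: T) = u T * c T e.
Proof.
move=> c0; elim: l => [|m l IH] /=; first by exists (fun=> 1) => // T; apply: oner_neq0.
case/andP=> ml ul triv.
have [|u u0 uE] := IH ul.
  by move=> T e f el fl; apply: triv; rewrite inE (el, fl) orbT.
exists (fun T => if m \in T then u (T :\ m) * c (T :\ m) m else u T) => [T|T e].
  by case: ifP => _ //; rewrite mulf_neq0 ?c0 // !inE eqxx.
rewrite inE => /predU1P[->|el] eT.
  by rewrite setU11 setU1K // (negPf eT).
have em : e != m by apply: contraNneq ml => <-.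
rewrite !inE eq_sym (negPf em) /=; case: ifP => mT; last exact: uE.
have eT' : e \notin T :\ m by rewrite !inE (negPf eT) andbF.
have -> : (e |: T) :\ m = e |: (T :\ m).
  by apply/setP => k; rewrite !inE; case: (eqVneq k e) => // ->; rewrite em.
rewrite uE // -!mulrA; congr (_ * _).
have := triv (T :\ m) e m; rewrite /trivial_face (setD1K mT) => -> //.
- by rewrite inE el orbT.
- by rewrite inE eqxx.
- by rewrite !inE eqxx.
Qed.

End Cochains.

(** * Relations and circuits of a family of vectors *)

Section Matroid.
Variables (F : fieldType) (I : finType) (V : vectType F) (vec : I -> V).
Implicit Types (T C : {set I}) (e f : I) (w z : freev F I).

Definition vspan T : {vspace V} := (\sum_(s in T) <[vec s]>)%VS.
Definition relation w := \sum_i (w i : F) *: vec i == 0.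
Definition supp w : {set I} := [set i | w i != 0].

Lemma suppPn w i : reflect (w i = 0) (i \notin supp w).
Proof. by rewrite inE negbK; apply: eqP. Qed.

Lemma supp_sub w T i : supp w \subset T -> i \notin T -> w i = 0.
Proof. by move=> /subsetP wT iT; apply/suppPn; apply: contra iT => /wT. Qed.

Lemma relationD w z : relation w -> relation z -> relation (w + z).
Proof.
rewrite /relation => /eqP w0 /eqP z0.
under eq_bigr do rewrite ffunE scalerDl.
by rewrite big_split /= w0 z0 addr0.
Qed.

Lemma relationZ a w : relation w -> relation (a *: w).
Proof.
rewrite /relation => /eqP w0; under eq_bigr do rewrite ffunE -scalerA.
by rewrite -scaler_sumr w0 scaler0.
Qed.

Lemma relationB w z : relation w -> relation z -> relation (w - z).
Proof. by move=> wr zr; rewrite -scaleN1r relationD ?relationZ. Qed.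

Lemma vspan_mono T T' : T \subset T' -> (vspan T <= vspan T')%VS.
Proof.
move=> /subsetP TT'; apply/subv_sumP => i iT.
by apply: (sumv_sup i) (TT' i iT) _.
Qed.

Lemma vspanP T e : e \notin T ->
  reflect (exists w, [/\ relation w, w e != 0 & supp w \subset e |: T])
          (vec e \in vspan T).
Proof.
move=> eT; apply: (iffP idP) => [/memv_sumP[v vT ve]|[w [/eqP wr we wT]]].
  have /fin_all_exists[k kP] s : exists k : F, s \in T -> v s = k *: vec s.
    case: (boolP (s \in T)) => [/vT/vlineP[k ->]|_]; first by exists k.
    by exists 0.
  pose w : freev F I := [ffun i => (if i == e then -1 else if i \in T then k i else 0) : F^o].
  exists w; split.
  - rewrite /relation (bigD1 e) //= ffunE eqxx scaleN1r ve addrC subr_eq0.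
    rewrite [X in X == _](bigID (mem T)) /= [X in _ + X]big1 ?addr0; last first.
      by move=> i /andP[ie /negPf iT]; rewrite ffunE iT (negPf ie) scale0r.
    apply/eqP; apply: eq_big => i.
      by case: (boolP (i \in T)) => iT; rewrite ?andbF // andbT; apply: contraNneq eT => <-.
    by case/andP=> ie iT; rewrite ffunE iT (negPf ie) -kP.
  - by rewrite ffunE eqxx oppr_eq0 oner_neq0.
  - apply/subsetP => i; rewrite !inE ffunE; case: (i == e) => //=.
    by case: (i \in T) => //; rewrite eqxx.
move: wr; rewrite (bigD1 e) //= => /eqP; rewrite addr_eq0 => /eqP we'.
have -> : vec e = (w e)^-1 *: (w e *: vec e) by rewrite scalerA mulVf // scale1r.
rewrite we' scalerN memvN memvZ // memv_suml // => i ie.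
have [iT|iT] := boolP (i \in T).
  by rewrite memvZ // /vspan (bigD1 i) //= (subvP (addvSl _ _)) ?memv_line.
by rewrite (supp_sub wT) ?scale0r ?mem0v // !inE negb_or ie.
Qed.

Lemma vspan_exchange T e f : e \notin T -> f \notin T -> e != f ->
  vec f \notin vspan T -> vec f \in vspan (e |: T) -> vec e \in vspan (f |: T).
Proof.
move=> eT fT ef nf /vspanP; case; first by rewrite !inE negb_or eq_sym ef.
move=> w [wr wf wT]; apply/vspanP; first by rewrite !inE negb_or ef.
exists w; split=> //; last by rewrite setUCA.
apply: contraNneq nf => we; apply/vspanP => //; exists w; split=> //.
apply/subsetP => i iw; have := subsetP wT i iw; rewrite !inE.
by case/or3P=> [->|/eqP ie|->]; rewrite ?orbT //; move: iw; rewrite inE ie we eqxx.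
Qed.

(** The relations of minimal support, unique up to a scalar. *)
Definition circuit_vec w :=
  [/\ relation w, w != 0 &
   forall z, relation z -> supp z \subset supp w -> exists k, z = k *: w].

Definition circuit C := exists2 w, circuit_vec w & supp w = C.

Lemma supp0 : supp 0 = set0.
Proof. by apply/setP => i; rewrite !inE ffunE eqxx. Qed.

Lemma supp_eq0 w : (supp w == set0) = (w == 0).
Proof.
apply/eqP/eqP => [w0|->]; last exact: supp0.
by apply/ffunP => i; rewrite ffunE; apply/suppPn; rewrite w0 inE.
Qed.

Lemma suppZ a w : a != 0 -> supp (a *: w) = supp w.
Proof.
by move=> a0; apply/setP => i; rewrite !inE ffunE mulf_eq0 (negPf a0).
Qed.

Lemma suppB w z : supp (w - z) \subset supp w :|: supp z.
Proof.
apply/subsetP => i; rewrite !inE !ffunE; apply: contraR.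
by rewrite negb_or !negbK => /andP[/eqP -> /eqP ->]; rewrite subrr.
Qed.

Lemma circuit_vecZ a w : a != 0 -> circuit_vec w -> circuit_vec (a *: w).
Proof.
move=> a0 [wr w0 wm]; split; first exact: relationZ.
  by rewrite scaler_eq0 negb_or a0.
move=> z zr; rewrite suppZ // => /(wm _ zr)[k ->].
by exists (k / a); rewrite scalerA divfK.
Qed.

(** If some other relation is supported in that of z, subtracting multiples of it
    yields a relation through e of smaller support. *)
Lemma circuit_through z e : relation z -> e \in supp z ->
  exists2 w, circuit_vec w & (e \in supp w) && (supp w \subset supp z).
Proof.
have [k le_k] := ubnP #|supp z|; elim: k => // k IH in z le_k * => zr ez.
have ze : z e != 0 by rewrite inE in ez.
(* either some relation has strictly smaller support, or z is a circuit *)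
case: (boolP [forall T : {set I}, (T \subset supp z) ==>
   ~~ ((vec e \in vspan (T :\ e)) && (e \in T) && (T != supp z))]) => [min|].
  exists z; last by rewrite ez subxx.
  split=> //; first by apply: contraTneq ez => ->; rewrite supp0 inE.
  move=> y yr yz; exists (y e / z e).
  pose y' := y - (y e / z e) *: z.
  have y'r : relation y' by rewrite relationB ?relationZ.
  apply/eqP; rewrite -subr_eq0 -/y'; apply: contraTT min => y'0.
  have [f fy'] : exists f, f \in supp y'.
    by apply/set0Pn; rewrite supp_eq0.
  have y'e : y' e = 0 by rewrite !ffunE [_ *: _]divfK // subrr.
  have y'z : supp y' \subset supp z.
    apply: subset_trans (suppB _ _) _; rewrite subUset yz.
    apply/subsetP => i; rewrite !inE ffunE; apply: contraNneq => ->.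
    by rewrite scaler0.
  have fe : f != e by apply: contraTneq fy' => ->; apply/suppPn.
  have fz : f \in supp z by apply: (subsetP y'z).
  have y'f : y' f != 0 by rewrite inE in fy'.
  pose z' := z - (z f / y' f) *: y'.
  rewrite negb_forall; apply/existsP; exists (supp z :\ f).
  rewrite negb_imply subD1set /= negbK -andbA.
  have -> /= : e \in supp z :\ f by rewrite in_setD1 ez eq_sym fe.
  have -> : supp z :\ f != supp z.
    by apply: contraTneq fz => <-; rewrite !inE eqxx.
  rewrite andbT; apply/vspanP; first by rewrite !inE eqxx.
  exists z'; split; first by rewrite relationB ?relationZ.
    by rewrite /z' 3!ffunE y'e scaler0 subr0.
  have ezf : e \in supp z :\ f by rewrite in_setD1 ez eq_sym fe.
  rewrite setD1K //; apply/subsetP => i iz'; rewrite in_setD1; apply/andP; split.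
    apply: contraTneq iz' => ->; apply/suppPn.
    by rewrite /z' 3!ffunE [_ *: _]divfK ?subrr.
  have /subsetP/(_ i iz') := suppB z ((z f / y' f) *: y').
  rewrite in_setU => /orP[//|]; rewrite inE ffunE => iy.
  apply: (subsetP y'z); rewrite inE; apply: contraNneq iy => ->.
  by rewrite scaler0.
rewrite negb_forall => /existsP[T]; rewrite negb_imply negbK -andbA.
case/and4P=> Tz /vspanP; case; first by rewrite !inE eqxx.
move=> y [yr ye yT] eT Tne; rewrite setD1K // in yT.
have yz : supp y \proper supp z.
  apply: sub_proper_trans yT _.
  by rewrite properEneq Tne.
have [||w wc /andP[ew wy]] := IH y _ yr; last by exists w; rewrite ?ew ?(subset_trans wy) ?proper_sub.
  by apply: leq_trans (proper_card yz) _; rewrite -ltnS.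
by rewrite inE.
Qed.

End Matroid.

Section Circuits.
Variables (F : fieldType) (I : finType) (V : vectType F) (vec : I -> V).
Implicit Types (T C : {set I}) (e f : I) (w z : freev F I).

Local Notation circuit := (circuit vec).
Local Notation circuit_vec := (circuit_vec vec).
Local Notation vspan := (vspan vec).
Local Notation relation := (relation vec).

Lemma circuit_dep C e : circuit C -> e \in C -> vec e \in vspan (C :\ e).
Proof.
case=> w [wr w0 wm] wC eC; apply/vspanP; first by rewrite !inE eqxx.
exists w; rewrite setD1K // -wC subxx; split=> //.
by move: eC; rewrite -wC inE.
Qed.

Lemma circuit_indep C T e f : circuit C -> e \in C -> f \in C -> e != f ->
  e \notin T -> e |: T \subset C :\ f -> vec e \notin vspan T.
Proof.
case=> w [wr w0 wm] wC eC fC ef eT TC; apply/vspanP => // -[z [zr ze zT]].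
have zC := subset_trans zT TC.
have [|k zE] := wm z zr; first by rewrite wC (subset_trans zC) // subD1set.
have : z f = 0 by apply: supp_sub zC _; rewrite !inE eqxx.
move: fC ze; rewrite -wC inE zE !ffunE => wf.
by move=> /negP kwe /eqP; rewrite mulf_eq0 (negPf wf) orbF => /eqP k0;
  apply: kwe; rewrite k0 scale0r.
Qed.

Definition circuitb C :=
  (C != set0) && [forall e in C, (vec e \in vspan (C :\ e)) &&
     [forall f in C, (f != e) ==> (vec e \notin vspan (C :\ e :\ f))]].

Lemma circuitP C : reflect (circuit C) (circuitb C).
Proof.
apply: (iffP andP) => [[/set0Pn[e eC] /forall_inP Cmin]|cC]; last first.
  split; first by case: cC => w [_ w0 _] <-; rewrite supp_eq0.
  apply/forall_inP => e eC; rewrite circuit_dep //=.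
  apply/forall_inP => f fC; apply/implyP => fe.
  apply: (circuit_indep cC eC fC); first by rewrite eq_sym.
    by rewrite !inE eqxx andbF.
  apply/subsetP => i; rewrite !inE => /orP[/eqP ->|/and3P[-> _ ->]] //.
  by rewrite eC eq_sym fe.
have /andP[/vspanP] := Cmin e eC; case; first by rewrite !inE eqxx.
move=> w [wr we]; rewrite setD1K // => wC /forall_inP emin.
have wCE : supp w = C.
  apply/eqP; rewrite eqEsubset wC; apply/subsetP => f fC.
  apply: contraT => fw; have fe : f != e.
    by apply: contraNneq fw => ->; rewrite inE.
  have /implyP/(_ fe)/negP[] := emin f fC.
  apply/vspanP; first by rewrite !inE eqxx andbF.
  exists w; split=> //; apply/subsetP => i iw; rewrite !inE.
  have [//|ie /=] := eqVneq i e.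
  by rewrite (subsetP wC) // andbT; apply: contraNneq fw => <-.
exists w => //; split=> //; first by rewrite -supp_eq0 wCE; apply/set0Pn; exists e.
move=> z zr zC; exists (z e / w e); apply/eqP; rewrite -subr_eq0.
set z' := _ - _; apply: contraT; rewrite -supp_eq0 => /set0Pn[g gz'].
have z'C : supp z' \subset C.
  apply: subset_trans (suppB _ _) _; rewrite subUset -wCE zC.
  apply/subsetP => i; rewrite !inE ffunE; apply: contraNneq => ->.
  by rewrite scaler0.
have z'e : z' e = 0 by rewrite !ffunE [_ *: _]divfK // subrr.
have ge : g != e by apply: contraTneq gz' => ->; apply/suppPn.
have gC := subsetP z'C g gz'.
have /andP[_ /forall_inP/(_ e eC)] := Cmin g gC.
rewrite eq_sym ge /= => /negP[]; apply/vspanP; first by rewrite !inE eqxx andbF.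
exists z'; split; [by rewrite relationB ?relationZ | by rewrite inE in gz' |].
apply/subsetP => i iz'; rewrite !inE.
have [//|ig /=] := eqVneq i g.
by rewrite (subsetP z'C) // andbT; apply: contraTneq iz' => ->; apply/suppPn.
Qed.

(** The relations supported in two circuits form a pencil, and two generators of
    it coincide on the common part of their supports. In a graph, the circuits
    of w, w1 and w - w1 then are the three cycles of a theta graph. *)
Definition theta_pair w w1 :=
  [/\ relation w, relation w1,
      forall i, i \in supp w -> i \in supp w1 -> w i = w1 i,
      (exists i, i \in supp w :&: supp w1) &
      forall z, relation z -> supp z \subset supp w :|: supp w1 ->
        exists a b, z = a *: w + b *: w1].

Lemma theta_pair_supp w w1 : theta_pair w w1 ->
  supp (w - w1) = (supp w :\: supp w1) :|: (supp w1 :\: supp w).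
Proof.
case=> _ _ ww1 _ _; apply/setP => i; rewrite in_setU !in_setD.
have [iw|/suppPn iw] := boolP (i \in supp w); have [iw1|/suppPn iw1] := boolP (i \in supp w1).
- by rewrite inE !ffunE ww1 // subrr eqxx.
- by rewrite inE !ffunE iw1 subr0; rewrite inE in iw.
- by rewrite inE !ffunE iw sub0r oppr_eq0; rewrite inE in iw1.
- by rewrite inE !ffunE iw iw1 subrr eqxx.
Qed.

Lemma theta_pair_sub w w1 : theta_pair w w1 -> (exists i, i \in supp w :\: supp w1) ->
  theta_pair w (w - w1).
Proof.
move=> th [i iD]; have sE := theta_pair_supp th.
case: th => wr w1r ww1 _ gen; split=> //.
- exact: relationB.
- move=> j jw; rewrite sE !inE => jD; move: (jw); rewrite inE => wj0.
  move: jD; rewrite wj0 /= andbT orbF negbK => /eqP w1j.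
  by rewrite !ffunE w1j subr0.
- by exists i; move: iD; rewrite in_setI sE !inE => /andP[-> ->].
- move=> z zr zS; have [|a [b ->]] := gen z zr.
    apply: subset_trans zS _; rewrite subUset subsetUl sE.
    by apply/subsetP => j; rewrite !inE => /orP[] /andP[_ ->]; rewrite ?orbT.
  exists (a + b), (- b); rewrite scaleNr scalerBr opprB scalerDl -addrA; congr (_ + _).
  by rewrite addrC subrK.
Qed.

Hypothesis charF : [pchar F] =i pred0.
Hypothesis unimodular : forall w, circuit_vec w ->
  exists2 k, k != 0 & forall i, i \in supp w -> w i = k \/ w i = - k.

Lemma circuit_unit C : circuit C ->
  exists2 w, circuit_vec w & supp w = C /\
    forall i, i \in C -> w i = 1 \/ w i = - 1.
Proof.
case=> w wc wC; have [k k0 wk] := unimodular wc.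
exists (k^-1 *: w); first by apply: circuit_vecZ; rewrite ?invr_eq0.
rewrite suppZ ?invr_eq0 //; split=> // i; rewrite -wC => /wk; rewrite !ffunE.
by case=> ->; [left; rewrite [LHS]mulVf | right; rewrite [LHS]mulrN mulVf].
Qed.

Lemma circuit_sub C C' : circuit C -> circuit C' -> C \subset C' -> C = C'.
Proof.
case=> w [wr w0 _] <- [w' [w'r w'0 wm] <-] /(wm _ wr)[k wE].
by move: w0; rewrite wE scaler_eq0 negb_or => /andP[k0 _]; rewrite suppZ.
Qed.

(** Take a circuit C1 in the union of C and C', not within C, that adds as few
    elements to C as possible: by minimality every relation supported in the
    union of C and C1 is a combination of those of C and C1. The two relations
    can be scaled to agree at one common element, and unimodularity forces them
    to agree at the others. As C1 leaves C only inside C', the circuits of the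
    theta other than C are closer to C' than C is. *)
Lemma theta_exists C C' : circuit C -> circuit C' -> C != C' -> C :&: C' != set0 ->
  exists w w1, [/\ theta_pair w w1, supp w = C, circuit (supp w1), circuit (supp (w - w1)) &
    [/\ supp w1 :\: C != set0, supp w1 :\: C \subset C' & C :\: supp w1 != set0]].
Proof.
move=> cC cC' neC meet.
have : exists C1 : {set I}, [&& circuitb C1, C1 \subset C :|: C' & ~~ (C1 \subset C)].
  exists C'; rewrite subsetUr (introT (circuitP _)) //=.
  by apply: contra neC => /(circuit_sub cC' cC) ->.
case=> C0 C0P.
have [C1 /and3P[/circuitP cC1 C1U nC1] C1min] :=
  @arg_minnP _ C0 (fun C1 => [&& circuitb C1, C1 \subset C :|: C' & ~~ (C1 \subset C)])
    (fun C1 => #|C1 :\: C|) C0P.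
have [w wc [wC w1E]] := circuit_unit cC.
have [w1' w1'c [w1'C w1'E]] := circuit_unit cC1.
have [d dC1 dC] : exists2 d, d \in C1 & d \notin C by apply/subsetPn.
have DC' : C1 :\: C \subset C'.
  apply/subsetP => i; rewrite inE => /andP[iC iC1].
  by have := subsetP C1U i iC1; rewrite inE (negPf iC).
have [e0 e0A] : exists e0, e0 \in C :&: C1.
  apply/set0Pn; apply: contra_neq neC => A0.
  have C1C' : C1 \subset C'.
    apply: subset_trans DC'; apply/subsetP => i iC1; rewrite inE iC1 andbT.
    by apply/negP => iC; move/setP/(_ i): A0; rewrite !inE iC iC1.
  move: meet; rewrite -(circuit_sub cC1 cC' C1C') => /set0Pn[i].
  by rewrite A0 inE.
have [e0C e0C1] : e0 \in C /\ e0 \in C1 by apply/andP; rewrite -in_setI.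
have [k [k0 w1c w1C w1u w1e0]] : exists k, [/\ k != 0, circuit_vec (k *: w1'),
    supp (k *: w1') = C1, forall i, i \in C1 -> (k *: w1') i = 1 \/ (k *: w1') i = -1
    & (k *: w1') e0 = w e0].
  have [same|opp] : w1' e0 = w e0 \/ w1' e0 = - w e0.
    by case: (w1E e0 e0C) => ->; case: (w1'E e0 e0C1) => ->; rewrite ?opprK; auto.
    by exists 1; rewrite scale1r oner_neq0.
  exists (-1); rewrite oppr_eq0 oner_neq0 suppZ ?oppr_eq0 ?oner_neq0 //.
  rewrite !ffunE opp; split=> //; first by apply: circuit_vecZ; rewrite ?oppr_eq0 ?oner_neq0.
    move=> i /w1'E; rewrite !ffunE => -[] ->.
      by right; rewrite [LHS]mulr1.
    by left; rewrite [LHS]mulrNN mulr1.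
  by rewrite [LHS]mulrNN mul1r.
move: (k *: w1') => w1 in w1c w1C w1u w1e0 *.
have [wr w0 wm] := wc; have [w1r w10 w1m] := w1c.
(* otherwise a relation that avoids d would reach out of C by fewer elements *)
have gen z : relation z -> supp z \subset supp w :|: supp w1 ->
    exists a b, z = a *: w + b *: w1.
  rewrite wC w1C => zr zU.
  have w1d : w1 d != 0 by rewrite -w1C inE in dC1.
  pose z' := z - (z d / w1 d) *: w1.
  have z'r : relation z' by rewrite relationB ?relationZ.
  have z'd : z' d = 0 by rewrite !ffunE [_ *: _]divfK // subrr.
  have z'U : supp z' \subset C :|: C1.
    apply: subset_trans (suppB _ _) _; rewrite subUset zU.
    apply/subsetP => i; rewrite !inE ffunE => i0; apply/orP; right.
    by rewrite -w1C inE; apply: contraNneq i0 => ->; rewrite scaler0.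
  have z'C : supp z' \subset supp w.
    rewrite wC; apply/subsetP => f fz'; apply: contraT => fC.
    have [w3 w3c /andP[fw3 w3z']] := circuit_through z'r fz'.
    have dw3 : d \notin supp w3.
      by apply: (contra (subsetP w3z' d)); apply/suppPn.
    have w3U := subset_trans w3z' z'U.
    have : (#|C1 :\: C| <= #|supp w3 :\: C|)%N.
      apply: C1min; apply/and3P; split.
      - by apply/circuitP; exists w3.
      - apply: subset_trans w3U _; rewrite subUset subsetUl.
        exact: C1U.
      - by apply/subsetPn; exists f.
    rewrite leqNgt => /negP[]; apply: proper_card; apply/properP; split.
      apply/subsetP => i; rewrite !in_setD => /andP[iC iw3]; rewrite iC /=.
      by have := subsetP w3U i iw3; rewrite in_setU (negPf iC).
    by exists d; rewrite inE dC ?dC1 // negb_and dw3 orbT.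
  have [k' kE] := wm z' z'r z'C.
  by exists k', (z d / w1 d); rewrite -kE subrK.
(* the multiples of w1 - w are the relations of the pencil that vanish at e0 *)
have Dd : (w1 - w) d = w1 d.
  by rewrite !ffunE (_ : w d = 0) ?subr0 //; apply/suppPn; rewrite wC.
have dne : (w1 - w) != 0.
  apply: contraTneq dC1 => /ffunP/(_ d); rewrite Dd ffunE -w1C => w1d0.
  by apply/suppPn.
have cD : circuit_vec (w1 - w).
  split=> //; first exact: relationB.
  move=> y yr yD; have [|a [b yE]] := gen y yr.
    by apply: subset_trans yD _; rewrite setUC suppB.
  have : y e0 = 0.
    by apply: supp_sub yD _; apply/suppPn; rewrite !ffunE w1e0 subrr.
  rewrite yE !ffunE w1e0 -scalerDl => /eqP; rewrite mulf_eq0.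
  have -> /= : w e0 == 0 = false.
    by apply/negbTE; move: e0C; rewrite -wC inE.
  by rewrite orbF addr_eq0 => /eqP ->; exists b; rewrite scalerBr scaleNr addrC.
have agree i : i \in supp w -> i \in supp w1 -> w i = w1 i.
  rewrite wC w1C => iC iC1; have [//|opp] : w i = w1 i \/ w i = - w1 i.
    by case: (w1E i iC) => ->; case: (w1u i iC1) => ->; rewrite ?opprK; auto.
  have w1i0 : w1 i != 0 by rewrite -w1C inE in iC1.
  (* if w i = - w1 i, then w1 - w would have the entries 2 * w1 i and w1 d, whose
     squares differ *)
  have two : (2%:R : F) != 0 by rewrite char0_natr_eq0.
  have three : (3%:R : F) != 0 by rewrite char0_natr_eq0.
  have Di : (w1 - w) i = w1 i *+ 2 by rewrite !ffunE opp opprK mulr2n.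
  have [k'' k''0 kP] := unimodular cD.
  have dD : d \in supp (w1 - w) by rewrite inE Dd -w1C inE in dC1 *.
  have iD : i \in supp (w1 - w) by rewrite inE Di -mulr_natr mulf_neq0.
  have sq (x y : F) : x = y \/ x = - y -> x ^+ 2 = y ^+ 2.
    by case=> ->; rewrite ?sqrrN.
  have := sq _ _ (kP d dD); rewrite -(sq _ _ (kP i iD)) Di Dd.
  rewrite exprMn_n (sq _ _ (w1u i iC1)) (sq _ _ (w1u d dC1)) expr1n => /eqP.
  by rewrite eq_sym -subr_eq0 -(natrB _ (isT : (1 <= 4)%N)) (negPf three).
exists w, w1; split=> //.
- by split=> //; exists e0; rewrite wC w1C.
- by exists w1.
- by exists (w1 - w) => //; rewrite -opprB -scaleN1r suppZ // oppr_eq0 oner_neq0.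
- rewrite w1C; split=> //; first by apply/set0Pn; exists d; rewrite inE dC.
  rewrite setD_eq0; apply: contra nC1 => CC1.
  by rewrite (circuit_sub cC cC1 CC1).
Qed.

End Circuits.

(** * Holonomy around circuits *)

Section Holonomy.
Variables (F : fieldType) (I : finType) (V : vectType F) (vec : I -> V).
Implicit Types (T C : {set I}) (e f r s : I) (w z : freev F I).

Local Notation circuit := (circuit vec).
Local Notation circuit_vec := (circuit_vec vec).
Local Notation vspan := (vspan vec).
Local Notation relation := (relation vec).

(** e and f become parallel non-zero vectors in the quotient by the span of T. *)
Definition parallel T e f :=
  [&& vec e \notin vspan T, vec f \notin vspan T & vec f \in vspan (e |: T)].

Lemma parallelC T e f : e \notin T -> f \notin T -> e != f ->
  parallel T e f -> parallel T f e.
Proof.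
by move=> eT fT ef /and3P[ne nf ef']; rewrite /parallel ne nf /= vspan_exchange.
Qed.

Variable c : {set I} -> I -> F.
Hypothesis c_neq0 : forall T e, e \notin T -> c T e != 0.

(** The holonomy is 1 except around the faces whose directions have opposite signs
    and are parallel in the quotient by the span of T. *)
Definition flat_off (pos : {set I}) := forall T e f,
  e \notin T -> f \notin T -> e != f ->
  ~~ (((e \in pos) (+) (f \in pos)) && parallel T e f) -> trivial_face c T e f.

Definition holonomy T e f := c T e * c (e |: T) f / (c T f * c (f |: T) e).

Lemma holonomyV T e f : (holonomy T e f)^-1 = holonomy T f e.
Proof. by rewrite /holonomy invf_div. Qed.

Lemma flat_offC pos : flat_off pos -> flat_off (~: pos).
Proof.
move=> flat T e f eT fT ef nP; apply: flat => //; apply: contra nP.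
by rewrite !inE; case: (e \in pos); case: (f \in pos).
Qed.

(** On the positive directions c is the coboundary of some u. Dividing by it leaves
    the scalar f T of the edge from T in direction s, and the holonomy is the
    change of f as r is added. By flatness f T changes only when vec s enters
    the span of T, so it takes two values, which depend only on T minus the
    positive directions. *)
Lemma holonomy_negative pos T T' r r' s : flat_off pos ->
  r \in pos -> r' \in pos -> s \notin pos -> r \notin T -> r' \notin T' ->
  s \notin T -> s \notin T' -> parallel T r s -> parallel T' r' s ->
  T :\: pos = T' :\: pos -> holonomy T r s = holonomy T' r' s.
Proof.
move=> flat rp rp' sp rT rT' sT sT' pr pr' TT'.
have [|u u0 uE] := @cube_potential _ _ c (enum pos) c_neq0 (enum_uniq _).
  move=> T0 e f; rewrite !mem_enum => ep fp eT fT ef; apply: flat => //.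
  by rewrite ep fp.
have {}uE T0 e : e \in pos -> e \notin T0 -> u (e |: T0) = u T0 * c T0 e.
  by move=> ep; apply: uE; rewrite mem_enum.
pose f T0 := c T0 s * u T0 / u (s |: T0).
have holE T0 r0 : r0 \in pos -> r0 \notin T0 -> s \notin T0 ->
    holonomy T0 r0 s = f (r0 |: T0) / f T0.
  move=> r0p r0T sT0; have sr : s != r0 by apply: contraNneq sp => ->.
  rewrite /f /holonomy uE // setUCA uE //; last by rewrite !inE negb_or eq_sym sr.
  have := c_neq0 sT0; have := c_neq0 r0T; have := u0 T0; have := u0 (s |: T0).
  have : c (s |: T0) r0 != 0 by rewrite c_neq0 // !inE negb_or eq_sym sr.
  by move=> h1 h2 h3 h4 h5; field; rewrite ?h1 ?h2 ?h3 ?h4 ?h5.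
have f0 T0 : s \notin T0 -> f T0 != 0.
  by move=> sT0; rewrite !mulf_neq0 ?invr_eq0 ?c_neq0.
have step T0 r0 : r0 \in pos -> r0 \notin T0 -> s \notin T0 ->
    ~~ parallel T0 r0 s -> f (r0 |: T0) = f T0.
  move=> r0p r0T sT0 np; have sr : r0 != s by apply: contraNneq sp => <-.
  apply: (mulIf (x := (f T0)^-1)); rewrite ?invr_eq0 ?f0 //.
  rewrite -holE // mulfV ?f0 //.
  have := flat T0 r0 s r0T sT0 sr; rewrite /trivial_face (negPf np) andbF /holonomy.
  move=> -> //; rewrite divff // mulf_neq0 ?c_neq0 //.
  by rewrite !inE negb_or sr.
(* outside the span of T0, positive elements can be removed ... *)
have down T0 : s \notin T0 -> vec s \notin vspan T0 -> f T0 = f (T0 :\: pos).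
  have [k le_k] := ubnP #|T0 :&: pos|; elim: k => // k IH in T0 le_k * => sT0 nT0.
  have [E|[r0]] := set_0Vmem (T0 :&: pos).
    by congr f; apply/esym/setDidPl; rewrite -setI_eq0 E.
  rewrite inE => /andP[r0T r0p].
  have T0E : r0 |: (T0 :\ r0) = T0 by rewrite setD1K.
  have nr0 : r0 \notin T0 :\ r0 by rewrite !inE eqxx.
  have s0 : s \notin T0 :\ r0 by rewrite !inE negb_and sT0 orbT.
  have sub : (vspan (T0 :\ r0) <= vspan T0)%VS by rewrite vspan_mono ?subD1set.
  have -> : T0 :\: pos = (T0 :\ r0) :\: pos.
    apply/setP => i; rewrite !inE; case: (eqVneq i r0) => // ->.
    by rewrite r0p.
  rewrite -IH //; last first.
    by apply: contra nT0; apply: (subvP sub).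
    rewrite setIDAC; move: le_k; rewrite (cardsD1 r0 (T0 :&: pos)).
    by rewrite inE r0T r0p.
  rewrite -{1}T0E step // /parallel T0E (negPf nT0).
  by rewrite !andbF.
(* ... and inside it they can be added *)
have up T0 : s \notin T0 -> vec s \in vspan T0 -> f T0 = f (T0 :|: pos).
  have [k le_k] := ubnP #|pos :\: T0|; elim: k => // k IH in T0 le_k * => sT0 iT0.
  have [E|[r0]] := set_0Vmem (pos :\: T0).
    by congr f; apply/esym/setUidPl; rewrite -setD_eq0 E.
  rewrite inE => /andP[r0T r0p].
  have -> : T0 :|: pos = (r0 |: T0) :|: pos.
    apply/setP => i; rewrite !inE; case: (eqVneq i r0) => // ->.
    by rewrite r0p orbT.
  rewrite -IH //.
  - rewrite step // /parallel iT0; by rewrite andbF.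
  - move: le_k; rewrite (cardsD1 r0 (pos :\: T0)) inE r0T r0p add1n ltnS.
    by rewrite setDDl setUC.
  - by rewrite !inE negb_or sT0 andbT; apply: contraNneq sp => ->.
  - by apply: subvP iT0; rewrite vspan_mono ?subsetUr.
have fE T0 r0 : r0 \in pos -> r0 \notin T0 -> s \notin T0 -> parallel T0 r0 s ->
    holonomy T0 r0 s = f ((T0 :\: pos) :|: pos) / f (T0 :\: pos).
  move=> r0p r0T sT0 /and3P[_ n1 n2]; rewrite holE // -down // up //; last first.
    by rewrite !inE negb_or sT0 andbT; apply: contraNneq sp => ->.
  congr (f _ / _); apply/setP => i; rewrite !inE.
  case: (eqVneq i r0) => [->|_] /=; first by rewrite r0p.
  by case: (i \in pos); rewrite ?orbT ?orbF.
by rewrite fE // [RHS]fE // TT'.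
Qed.

(** The same with the signs exchanged. *)
Lemma holonomy_positive pos T T' r s s' : flat_off pos ->
  r \in pos -> s \notin pos -> s' \notin pos -> r \notin T -> r \notin T' ->
  s \notin T -> s' \notin T' -> parallel T r s -> parallel T' r s' ->
  T :&: pos = T' :&: pos -> holonomy T r s = holonomy T' r s'.
Proof.
move=> flat rp sp sp' rT rT' sT sT' pr pr' TT'.
apply: invr_inj; rewrite !holonomyV.
have rs : r != s by apply: contraNneq sp => <-.
have rs' : r != s' by apply: contraNneq sp' => <-.
apply: (holonomy_negative (flat_offC flat)); rewrite ?inE ?negbK //.
- exact: parallelC.
- exact: parallelC.
- by rewrite !setDE setCK.
Qed.

Variable pos : {set I}.
Hypothesis flat : flat_off pos.

(** Only circuits with elements of both signs carry a holonomy. *)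
Definition mixed C := (C :&: pos != set0) && (C :\: pos != set0).

(** The value 1 stands for the circuits that are not mixed; on a mixed circuit the
    choice of r and s is irrelevant by [holonomy_circuit]. *)
Definition circuit_holonomy C :=
  if [pick r in C :&: pos] is Some r then
    if [pick s in C :\: pos] is Some s then holonomy (C :\ r :\ s) r s else 1
  else 1.

Lemma circuit_parallel C r s : circuit C -> r \in C -> s \in C -> r != s ->
  parallel (C :\ r :\ s) r s.
Proof.
move=> cC rC sC rs; apply/and3P; split.
- apply: (circuit_indep cC rC sC) => //; first by rewrite !inE eqxx andbF.
  by apply/subsetP => i; rewrite !inE => /predU1P[->|/and3P[-> _ ->]]; rewrite ?rs.
- apply: (circuit_indep cC sC rC); rewrite 1?eq_sym //.
    by rewrite !inE eqxx.
  apply/subsetP => i; rewrite !inE => /predU1P[->|/and3P[_ -> ->]] //.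
  by rewrite eq_sym rs.
- have -> : r |: C :\ r :\ s = C :\ s.
    apply/setP => i; rewrite !inE; case: (eqVneq i r) => [->|] //=.
    by rewrite rs rC.
  exact: circuit_dep.
Qed.

(** By the two lemmas above, the holonomy sees only the negative part of T and s,
    and only the positive part of T and r. Hence T can be cut down to the
    circuit in two steps, and r and s can be exchanged for other elements. *)
Lemma holonomy_circuit T r s C : r \in pos -> s \notin pos ->
  r \notin T -> s \notin T -> parallel T r s ->
  circuit C -> r \in C -> s \in C -> C \subset r |: (s |: T) ->
  holonomy T r s = circuit_holonomy C.
Proof.
move=> rp sp rT sT pT cC rC sC CT.
have ne x y : x \in pos -> y \notin pos -> x != y.
  by move=> xp yp; apply: contraNneq yp => <-.
have notr x y : x \notin C :\ x :\ y by rewrite !inE eqxx andbF.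
have nots x y : y \notin C :\ x :\ y by rewrite !inE eqxx.
have indep r0 r1 s0 s1 : r0 \in pos -> r1 \in pos -> s0 \notin pos -> s1 \notin pos ->
    r0 \in C -> r1 \in C -> s0 \in C -> s1 \in C ->
    holonomy (C :\ r0 :\ s0) r0 s0 = holonomy (C :\ r1 :\ s1) r1 s1.
  move=> r0p r1p s0p s1p r0C r1C s0C s1C.
  rewrite (@holonomy_negative pos _ (C :\ r1 :\ s0) r0 r1 s0) ?circuit_parallel ?ne //.
    rewrite (@holonomy_positive pos _ (C :\ r1 :\ s1) r1 s0 s1) ?circuit_parallel ?ne //.
    apply/setP => i; rewrite !inE; case: (boolP (i \in pos)) => ip; rewrite ?andbF ?andbT //.
    by rewrite (ne i s0) // (ne i s1).
  apply/setP => i; rewrite !inE; case: (boolP (i \in pos)) => ip //=.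
  by rewrite !(eq_sym i) (ne r0 i) // (ne r1 i).
transitivity (holonomy (C :\ r :\ s) r s).
  (* T1 has the negative part of T and the positive part of the circuit *)
  pose T1 := (T :\: pos) :|: ((C :\ r :\ s) :&: pos).
  have subT : C :\ r :\ s \subset T.
    apply/subsetP => i; rewrite !inE => /and3P[iss ir iC].
    by have := subsetP CT i iC; rewrite !inE (negPf iss) (negPf ir).
  have T1T : T1 \subset T.
    by rewrite subUset subsetDl (subset_trans (subsetIl _ _)).
  have CT1 : C :\ r :\ s \subset T1.
    apply/subsetP => i iC; rewrite in_setU in_setD in_setI iC (subsetP subT) //.
    by case: (i \in pos).
  have rT1 : r \notin T1 by apply: contra rT; apply: (subsetP T1T).
  have sT1 : s \notin T1 by apply: contra sT; apply: (subsetP T1T).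
  have pT1 : parallel T1 r s.
    case/and3P: pT => n1 n2 _; apply/and3P; split.
    - by apply: contra n1; apply: subvP; rewrite vspan_mono.
    - by apply: contra n2; apply: subvP; rewrite vspan_mono.
    - have /and3P[_ _] := circuit_parallel cC rC sC (ne _ _ rp sp).
      by apply: subvP; rewrite vspan_mono ?setUS.
  rewrite (@holonomy_negative pos T T1 r r s) //; last first.
    apply/setP => i; rewrite !inE; case: (i \in pos) => //=.
    by rewrite andbF orbF.
  rewrite (@holonomy_positive pos T1 (C :\ r :\ s) r s s) ?circuit_parallel ?ne //.
  apply/setP => i; rewrite !inE; case: (i \in pos); rewrite ?andbF ?andbT //=.
rewrite /circuit_holonomy; case: pickP => [r' |/(_ r)]; last by rewrite inE rC rp.
rewrite inE => /andP[r'C r'p]; case: pickP => [s'|/(_ s)]; last by rewrite inE sC sp.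
by rewrite inE => /andP[s'p s'C]; apply: indep.
Qed.

(** A relation through e supported in e |: T is a combination of w and w1. It
    vanishes at x, where w and w1 agree, so it is a multiple of w - w1; then
    it vanishes at e if e is in the common part, and at y otherwise. *)
Lemma theta_pair_indep w w1 T e x : theta_pair vec w w1 -> e \notin T ->
  e |: T \subset supp w :|: supp w1 ->
  x \in supp w :&: supp w1 -> x \notin e |: T ->
  (e \in supp w :&: supp w1) || [exists y, (y \notin e |: T) &&
     ((y \in supp w) (+) (y \in supp w1))] ->
  vec e \notin vspan T.
Proof.
case=> _ _ ww1 _ gen eT TU xA xT cond; apply/vspanP => // -[z [zr ze zT]].
have [a [b zE]] := gen z zr (subset_trans zT TU).
have [xw xw1] := setIP xA.
have nz y : y \in supp w -> w y != 0 by rewrite inE.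
have nz1 y : y \in supp w1 -> w1 y != 0 by rewrite inE.
have ab : a + b = 0.
  have : z x = 0 by apply: supp_sub zT xT.
  rewrite zE !ffunE -ww1 // -scalerDl => /eqP; rewrite mulf_eq0.
  by rewrite (negPf (nz x xw)) orbF => /eqP.
case/orP: cond => [/setIP[ew ew1]|/existsP[y /andP[yT yx]]].
  by move/eqP: ze; rewrite zE !ffunE -ww1 // -scalerDl ab scale0r.
have zy : z y = 0 by apply: supp_sub zT yT.
suff a0 : a = 0.
  move: ab; rewrite a0 add0r => b0.
  by move: ze; rewrite zE a0 b0 !scale0r addr0 ffunE eqxx.
move: zy; rewrite zE !ffunE; move: yx.
have [yw|/suppPn ->] := boolP (y \in supp w) => /=.
  by move=> /suppPn ->; rewrite scaler0 addr0 => /eqP;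
    rewrite mulf_eq0 (negPf (nz y yw)) orbF => /eqP.
move=> yw1; rewrite scaler0 add0r => /eqP.
rewrite mulf_eq0 (negPf (nz1 y yw1)) orbF => /eqP b0.
by move: ab; rewrite b0 addr0.
Qed.

(** If the common part contains elements r and s of both signs, one face (r, s)
    computes both holonomies. Otherwise the common part has one sign; take r
    in it and an element of the other sign on each of the two private parts:
    the two faces share r, so their holonomies agree. *)
Lemma theta_pair_holonomy w w1 : theta_pair vec w w1 ->
  circuit (supp w) -> circuit (supp w1) -> mixed (supp w) -> mixed (supp w1) ->
  circuit_holonomy (supp w) = circuit_holonomy (supp w1).
Proof.
move=> th cC cC1 mC mC1.
set C := supp w in cC mC *; set C1 := supp w1 in cC1 mC1 *.
have ne x y : x \in pos -> y \notin pos -> x != y.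
  by move=> xp yp; apply: contraNneq yp => <-.
have [x xA] : exists x, x \in C :&: C1 by case: th.
have dep T y r D : circuit D -> y \in D -> D \subset y |: (r |: T) ->
    y \notin T -> vec y \in vspan (r |: T).
  move=> cD yD DT yT; apply: subvP (circuit_dep cD yD).
  by apply: vspan_mono; rewrite subDset.
have [[r [s [rA sA rp sp]]]|nAm] : (exists r s, [/\ r \in C :&: C1, s \in C :&: C1,
    r \in pos & s \notin pos]) \/ ((C :&: C1 \subset pos) || (C :&: C1 \subset ~: pos)).
  have [sub|/subsetPn[s sA sp]] := boolP (C :&: C1 \subset pos); first by right.
  have [sub|/subsetPn[r rA]] := boolP (C :&: C1 \subset ~: pos); first by right.
  by rewrite inE negbK => rp; left; exists r, s.
  pose T := (C :|: C1) :\ r :\ s.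
  have rs := ne _ _ rp sp.
  have [rC rC1] := setIP rA; have [sC sC1] := setIP sA.
  have rT : r \notin T by rewrite !inE eqxx andbF.
  have sT : s \notin T by rewrite !inE eqxx.
  have CT (D : {set I}) : D \subset C :|: C1 -> D \subset r |: (s |: T).
    move=> DU; apply/subsetP => i /(subsetP DU); rewrite !inE.
    by move=> ->; case: (i == r); case: (i == s).
  have eTU e : e \in C :|: C1 -> e |: T \subset C :|: C1.
    move=> eU; rewrite subUset sub1set eU.
    by rewrite (subset_trans (subsetDl _ _)) ?subsetDl.
  have pT : parallel T r s.
    apply/and3P; split.
    - apply: (theta_pair_indep th rT _ sA); last by rewrite rA.
        by apply: eTU; rewrite in_setU rC.
      by rewrite in_setU1 negb_or eq_sym rs.
    - apply: (theta_pair_indep th sT _ rA); last by rewrite sA.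
        by apply: eTU; rewrite in_setU sC.
      by rewrite in_setU1 negb_or rs.
    - apply: dep cC sC _ sT.
      by rewrite setUCA CT ?subsetUl.
  rewrite -(holonomy_circuit rp sp rT sT pT cC) ?CT ?subsetUl //.
  by rewrite -(holonomy_circuit rp sp rT sT pT cC1) ?CT ?subsetUr.
(* otherwise the common part has one sign; pick an element of it, and one of
   the other sign on each of the two circuits *)
have [r [s [t [rA sC tC1 hrst]]]] : exists r s t, [/\ r \in C :&: C1, s \in C :\: C1,
    t \in C1 :\: C &
    (r \in pos) && (s \notin pos) && (t \notin pos)
    || (r \notin pos) && (s \in pos) && (t \in pos)].
  case/andP: mC => /set0Pn[p]; rewrite inE => /andP[pC pp].
  case/set0Pn => q; rewrite inE => /andP[qp qC].
  case/andP: mC1 => /set0Pn[p1]; rewrite inE => /andP[p1C p1p].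
  case/set0Pn => q1; rewrite inE => /andP[q1p q1C].
  case/orP: nAm => /subsetP sub; have xp := sub x xA.
    exists x, q, q1; rewrite xA xp !in_setD qC q1C q1p qp !andbT; split=> //.
      by apply: contra qp => qC1; apply: sub; rewrite inE qC.
    by apply: contra q1p => q1C'; apply: sub; rewrite inE q1C'.
  rewrite inE in xp.
  exists x, p, p1; rewrite xA xp !in_setD pC p1C p1p pp !andbT orbT; split=> //.
    by apply/negP => pC1; have := sub p; rewrite in_setI in_setC pC pC1 pp => /(_ isT).
  by apply/negP => pC1; have := sub p1; rewrite in_setI in_setC p1C pC1 p1p => /(_ isT).
have [rC rC1] := setIP rA; have [sC' sC1] := setDP sC; have [tC1' tC] := setDP tC1.
have rs : r != s by apply: contraNneq sC1 => <-.
have rt : r != t by apply: contraNneq tC => <-.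
have st : s != t by apply: contraNneq tC => <-.
pose T := (C :|: C1) :\ r :\ s :\ t.
have rT : r \notin T by rewrite !inE eqxx !andbF.
have sT : s \notin T by rewrite !inE eqxx !andbF.
have tT : t \notin T by rewrite !inE eqxx.
have eTU e : e \in C :|: C1 -> e |: T \subset C :|: C1.
  move=> eU; rewrite subUset sub1set eU.
  by apply/subsetP => i; rewrite !inE => /and4P[].
have CT : C \subset r |: (s |: T).
  apply/subsetP => i iC; rewrite /T !in_setU1 !in_setD1 in_setU iC.
  case: (i == r); case: (i == s) => //=.
  by rewrite andbT; apply: contraNneq tC => <-.
have C1T : C1 \subset r |: (t |: T).
  apply/subsetP => i iC; rewrite /T !in_setU1 !in_setD1 in_setU iC.
  case: (i == r); case: (i == t) => //=.
  by rewrite orbT !andbT; apply: contraNneq sC1 => <-.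
have nr : vec r \notin vspan T.
  (* a relation through r that avoids s and t vanishes *)
  apply/vspanP => // -[z [zr ze zT]]; case: th => _ _ ww1 _ gen.
  have [|a [b zE]] := gen z zr.
    by apply: subset_trans zT (eTU r _); rewrite inE rC.
  have zs : z s = 0 by apply: supp_sub zT _; rewrite in_setU1 negb_or eq_sym rs.
  have zt : z t = 0 by apply: supp_sub zT _; rewrite in_setU1 negb_or eq_sym rt.
  move: zs zt ze; rewrite zE !ffunE.
  rewrite (suppPn _ _ sC1) (suppPn _ _ tC) !scaler0 addr0 add0r.
  move/eqP; rewrite mulf_eq0; move: sC'; rewrite inE => /negPf ->; rewrite orbF => /eqP ->.
  move/eqP; rewrite mulf_eq0; move: tC1'; rewrite inE => /negPf ->; rewrite orbF => /eqP ->.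
  by rewrite !scale0r addr0 eqxx.
have ns : vec s \notin vspan T.
  apply: (theta_pair_indep th sT _ rA).
  - by apply: eTU; rewrite in_setU sC'.
  - by rewrite in_setU1 negb_or rs.
  apply/orP; right; apply/existsP; exists t.
  by rewrite (negPf tC) tC1' in_setU1 negb_or [t == s]eq_sym st tT.
have nt : vec t \notin vspan T.
  apply: (theta_pair_indep th tT _ rA).
  - by apply: eTU; rewrite in_setU tC1' orbT.
  - by rewrite in_setU1 negb_or rt.
  apply/orP; right; apply/existsP; exists s.
  by rewrite sC' (negPf sC1) in_setU1 negb_or st sT.
have prs : parallel T r s.
  apply/and3P; split=> //; apply: dep cC sC' _ sT.
  by rewrite setUCA.
have prt : parallel T r t.
  apply/and3P; split=> //; apply: dep cC1 tC1' _ tT.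
  by rewrite setUCA.
case/orP: hrst => /andP[/andP[rp sp] tp].
  rewrite -(holonomy_circuit rp sp rT sT prs cC rC sC' CT).
  rewrite -(holonomy_circuit rp tp rT tT prt cC1 rC1 tC1' C1T).
  exact: holonomy_positive flat _ _ _ _ _ _ _ _ _ _.
rewrite setUCA in CT; rewrite setUCA in C1T.
have psr : parallel T s r by apply: parallelC.
have ptr : parallel T t r by apply: parallelC.
rewrite -(holonomy_circuit sp rp sT rT psr cC sC' rC CT).
rewrite -(holonomy_circuit tp rp tT rT ptr cC1 tC1' rC1 C1T).
exact: holonomy_negative flat _ _ _ _ _ _ _ _ _ _.
Qed.
End Holonomy.

Section Gauge.
Variables (F : fieldType) (I : finType) (V : vectType F) (vec : I -> V).
Implicit Types (T C : {set I}) (e f r s : I) (w z : freev F I).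

Local Notation circuit := (circuit vec).
Local Notation circuit_vec := (circuit_vec vec).
Local Notation vspan := (vspan vec).
Local Notation relation := (relation vec).

Hypothesis charF : [pchar F] =i pred0.
Hypothesis unimodular : forall w, circuit_vec w ->
  exists2 k, k != 0 & forall i, i \in supp w -> w i = k \/ w i = - k.

Variable c : {set I} -> I -> F.
Hypothesis c_neq0 : forall T e, e \notin T -> c T e != 0.
Variable pos : {set I}.
Hypothesis flat : flat_off vec c pos.

Local Notation mixed := (mixed pos).
Local Notation hol := (circuit_holonomy c pos).

(** Replace C by one of the two other circuits of a theta from [theta_exists]: at
    least one of them is mixed, has the holonomy of C by [theta_pair_holonomy],
    and meets C'. It is closer to C' unless the other circuit of the theta is
    C' itself and is not mixed; then C and the mixed one cover C'. *)
Lemma circuit_holonomy_meet C C' : circuit C -> circuit C' -> mixed C ->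
  C :&: C' != set0 ->
  (mixed C' -> hol C' = hol C) /\
  (forall f, f \in C' -> exists D, [/\ circuit D, mixed D, f \in D & hol D = hol C]).
Proof.
have [k le_k] := ubnP #|C :|: C'|; elim: k => // k IH in C le_k *.
move=> cC cC' mC meet.
have [<-|neC] := eqVneq C C'; first by split=> // f fC; exists C.
have [w [w1 [th wC c1 c2 [D0 DC' B0]]]] := theta_exists charF unimodular cC cC' neC meet.
set C1 := supp w1 in c1 D0 DC' B0 *.
have s2 := theta_pair_supp th; rewrite wC -/C1 in s2.
set C2 := supp (w - w1) in c2 s2.
have [d dD] : exists d, d \in C1 :\: C by apply/set0Pn.
have [dC1 dC] := setDP dD.
have dC' : d \in C' by apply: (subsetP DC').
have dC2 : d \in C2 by rewrite s2 in_setU dD orbT.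
have th2 : theta_pair vec w (w - w1).
  by apply: theta_pair_sub th _; apply/set0Pn; rewrite wC.
have h1 : mixed C1 -> hol C1 = hol C.
  by move=> m1; rewrite -wC; apply/esym/(theta_pair_holonomy c_neq0 flat th); rewrite ?wC.
have h2 : mixed C2 -> hol C2 = hol C.
  by move=> m2; rewrite -wC; apply/esym/(theta_pair_holonomy c_neq0 flat th2); rewrite ?wC.
have U1 : C1 \subset C :|: C'.
  by rewrite -(setID C1 C) subUset subIset ?subsetUl ?orbT // (subset_trans DC') ?subsetUr.
have U2 : C2 \subset C :|: C'.
  rewrite s2 subUset (subset_trans (subsetDl _ _)) ?subsetUl //.
  by rewrite (subset_trans DC') ?subsetUr.
have shrink (X : {set I}) x : X \subset C :|: C' -> x \in C -> x \notin X -> x \notin C' ->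
    (#|X :|: C'| < k)%N.
  move=> XU xC xX xC'; rewrite -ltnS; apply: leq_trans le_k; rewrite ltnS.
  apply: proper_card; apply/properP; split; first by rewrite subUset XU subsetUr.
  by exists x; rewrite inE ?xC // negb_or xX.
have use X : circuit X -> mixed X -> d \in X -> hol X = hol C ->
    (#|X :|: C'| < k)%N ->
   (mixed C' -> hol C' = hol C) /\
   (forall f, f \in C' -> exists D, [/\ circuit D, mixed D, f \in D & hol D = hol C]).
  move=> cX mX dX <- lt; apply: IH => //.
  by apply/set0Pn; exists d; rewrite inE dX.
(* one of the two other circuits of the theta is mixed *)
have m12 : mixed C1 || mixed C2.
  case/andP: mC => /set0Pn[p]; rewrite inE => /andP[pC pp].
  case/set0Pn => q; rewrite inE => /andP[qp qC].
  have one (x : I) : x \in C -> (x \in C1) || (x \in C2).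
    by move=> xC; rewrite s2 in_setU !in_setD xC /= andbT; case: (x \in C1).
  have mix (X : {set I}) x y : x \in X -> y \in X -> x \in pos -> y \notin pos -> mixed X.
    move=> xX yX xp yp; apply/andP; split; apply/set0Pn.
      by exists x; rewrite inE xX.
    by exists y; rewrite inE yX yp.
  have [dp|dp] := boolP (d \in pos).
    case/orP: (one q qC) => qX; apply/orP; [left|right].
      exact: mix dC1 qX dp qp.
    exact: mix dC2 qX dp qp.
  case/orP: (one p pC) => pX; apply/orP; [left|right].
    exact: mix pX dC1 pp dp.
  exact: mix pX dC2 pp dp.
have nCC' : ~~ (C \subset C').
  by apply: contra neC => /(circuit_sub cC cC') ->.
have AE x : x \in C -> x \in C1 -> x \notin C2.
  by move=> xC x1; rewrite s2 in_setU !in_setD xC x1.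
have BE x : x \in C -> x \notin C1 -> x \in C2.
  by move=> xC x1; rewrite s2 in_setU !in_setD xC x1.
have [B_sub|] := boolP (C :\: C1 \subset C'); last first.
  case/subsetPn => x /setDP[xC xC1] xC'.
  have [m1|n1] := boolP (mixed C1).
    by apply: (use C1) => //; [apply: h1 | apply: (shrink C1 x)].
  rewrite (negPf n1) /= in m12.
  have [A_sub|] := boolP (C :&: C1 \subset C'); last first.
    case/subsetPn => y /setIP[yC yC1] yC'.
    by apply: (use C2) => //; [apply: h2 | apply: (shrink C2 y) => //; apply: AE].
  (* C1 lies in C', so it is C' *)
  have C1C' : C1 = C'.
    apply: (circuit_sub c1 cC'); rewrite -(setID C1 C) subUset DC' andbT.
    by rewrite setIC.
  split; first by rewrite -C1C' (negPf n1).
  move=> f; rewrite -C1C' => fC1; have [fC|fC] := boolP (f \in C); first by exists C.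
  exists C2; split=> //; last exact: h2.
  by rewrite s2 in_setU !in_setD fC fC1 orbT.
have [y yA yC'] : exists2 y, y \in C :&: C1 & y \notin C'.
  apply/subsetPn; apply: contra nCC' => A_sub.
  by rewrite -(setID C C1) subUset A_sub.
have [yC yC1] := setIP yA.
have [m2|n2] := boolP (mixed C2).
  by apply: (use C2) => //; [apply: h2 | apply: (shrink C2 y) => //; apply: AE].
rewrite (negPf n2) orbF in m12.
have C2C' : C2 = C'.
  by apply: (circuit_sub c2 cC'); rewrite s2 subUset B_sub.
split; first by rewrite -C2C' (negPf n2).
move=> f; rewrite -C2C' => fC2; have [fC|fC] := boolP (f \in C); first by exists C.
exists C1; split=> //; last exact: h1.
by move: fC2; rewrite s2 in_setU !in_setD (negPf fC) andbF /=.
Qed.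

Lemma circuit_holonomy_neq0 C : hol C != 0.
Proof.
rewrite /circuit_holonomy; case: pickP => [r|_]; last exact: oner_neq0.
rewrite inE => /andP[rC rp]; case: pickP => [s|_]; last exact: oner_neq0.
rewrite inE => /andP[sp sC].
have rs : r != s by apply: contraNneq sp => <-.
have n1 : r \notin C :\ r :\ s by rewrite !inE eqxx andbF.
have n2 : s \notin C :\ r :\ s by rewrite !inE eqxx.
rewrite !mulf_neq0 ?invr_eq0 ?mulf_neq0 ?c_neq0 //; rewrite !inE negb_or.
  by rewrite eq_sym rs eqxx.
by rewrite rs eqxx andbF.
Qed.

(** By [circuit_holonomy_meet] the holonomy is a function lam of the elements,
    constant on circuits. Multiplying c by lam e at the negative steps e that
    increase the rank kills the holonomy of the parallel faces and creates
    none, so the result is a coboundary. Being constant on circuits, lam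
    preserves the relations, which circuits span. *)
Theorem gauge : exists lam : I -> F, exists u : {set I} -> F,
  [/\ forall e, lam e != 0, forall T, u T != 0,
      forall w, relation w -> relation [ffun e => (lam e * w e : F) : F^o] &
      forall T e, e \notin T -> u (e |: T) =
        u T * (c T e * (if (e \notin pos) && (vec e \notin vspan T) then lam e else 1))].
Proof.
have /fin_all_exists[lam lamP] e : exists l : F, l != 0 /\
    ((forall C, circuit C -> mixed C -> e \in C -> hol C = l) /\
     ((forall C, circuit C -> mixed C -> e \notin C) -> l = 1)).
  have [/existsP[C /and3P[/circuitP cC mC eC]]|] :=
     boolP [exists C, [&& circuitb vec C, mixed C & e \in C]].
    exists (hol C); split; first exact: circuit_holonomy_neq0.
    split=> [D cD mD eD|no]; last by have := no C cC mC; rewrite eC.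
    have [|same _] := circuit_holonomy_meet cC cD mC; last exact: same.
    by apply/set0Pn; exists e; rewrite inE eC.
  rewrite negb_exists => /forallP no; exists 1; split; first exact: oner_neq0.
  split=> // C cC mC eC; have := no C.
  by rewrite mC eC (introT (circuitP _ _)).
have lam0 e : lam e != 0 by case: (lamP e).
have lamE e C : circuit C -> mixed C -> e \in C -> hol C = lam e.
  by case: (lamP e) => _ [+ _]; apply.
have lam1 e : (forall C, circuit C -> mixed C -> e \notin C) -> lam e = 1.
  by case: (lamP e) => _ [_ +]; apply.
(* lam is constant on circuits *)
have lam_circuit C e f : circuit C -> e \in C -> f \in C -> lam e = lam f.
  have key e' f' : circuit C -> e' \in C -> f' \in C ->
     (exists D, [/\ circuit D, mixed D & e' \in D]) -> lam e' = lam f'.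
    move=> cC eC fC [D [cD mD eD]].
    have [|_ cover] := circuit_holonomy_meet cD cC mD.
      by apply/set0Pn; exists e'; rewrite inE eD.
    have [D' [cD' mD' fD' hD']] := cover f' fC.
    by rewrite -(lamE e' D) // -hD' (lamE f').
  move=> cC eC fC.
  have dec e' : (exists D, [/\ circuit D, mixed D & e' \in D]) \/
      (forall D, circuit D -> mixed D -> e' \notin D).
    have [/existsP[D /and3P[/circuitP cD mD eD]]|] :=
       boolP [exists D, [&& circuitb vec D, mixed D & e' \in D]].
      by left; exists D.
    rewrite negb_exists => /forallP no; right=> D cD mD; apply/negP => eD.
    by have := no D; rewrite mD eD (introT (circuitP _ _)).
  case: (dec e) => [|noe]; first exact: key.
  case: (dec f) => [|nof]; first by move=> h; apply/esym/key.
  by rewrite !lam1.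
pose t T e := if (e \notin pos) && (vec e \notin vspan T) then lam e else 1.
have t0 T e : t T e != 0 by rewrite /t; case: ifP; rewrite ?oner_neq0.
have mono T e f : vec f \in vspan T -> vec f \in vspan (e |: T).
  by apply: subvP; rewrite vspan_mono ?subsetUr.
(* the circuit through two parallel elements *)
have par_circuit T e f : e \notin T -> f \notin T -> e != f -> parallel vec T e f ->
    exists C, [/\ circuit C, e \in C, f \in C & C \subset e |: (f |: T)].
  move=> eT fT ef /and3P[ne nf /vspanP[|w [wr wf wT]]].
    by rewrite !inE negb_or eq_sym ef.
  have fw : f \in supp w by rewrite inE.
  have [w1 w1c /andP[fw1 w1w]] := circuit_through wr fw.
  exists (supp w1); split=> //; first by exists w1.
    apply: contraT => ew1; case/negP: nf; apply/vspanP => //; exists w1.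
    case: w1c => w1r _ _; split=> //; first by rewrite inE in fw1.
    apply/subsetP => i iw1; have := subsetP wT i (subsetP w1w i iw1).
    rewrite !inE => /or3P[->|/eqP ie|->] //; last by rewrite orbT.
    by move: ew1; rewrite -ie iw1.
  by rewrite setUCA (subset_trans w1w).
have nopar T e f : ~~ parallel vec T e f ->
    (vec f \in vspan (e |: T)) = (vec f \in vspan T).
  move=> np; apply/idP/idP; last exact: mono.
  move=> fe; apply: contraT => nf; have [eT|eT] := boolP (vec e \in vspan T).
    suff eqs : (vspan (e |: T) <= vspan T)%VS by rewrite (subvP eqs) in nf.
    apply/subv_sumP => i; rewrite in_setU1 => /predU1P[->|iT]; first by rewrite -memvE.
    exact: (sumv_sup i).
  by move: np; rewrite /parallel eT nf fe.
have mixed_face T e f : e \notin T -> f \notin T -> e != f ->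
    e \in pos -> f \notin pos -> trivial_face (fun T e => c T e * t T e) T e f.
  move=> eT fT ef ep fp; rewrite /trivial_face /t ep fp /= !mulr1.
  have [par|np] := boolP (parallel vec T e f); last first.
    have := flat eT fT ef; rewrite (negPf np) andbF => /(_ isT).
    by rewrite (nopar _ _ _ np) /trivial_face mulrAC mulrA => ->; rewrite mulrAC.
  have [C [cC eC fC CT]] := par_circuit T e f eT fT ef par.
  have := holonomy_circuit c_neq0 flat ep fp eT fT par cC eC fC CT.
  rewrite (lamE f C) //; last first.
    by apply/andP; split; apply/set0Pn; [exists e | exists f]; rewrite inE ?eC ?ep ?fp ?fC.
  case/and3P: par => _ -> ->; rewrite mulr1 /holonomy => <-.
  have h1 := c_neq0 fT.
  have h2 : c (f |: T) e != 0 by rewrite c_neq0 // !inE negb_or ef.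
  by field; rewrite h1 h2.
have [|T e f _ _ eT fT ef|u u0 uE] :=
   @cube_potential _ _ (fun T e => c T e * t T e) (enum I) _ (enum_uniq _).
- by move=> T e eT; rewrite mulf_neq0 ?c_neq0.
- have [ep|ep] := boolP (e \in pos); have [fp|fp] := boolP (f \in pos).
  + rewrite /trivial_face /t ep fp /= !mulr1.
    by apply: (flat eT fT ef); rewrite ep fp.
  + exact: mixed_face.
  + by apply/esym/mixed_face => //; rewrite eq_sym.
  have := flat eT fT ef; rewrite (negPf ep) (negPf fp) => /(_ isT).
  rewrite /trivial_face => E; rewrite mulrACA [RHS]mulrACA E; congr (_ * _).
  rewrite /t ep fp /=.
  have [par|np] := boolP (parallel vec T e f); last first.
    have npC : ~~ parallel vec T f e.
      by apply: contra np; apply: parallelC => //; rewrite eq_sym.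
    by rewrite (nopar _ _ _ np) (nopar _ _ _ npC) mulrC.
  have parC := parallelC eT fT ef par.
  have [C [cC eC fC CT]] := par_circuit T e f eT fT ef par.
  case/and3P: par => -> -> ->; case/and3P: parC => _ _ ->.
  by rewrite /= !mulr1 (lam_circuit C e f).
exists lam, u; split=> //; last by move=> T e eT; rewrite uE ?mem_enum.
(* the relations are spanned by circuits, on which lam is constant *)
move=> w; have [k le_k] := ubnP #|supp w|; elim: k => // k IH in w le_k * => wr.
have [E|[e ew]] := set_0Vmem (supp w).
  have /eqP -> : w == 0 by rewrite -supp_eq0 E.
  by rewrite /relation big1 // => i _; rewrite !ffunE mulr0 scale0r.
have [w1 w1c /andP[ew1 w1w]] := circuit_through wr ew.
have [w1r _ _] := w1c.
have w1e : w1 e != 0 by rewrite inE in ew1.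
pose w' := w - (w e / w1 e) *: w1.
have w'r : relation w' by rewrite relationB ?relationZ.
have w'w : supp w' \proper supp w.
  apply/properP; split; last first.
    by exists e => //; apply/suppPn; rewrite !ffunE [_ *: _]divfK ?subrr.
  apply: subset_trans (suppB _ _) _; rewrite subUset subxx.
  apply: subset_trans w1w; apply/subsetP => i; rewrite !inE ffunE.
  by apply: contraNneq => ->; rewrite scaler0.
have -> : [ffun i => (lam i * w i : F) : F^o] =
    [ffun i => (lam i * w' i : F) : F^o] + (lam e * (w e / w1 e)) *: w1.
  apply/ffunP => i; rewrite !ffunE.
  have [iw1|/suppPn ->] := boolP (i \in supp w1); last first.
    by rewrite !scaler0 subr0 addr0.
  rewrite (lam_circuit (supp w1) e i) //; last by exists w1.
  rewrite mulrBr -[X in _ = _ + X]/(lam i * (w e / w1 e) * w1 i).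
  by rewrite -[(w e / w1 e) *: _]/(w e / w1 e * w1 i) !mulrA subrK.
apply: relationD; last exact: relationZ.
by apply: IH => //; apply: leq_trans (proper_card w'w) _; rewrite -ltnS.
Qed.

End Gauge.

(** * Unimodularity of graphs *)

Section Graph.
Variables (F : fieldType) (I K : finType) (a b : I -> K).
Implicit Types (S : {set I}) (w z : freev F I).

Definition graph_vec (e : I) : freev F K := basisv F (a e) - basisv F (b e).

Definition graph_rel S : rel K := fun u v =>
  [exists e in S, ((a e == u) && (b e == v)) || ((a e == v) && (b e == u))].

(** The flow of one unit along a path. *)
Lemma path_flow S x p : path (graph_rel S) x p -> uniq (x :: p) ->
  exists z : freev F I,
    [/\ forall i, z i != 0 -> [&& i \in S, a i \in x :: p & b i \in x :: p],
        forall i, [\/ z i = 0, z i = 1 | z i = -1] &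
        \sum_i (z i : F) *: graph_vec i = basisv F x - basisv F (last x p)].
Proof.
elim: p x => [|y p IH] x /=.
  move=> _ _; exists 0; split=> [i|i|]; first by rewrite ffunE eqxx.
    by constructor; rewrite ffunE.
  by rewrite subrr big1 // => i _; rewrite ffunE scale0r.
case/andP=> /exists_inP[e eS eE] pp /andP[xp up].
have [z [z1 z2 z3]] := IH y pp up.
have xyp i : z i != 0 -> (a i != x) && (b i != x).
  move/z1/and3P=> [_ ai bi].
  by apply/andP; split; [apply: contraNneq xp => <- | apply: contraNneq xp => <-].
have [s [s1 sE]] : exists s : F, (s = 1 \/ s = -1) /\
    s *: graph_vec e = basisv F x - basisv F y.
  case/orP: eE => /andP[/eqP ae /eqP be].
    by exists 1; rewrite scale1r /graph_vec ae be; split; [left|].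
  by exists (-1); rewrite scaleN1r /graph_vec ae be opprB; split; [right|].
have ze : z e = 0.
  apply/eqP; apply: contraT => /xyp.
  by case/orP: eE => /andP[ae be]; rewrite ?ae ?be ?andbF.
exists (z + s *: basisv F e); split=> [i|i|].
- rewrite !ffunE; have [->|ie] := eqVneq i e.
    by move=> _; rewrite eS /= !inE; case/orP: eE => /andP[-> ->]; rewrite !orbT.
  rewrite scaler0 addr0 => /z1/and3P[-> ai bi] /=.
  by rewrite in_cons ai in_cons bi !orbT.
- rewrite !ffunE; have [->|ie] := eqVneq i e; last by rewrite scaler0 addr0; apply: z2.
  by rewrite ze add0r [_ *: _]mulr1; case: s1 => ->; [constructor 2|constructor 3].
- under eq_bigr do rewrite !ffunE scalerDl.
  rewrite big_split /= z3 (bigD1 e) //= eqxx [_ *: 1]mulr1 sE.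
  rewrite big1 => [|i /negPf ie]; last by rewrite ie scaler0 scale0r.
  by rewrite addr0 addrC addrA subrK.
Qed.

(** Cut the circuit open at e0. The rest still connects the two ends of e0, for
    otherwise the cut around one of them would meet the circuit in e0 only. A
    flow along a path between the ends gives a relation with entries 0, 1 and
    -1 supported in the circuit, which therefore is a multiple of it. *)
Lemma graph_unimodular w : circuit_vec graph_vec w ->
  exists2 k : F, k != 0 & forall i, i \in supp w -> w i = k \/ w i = - k.
Proof.
case=> wr w0 wm.
have [e0 e0w] : exists e, e \in supp w by apply/set0Pn; rewrite supp_eq0.
have we0 : w e0 != 0 by rewrite inE in e0w.
exists (w e0) => //.
pose S := supp w :\ e0.
have conn : connect (graph_rel S) (a e0) (b e0).
  apply: contraT => nconn.
  (* the cut around the component of a e0 meets w in e0 only *)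
  pose X := [set v | connect (graph_rel S) (a e0) v].
  pose cut (u : freev F K) : F := \sum_(v in X) u v.
  have cut_vec i : cut (graph_vec i) = (a i \in X)%:R - (b i \in X)%:R.
    have basis v : \sum_(u in X) basisv F v u = (v \in X)%:R.
      rewrite (big_mkcond) (bigD1 v) //= ffunE eqxx big1 ?addr0 => [|u /negPf uv].
        by case: (v \in X).
      by rewrite ffunE uv; case: ifP.
    rewrite -!basis -sumrB; apply: eq_bigr => u _.
    by rewrite !ffunE.
  have : cut (\sum_i (w i : F) *: graph_vec i) = \sum_i (w i : F) * cut (graph_vec i).
    rewrite /cut; under eq_bigr do rewrite sum_ffunE.
    rewrite exchange_big /=; apply: eq_bigr => i _.
    by rewrite mulr_sumr; apply: eq_bigr => u _; rewrite !ffunE.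
  move/eqP: wr => ->; rewrite (bigD1 e0) //= big1 ?addr0; last first.
    move=> i ie0; have [wi0|wi] := eqVneq (w i) 0; first by rewrite wi0 mul0r.
    rewrite cut_vec (_ : (a i \in X) = (b i \in X)) ?subrr ?mulr0 //.
    rewrite !inE; have iS : i \in S by rewrite !inE ie0.
    apply/idP/idP => h; apply: connect_trans h (connect1 _);
      by apply/exists_inP; exists i; rewrite // !eqxx ?orbT.
  rewrite cut_vec !inE connect0 (negPf nconn) subr0 mulr1 /cut big1.
    by move/eqP; rewrite eq_sym (negPf we0).
  by move=> v _; rewrite ffunE.
have [p0 pp0 lastp0] := connectP conn.
have [p [pp up lastp]] : exists p, [/\ path (graph_rel S) (a e0) p,
    uniq (a e0 :: p) & b e0 = last (a e0) p].
  by rewrite lastp0; case/shortenP: pp0 => p pp up _; exists p.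
have [z [z1 z2 z3]] := path_flow pp up.
have ze0 : z e0 = 0.
  by apply/eqP; apply: contraT => /z1; rewrite !inE eqxx.
pose y := basisv F e0 - z.
have yr : relation graph_vec y.
  rewrite /relation; under eq_bigr do rewrite !ffunE scalerBl.
  rewrite sumrB z3 -lastp (bigD1 e0) //= eqxx scale1r big1 ?addr0 ?subrr //.
  by move=> i /negPf ->; rewrite scale0r.
have yw : supp y \subset supp w.
  apply/subsetP => i; rewrite inE !ffunE; have [-> //|ie] := eqVneq i e0.
  by rewrite sub0r oppr_eq0 => /z1/and3P[]; rewrite in_setD1 => /andP[].
have [k yE] := wm y yr yw.
have kE : k * w e0 = 1.
  by have /ffunP/(_ e0) := yE; rewrite !ffunE ze0 eqxx subr0 => /esym.
have k0 : k != 0 by apply: contra_eq_neq kE => ->; rewrite mul0r eq_sym oner_neq0.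
have wE i : w i = w e0 * y i.
  by rewrite yE !ffunE -[k *: _]/(k * w i) mulrA [w e0 * k]mulrC kE mul1r.
move=> i iw; have := wE i; rewrite !ffunE; have [->|ie] := eqVneq i e0.
  by left.
rewrite sub0r; case: (z2 i) => -> wiE.
- by move: iw; rewrite inE wiE oppr0 mulr0 eqxx.
- by right; rewrite wiE; apply: mulrN1.
- by left; rewrite wiE opprK; apply: mulr1.
Qed.

End Graph.

(** * Non-degeneracy and orthogonal projections *)

Section IntegerMatrices.
Import Num.Theory.

Lemma rat_mx_denominator m p (Y : 'M[rat]_(m, p)) :
  exists2 d : int, d != 0 & exists Y' : 'M[int]_(m, p),
    d%:~R *: Y = map_mx intr Y'.
Proof.
pose dn (ij : 'I_m * 'I_p) := denq (Y ij.1 ij.2).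
exists (\prod_ij dn ij).
  by apply/prodf_neq0 => ij _; apply: denq_neq0.
exists (\matrix_(i, j) ((\prod_(ij | ij != (i, j)) dn ij) * numq (Y i j))).
apply/matrixP => i j; rewrite !mxE (bigD1 (i, j)) //= !intrM numqE /dn /=.
by rewrite [LHS]mulrAC [LHS]mulrC [_ * Y i j]mulrC.
Qed.

(** Over an ordered field a sum of squares vanishes only if each term does, so M
    and its Gram matrix have the same rank. *)
Lemma rat_gram_sub m p (M : 'M[rat]_(m, p)) : (M^T <= M *m M^T)%MS.
Proof.
rewrite submxE; set X := cokermx _.
have MX : M *m M^T *m X = 0 by apply: mulmx_coker.
have : (M^T *m X)^T *m (M^T *m X) = 0.
  by rewrite trmx_mul trmxK -mulmxA [M *m (_ *m _)]mulmxA MX mulmx0.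
move: (M^T *m X) => Z /matrixP Z0; apply/eqP/matrixP => i j; rewrite [RHS]mxE.
have := Z0 j j; rewrite !mxE => /eqP; rewrite psumr_eq0 => [|k _]; last first.
  by rewrite mxE -expr2 sqr_ge0.
by move/allP/(_ i (mem_index_enum i)); rewrite mxE -expr2 sqrf_eq0 => /eqP.
Qed.

(** The previous fact without denominators; it then holds over any field of
    characteristic zero, where the dot product may have isotropic vectors. *)
Lemma int_gram_factor m p (M : 'M[int]_(m, p)) :
  exists2 d : int, d != 0 & exists Y, M *m M^T *m Y = d *: M.
Proof.
pose Mq : 'M[rat]_(m, p) := map_mx intr M.
have [D MD] := submxP (rat_gram_sub Mq).
have [d d0 [Y YE]] := rat_mx_denominator D^T.
exists d => //; exists Y.
have inj : injective (fun A : 'M[int]_(m, p) => map_mx intr A : 'M[rat]_(m, p)).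
  by move=> A B /matrixP AB; apply/matrixP => i j; have := AB i j; rewrite !mxE => /intr_inj.
apply: inj; rewrite !map_mxM -matrix.map_trmx -/Mq -YE map_mxZ -/Mq -scalemxAr.
congr (_ *: _); apply: trmx_inj.
by rewrite trmx_mul trmxK trmx_mul trmxK.
Qed.

End IntegerMatrices.

Section RationalNondegeneracy.
Import Num.Theory.
Variables (F : fieldType) (J K : finType).
Hypothesis charF : [pchar F] =i pred0.

(** The solution space has a rational structure, and the dot product of the
    rationals is anisotropic. A vector orthogonal to all solutions is a
    combination of the equations; if it is itself a solution, then
    [int_gram_factor] shows that it vanishes. *)
Lemma int_system_nondegenerate (k : K -> J -> int) (u : freev F J) :
  (forall i, \sum_j (k i j)%:~R * u j = 0) ->
  (forall v : freev F J, (forall i, \sum_j (k i j)%:~R * v j = 0) -> dotp u v = 0) ->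
  u = 0.
Proof.
move=> uk ukk.
pose M : 'M[int]_(#|K|, #|J|) := \matrix_(i, j) k (enum_val i) (enum_val j).
pose MF : 'M[F]_(#|K|, #|J|) := map_mx intr M.
pose ur : 'rV[F]_(#|J|) := \row_j u (enum_val j).
have sumJ (f : J -> F) : \sum_j f j = \sum_(j < #|J|) f (enum_val j).
  by rewrite -(big_enum_val f); apply: eq_bigl => j; rewrite inE.
have uMT : ur *m MF^T = 0.
  apply/matrixP => i0 i; rewrite !mxE -[RHS](uk (enum_val i)) sumJ.
  by apply: eq_bigr => j _; rewrite !mxE mulrC.
have ucoker : ur *m cokermx MF = 0.
  apply/matrixP => i0 l; rewrite [RHS]mxE.
  pose v : freev F J := [ffun j => (cokermx MF (enum_rank j) l : F) : F^o].
  have vk i : \sum_j (k i j)%:~R * v j = 0.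
    have /matrixP/(_ (enum_rank i) l) := mulmx_coker MF.
    rewrite !mxE => E; rewrite -[RHS]E sumJ; apply: eq_bigr => j _.
    by rewrite !ffunE !mxE enum_rankK enum_valK.
  rewrite -[RHS](ukk v vk) /dotp sumJ mxE; apply: eq_bigr => j _.
  by rewrite mxE ffunE enum_valK.
have [c uE] : exists c, ur = c *m MF by apply/submxP; rewrite submxE ucoker.
have [d d0 [Y YE]] := int_gram_factor M.
have dF : d%:~R != 0 :> F.
  rewrite -[d]mulz_sign_abs intrM mulf_neq0 //.
    by rewrite rmorph_sign signr_eq0.
  by rewrite char0_natr_eq0 // absz_eq0.
have dM : d%:~R *: MF = MF *m MF^T *m map_mx intr Y.
  by rewrite -map_mxZ -YE !map_mxM -matrix.map_trmx.
have : d%:~R *: ur = 0.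
  by rewrite uE scalemxAr dM !mulmxA -uE uMT mul0mx.
move/eqP; rewrite scaler_eq0 (negPf dF) /= => /eqP/matrixP ur0.
apply/ffunP => j; have := ur0 0 (enum_rank j).
by rewrite !mxE enum_rankK ffunE.
Qed.

End RationalNondegeneracy.

Section OrthogonalProjection.
Variables (F : fieldType) (V : vectType F) (form : {symmetric V}).
Implicit Types (U : {vspace V}) (u v w x : V).

Lemma sformC u v : form u v = form v u.
Proof. by rewrite hermC expr0 mul1r. Qed.

Lemma sform_sumr (I : Type) (r : seq I) (P : pred I) (f : I -> V) u :
  form u (\sum_(i <- r | P i) f i) = \sum_(i <- r | P i) form u (f i).
Proof. by rewrite linear_sum. Qed.

Lemma sformBl u v w : form (u - v) w = form u w - form v w.
Proof. by rewrite !(sformC _ w) linearB. Qed.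

Lemma sformDl u v w : form (u + v) w = form u w + form v w.
Proof. by rewrite !(sformC _ w) linearD. Qed.

Lemma sformZl a v w : form (a *: v) w = a * form v w.
Proof. by rewrite !(sformC _ w) linearZ. Qed.

Lemma sformZr a v w : form w (a *: v) = a * form w v.
Proof. by rewrite linearZ. Qed.

Lemma sformBr u v w : form w (u - v) = form w u - form w v.
Proof. by rewrite linearB. Qed.

Definition nondeg U := forall u, u \in U -> (forall w, w \in U -> form u w = 0) -> u = 0.

Lemma nondeg_cap U : nondeg U -> (U :&: orthov form U = 0)%VS.
Proof.
move=> ndU; apply/eqP; rewrite -subv0; apply/subvP => u /memv_capP[uU /mem_orthovP uo].
by rewrite memv0; apply/eqP/ndU.
Qed.

Lemma dim_orthov_ge U : (\dim {:V} <= \dim U + \dim (orthov form U))%N.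
Proof.
have dimcap n (f : 'I_n -> V) (W : {vspace V}) :
    (\dim W <= n + \dim (W :&: \bigcap_(i < n) orthov form <[f i]>))%N.
  elim: n f W => [|n IH] f W; first by rewrite big_ord0 capvf.
  rewrite big_ord_recl capvA.
  apply: leq_trans (leqSpred _) _; rewrite addSn ltnS.
  apply: leq_trans (leq_dim_orthov1 form (f ord0) W) _.
  exact: IH.
have := dimcap (\dim U) (fun i => (vbasis U)`_i) fullv; rewrite capfv.
suff -> : (\bigcap_(i < \dim U) orthov form <[(vbasis U)`_i]>)%VS = orthov form U by [].
rewrite /orthov; apply: eq_bigr => i _.
exact: orthov1E.
Qed.

(** Dimension count: over an arbitrary field this uses only that U meets its
    orthogonal trivially. *)
Lemma nondeg_sum U : nondeg U -> (U + orthov form U = fullv)%VS.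
Proof.
move=> ndU; apply/eqP; rewrite eqEdim subvf /= dimv_disjoint_sum ?dim_orthov_ge //.
exact: nondeg_cap.
Qed.

Definition oproj U v : subvs_of U := vsproj U (orth_proj form U v).

Lemma oproj_is_linear U : linear (oproj U).
Proof. by move=> a u v; rewrite /oproj !linearP. Qed.
HB.instance Definition _ U :=
  GRing.isLinear.Build F V (subvs_of U) *:%R (oproj U) (oproj_is_linear U).

Lemma orth_proj_mem U v : orth_proj form U v \in U.
Proof. exact: memv_pi. Qed.

Lemma vsval_oproj U v : vsval (oproj U v) = orth_proj form U v.
Proof. by rewrite /oproj vsprojK ?orth_proj_mem. Qed.

Lemma oprojP U v w : nondeg U -> w \in U -> form (vsval (oproj U v)) w = form v w.
Proof.
move=> ndU wU; rewrite vsval_oproj /orth_proj.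
have E := daddv_pi_add (nondeg_cap ndU) (w := v).
rewrite -{2}E ?nondeg_sum ?memvf // sformDl.
have /mem_orthovP/(_ w wU) -> : daddv_pi (orthov form U) U v \in orthov form U by exact: memv_pi.
by rewrite addr0.
Qed.

Lemma oproj_unique U u v : nondeg U -> u \in U ->
  (forall w, w \in U -> form u w = form v w) -> vsval (oproj U v) = u.
Proof.
move=> ndU uU uv; apply/eqP; rewrite -subr_eq0; apply/eqP/ndU.
  by rewrite memvB ?subvsP.
by move=> w wU; rewrite sformBl oprojP // uv // subrr.
Qed.

Lemma oproj_id U u : nondeg U -> u \in U -> vsval (oproj U u) = u.
Proof. by move=> ndU uU; apply: oproj_unique. Qed.

Lemma oproj_incl U u : nondeg U -> u \in U -> oproj U u = vsproj U u.
Proof. by move=> ndU uU; apply: val_inj; rewrite /= oproj_id // vsprojK. Qed.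

Lemma oproj_surj U (u : subvs_of U) : nondeg U -> oproj U (vsval u) = u.
Proof. by move=> ndU; apply: val_inj; rewrite /= oproj_id ?subvsP. Qed.

Lemma oproj_congr U u v : nondeg U ->
  (forall w, w \in U -> form u w = form v w) -> oproj U u = oproj U v.
Proof.
move=> ndU uv; apply: val_inj; apply: oproj_unique; rewrite ?subvsP //.
by move=> w wU; rewrite oprojP // uv.
Qed.

Lemma oproj_eq0 U v : nondeg U ->
  oproj U v = 0 <-> (forall w, w \in U -> form v w = 0).
Proof.
move=> ndU; split=> [v0 w wU|v0].
  by rewrite -(oprojP v ndU wU) v0 /= linear0l.
rewrite -[RHS](linear0 (oproj U)); apply: oproj_congr => // w wU.
by rewrite v0 // linear0l.
Qed.

Lemma oproj_oproj U U' v : nondeg U -> nondeg U' -> (U' <= U)%VS ->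
  oproj U' (vsval (oproj U v)) = oproj U' v.
Proof.
move=> ndU ndU' /subvP U'U; apply: oproj_congr => // w /U'U wU.
by rewrite oprojP.
Qed.

(** On U the functional given by the difference of v and its projection vanishes on
    U', that is, wherever x vanishes; so it is a multiple of x. *)
Lemma oproj_hyperplane U U' v x : nondeg U -> nondeg U' -> (U' <= U)%VS ->
  (forall u, u \in U -> form x u = 0 -> u \in U') ->
  exists k, oproj U (vsval (oproj U' v)) = oproj U v + k *: oproj U x.
Proof.
move=> ndU ndU' U'U xU.
pose d := vsval (oproj U' v) - v.
have dU' w : w \in U' -> form d w = 0.
  by move=> wU'; rewrite sformBl oprojP // subrr.
suff [k kE] : exists k, forall w, w \in U -> form d w = k * form x w.
  exists k; rewrite -linearZ -linearD; apply: oproj_congr => // w wU.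
  by rewrite sformDl sformZl -kE // sformBl addrC subrK.
have [/existsP[i xi]|] := boolP [exists i, form x (tnth (vbasis U) i) != 0].
  pose w0 := tnth (vbasis U) i.
  have w0U : w0 \in U by apply: vbasis_mem; apply: mem_tnth.
  exists (form d w0 / form x w0) => w wU.
  have : form d (w - (form x w / form x w0) *: w0) = 0.
    apply/dU'/xU; first by rewrite memvB ?memvZ.
    by rewrite sformBr sformZr divfK ?subrr.
  rewrite sformBr sformZr => /eqP; rewrite subr_eq0 => /eqP ->.
  by rewrite mulrC mulrA mulrAC.
rewrite negb_exists => /forallP x0; exists 0 => w wU; rewrite mul0r.
apply/dU'/xU => //; rewrite (coord_vbasis wU) sform_sumr big1 // => i _.
rewrite sformZr -tnth_nth.
by have := x0 i; rewrite negbK => /eqP ->; rewrite mulr0.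
Qed.

Lemma orth_orth U v : nondeg (orthov form U) ->
  (forall w, w \in orthov form U -> form v w = 0) -> v \in U.
Proof.
move=> nd vU; have vo : v \in orthov form (orthov form U) by apply/mem_orthovP.
suff -> : U = orthov form (orthov form U) by [].
apply/eqP; rewrite eqEdim; apply/andP; split.
  by rewrite orthov_sym subvv.
rewrite -(leq_add2l (\dim (orthov form U))) -dimv_disjoint_sum ?nondeg_cap //.
by rewrite nondeg_sum // addnC dim_orthov_ge.
Qed.

End OrthogonalProjection.

(** * Circles of a smoothing *)

Section Turn.
Variable n : nat.
Implicit Types x : dart n.

Lemma turn_turn k l x : turn k (turn l x) = turn (l + k) x.
Proof. by rewrite /turn /= addrA. Qed.

Lemma turn0 x : turn 0 x = x.
Proof. by case: x => c j; rewrite /turn addr0. Qed.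

Lemma turnNN x : turn (-1) (turn (-1) x) = turn 2 x.
Proof. by rewrite turn_turn (_ : -1 - 1 = 2) //; apply: val_inj. Qed.

Lemma turn2N x : turn 2 (turn (-1) x) = turn 1 x.
Proof. by rewrite turn_turn (_ : -1 + 2 = 1) //; apply: val_inj. Qed.

Lemma turn21 x : turn 2 (turn 1 x) = turn (-1) x.
Proof. by rewrite turn_turn (_ : 1 + 2 = -1) //; apply: val_inj. Qed.

Lemma turn12 x : turn 1 (turn 2 x) = turn (-1) x.
Proof. by rewrite turn_turn (_ : 2 + 1 = -1) //; apply: val_inj. Qed.

Lemma turnN2 x : turn (-1) (turn 2 x) = turn 1 x.
Proof. by rewrite turn_turn (_ : 2 - 1 = 1) //; apply: val_inj. Qed.

Lemma turn22 x : turn 2 (turn 2 x) = x.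
Proof. by rewrite turn_turn (_ : 2 + 2 = 0) ?turn0 //; apply: val_inj. Qed.

Lemma turn1N x : turn 1 (turn (-1) x) = x.
Proof. by rewrite turn_turn addNr turn0. Qed.

Lemma turnN1 x : turn (-1) (turn 1 x) = x.
Proof. by rewrite turn_turn subrr turn0. Qed.

Lemma turn_at c k : turn k ((c, 0) : dart n) = (c, k).
Proof. by rewrite /turn /= add0r. Qed.

Lemma turn_neq2 x : x != turn 2 x.
Proof.
apply/eqP => /(congr1 (fun y : dart n => y.2 - x.2)).
by rewrite /= subrr addrC addKr => /(congr1 val).
Qed.

Lemma turn_fst k x : (turn k x).1 = x.1. Proof. by []. Qed.

Lemma turn_inj k : injective (turn k : dart n -> dart n).
Proof.
move=> x y E.
by rewrite -[x]turn0 -(addrN k) -turn_turn E turn_turn addrN turn0.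
Qed.

End Turn.

Section Circles.
Variables (D : link_diagram) (shaded : checkerboard D).
Local Notation n := (ncross D).
Local Notation glue := (@glue D).
Local Notation next := (next_sector glue).
Implicit Types (S T : {set 'I_n}) (x y : dart n).

Lemma shade_turnN1 x : shaded (turn (-1) x) = ~~ shaded x.
Proof. by rewrite -[x in RHS]turn0 -(addNr 1) -turn_turn shade_adjacent negbK. Qed.

Lemma shade_turn2 x : shaded (turn 2 x) = shaded x.
Proof. by rewrite -[2]/(1 + 1) -turn_turn !shade_adjacent negbK. Qed.

Lemma shade_turn3 x : shaded (turn 3 x) = ~~ shaded x.
Proof. by rewrite -[3]/(1 + 2) -turn_turn shade_turn2 shade_adjacent. Qed.

Lemma shade_glue x : shaded (glue x) = ~~ shaded x.
Proof. by rewrite -(shade_region shaded x) /next_sector shade_turnN1 negbK. Qed.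

Lemma shade_parity x : shaded x = shaded (x.1, 0) (+) odd x.2.
Proof.
case: x => c j; have E k : shaded (turn k (c, 0)) = shaded (c, 0) (+) odd k.
  case: k => k; do 4?[case: k => [|k]] => //= ltk.
  - by rewrite addbF (_ : Ordinal ltk = 0) ?turn0 //; apply: val_inj.
  - by rewrite addbT (_ : Ordinal ltk = 1) ?shade_adjacent //; apply: val_inj.
  - by rewrite addbF (_ : Ordinal ltk = 2) ?shade_turn2 //; apply: val_inj.
  - by rewrite addbT (_ : Ordinal ltk = 3) ?shade_turn3 //; apply: val_inj.
by have := E j; rewrite /turn /= add0r.
Qed.

(** The edges of the Tait graph along which the smoothing S joins the shaded
    regions; it is the set tilde S of the arrangement, so S grows with it at
    positive crossings and shrinks at negative ones. *)
Definition tait_set S : {set 'I_n} :=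
  (S :&: positive_edges shaded) :|: (~: positive_edges shaded :\: S).

Lemma in_tait_set S c : (c \in tait_set S) = ((c \in S) == (c \in positive_edges shaded)).
Proof. by rewrite in_setU in_setI in_setD in_setC; case: (c \in S); case: (c \in _). Qed.

Lemma tait_setK : involutive tait_set.
Proof.
by move=> S; apply/setP => c; rewrite !in_tait_set; case: (c \in S); case: (c \in _).
Qed.

Lemma smooth_unshaded S x : ~~ shaded x ->
  smooth S x = turn (if x.1 \in tait_set S then 1 else -1) x.
Proof.
rewrite /smooth shade_parity in_tait_set inE negb_add => /eqP <-.
by case: (x.1 \in S); case: (shaded _).
Qed.

Lemma smooth_shaded S x : shaded x ->
  smooth S x = turn (if x.1 \in tait_set S then -1 else 1) x.
Proof.
rewrite /smooth shade_parity in_tait_set inE => /addbP <-.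
by case: (x.1 \in S); case: (shaded _).
Qed.

Lemma shade_smooth S x : shaded (smooth S x) = ~~ shaded x.
Proof. by rewrite /smooth; case: ifP => _; rewrite ?shade_turnN1 ?shade_adjacent. Qed.

Lemma smoothK S : involutive (@smooth D S).
Proof.
move=> x; have [xs|xs] := boolP (shaded x).
  rewrite (smooth_unshaded S (x := smooth S x)) ?shade_smooth ?xs //.
  rewrite smooth_shaded //=; case: ifP => _; rewrite turn_turn -[RHS]turn0.
    by rewrite addNr.
  by rewrite subrr.
rewrite (smooth_shaded S (x := smooth S x)) ?shade_smooth ?xs //.
rewrite smooth_unshaded //=; case: ifP => _; rewrite turn_turn -[RHS]turn0.
  by rewrite subrr.
by rewrite addNr.
Qed.

Lemma circle_rel_sym S : connect_sym (circle_rel S).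
Proof.
apply: (@sym_connect_sym _ (circle_rel S)) => x y; rewrite /circle_rel /=.
by congr (_ || _); apply/eqP/eqP => ->; rewrite ?smoothK ?glueK.
Qed.

Lemma next_inj : injective next.
Proof. by move=> x y /turn_inj/(inv_inj (@glueK D)). Qed.

Lemma next_glue x : next (glue x) = turn (-1) x.
Proof. by rewrite /next_sector glueK. Qed.

(** The half-edge x separates the sectors x and [turn (-1) x], one of which is
    shaded. *)
Definition shaded_side x := if shaded x then x else turn (-1) x.
Definition unshaded_side x := if shaded x then turn (-1) x else x.

Lemma shaded_sideP x : shaded (shaded_side x).
Proof. by rewrite /shaded_side; case: ifP => // /negbT; rewrite shade_turnN1. Qed.

(** Along a circle the shaded side stays in one region, except where the circle
    passes from one shaded sector of a crossing in T to the opposite one. *)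
Lemma shaded_side_circle S (A : Type) (h : dart n -> A) :
  (forall x, h (next x) = h x) ->
  (forall x, shaded x -> x.1 \in tait_set S -> h (turn 2 x) = h x) ->
  forall x y, connect (circle_rel S) x y ->
    h (shaded_side x) = h (shaded_side y).
Proof.
move=> hn h2 x _ /connectP[p pp ->]; elim: p x pp => //= y p IH x /andP[xy /IH <-].
rewrite /shaded_side; case/orP: xy => /eqP ->; last first.
  rewrite shade_glue; case: ifP => _ /=.
    by rewrite -/(next x) hn.
  by rewrite -next_glue hn.
rewrite shade_smooth; case: (boolP (shaded x)) => xs /=.
  rewrite smooth_shaded //; case: ifP => xT; last by rewrite turnN1.
  by rewrite turnNN h2.
rewrite smooth_unshaded //; case: ifP => xT //.
by rewrite -[turn 1 x]turn2N h2 // shade_turnN1.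
Qed.

(** Dually, the unshaded side changes only at the crossings outside T. *)
Lemma unshaded_side_circle S (A : Type) (h : dart n -> A) :
  (forall x, h (next x) = h x) ->
  (forall x, ~~ shaded x -> x.1 \notin tait_set S -> h (turn 2 x) = h x) ->
  forall x y, connect (circle_rel S) x y ->
    h (unshaded_side x) = h (unshaded_side y).
Proof.
move=> hn h2 x _ /connectP[p pp ->]; elim: p x pp => //= y p IH x /andP[xy /IH <-].
rewrite /unshaded_side; case/orP: xy => /eqP ->; last first.
  rewrite shade_glue; case: ifP => _ /=.
    by rewrite -next_glue hn.
  by rewrite -/(next x) hn.
rewrite shade_smooth; case: (boolP (shaded x)) => xs /=.
  rewrite smooth_shaded //; case: ifP => xT //.
  by rewrite -[turn 1 x]turn2N h2 ?shade_turnN1 ?negbK ?xT.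
rewrite smooth_unshaded //; case: ifP => xT; first by rewrite turnN1.
by rewrite turnNN h2 ?xT.
Qed.

(** A circle is traversed in both directions by [walk]; the half-edges that are
    unshaded sectors single out one of the two. On the shaded ones the map is
    the identity, to make it a permutation of all half-edges. *)
Definition walk_unshaded S x := if shaded x then x else walk S x.

Lemma walk_unshaded_inj S : injective (walk_unshaded S).
Proof.
have sw x : ~~ shaded x -> ~~ shaded (walk S x).
  by move=> xs; rewrite /walk shade_glue shade_smooth xs.
move=> x y; rewrite /walk_unshaded; case: (boolP (shaded x)) => xs; case: (boolP (shaded y)) => ys //.
- by move=> xE; move: xs; rewrite xE (negPf (sw _ ys)).
- by move=> xE; move: ys; rewrite -xE (negPf (sw _ xs)).
by rewrite /walk => /(inv_inj (@glueK D))/(inv_inj (smoothK S)).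
Qed.

Definition walk_perm S := perm (@walk_unshaded_inj S).

Definition entering x := if shaded x then glue x else x.

Lemma enteringP x : ~~ shaded (entering x).
Proof. by rewrite /entering; case: ifP => [|/negbT //]; rewrite shade_glue => ->. Qed.

Lemma connect_glue S x : connect (circle_rel S) x (glue x).
Proof. by apply: connect1; rewrite /circle_rel /= eqxx orbT. Qed.

Lemma connect_smooth S x : connect (circle_rel S) x (smooth S x).
Proof. by apply: connect1; rewrite /circle_rel /= eqxx. Qed.

Lemma connect_entering S x : connect (circle_rel S) x (entering x).
Proof.
by rewrite /entering; case: ifP => // _; apply: connect_glue.
Qed.

(** Each circle is one orbit of [walk_perm] on the unshaded half-edges, which
    [entering] selects. *)
Lemma connect_porbit S x y : connect (circle_rel S) x y =
  (entering y \in porbit (walk_perm S) (entering x)).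
Proof.
apply/idP/idP => [/connectP[p pp ->]|].
  elim: p x pp => [|y' p IH] x /=; first by rewrite porbit_id.
  case/andP=> xy /IH.
  suff /eqP -> : porbit (walk_perm S) (entering x) == porbit (walk_perm S) (entering y').
    by [].
  rewrite eq_porbit_mem; case/orP: xy => /eqP ->.
    rewrite /entering shade_smooth; case: (boolP (shaded x)) => xs /=.
      have -> : glue x = walk_perm S (smooth S x).
        by rewrite permE /walk_unshaded shade_smooth xs /walk smoothK.
      by have := mem_porbit (walk_perm S) 1 (smooth S x); rewrite expg1.
    have -> : glue (smooth S x) = walk_perm S x.
      by rewrite permE /walk_unshaded (negPf xs).
    by rewrite porbit_sym; have := mem_porbit (walk_perm S) 1 x; rewrite expg1.
  rewrite /entering shade_glue; case: (boolP (shaded x)) => xs /=.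
    by rewrite porbit_id.
  by rewrite glueK porbit_id.
have step x' : connect (circle_rel S) x' (walk_perm S x').
  rewrite permE /walk_unshaded; case: ifP => // _.
  exact: connect_trans (connect_smooth S x') (connect_glue S _).
case/porbitP => i yE; apply: connect_trans (connect_entering S x) _.
rewrite circle_rel_sym; apply: connect_trans (connect_entering S y) _.
rewrite circle_rel_sym yE; elim: i {yE} => [|i IH]; first by rewrite expg0 perm1.
by rewrite expgSr permM; apply: connect_trans IH _.
Qed.

Lemma card_porbits_walk S : #|porbits (walk_perm S)| =
  (#|roots (circle_rel S)| + #|[set x | shaded x]|)%N.
Proof.
have fixs x : shaded x -> porbit (walk_perm S) x = [set x].
  move=> xs; apply/setP => y; rewrite inE; apply/porbitP/eqP => [[i ->]|->]; last first.
    by exists 0%N; rewrite expg0 perm1.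
  elim: i => [|i IH]; first by rewrite expg0 perm1.
  by rewrite expgSr permM IH permE /walk_unshaded xs.
have nfix x y : ~~ shaded x -> y \in porbit (walk_perm S) x -> ~~ shaded y.
  move=> xs yx; apply/negP => ys; have : x \in porbit (walk_perm S) y by rewrite porbit_sym.
  by rewrite fixs // inE => /eqP xy; rewrite xy ys in xs.
pose f x := porbit (walk_perm S) (entering x).
have -> : porbits (walk_perm S) =
    (f @: [set x | roots (circle_rel S) x]) :|: [set [set x] | x in [set x | shaded x]].
  apply/setP => B; rewrite in_setU; apply/imsetP/orP => [[x _ ->]|[]/imsetP[x]].
  - have [xs|xs] := boolP (shaded x).
      by right; apply/imsetP; exists x; rewrite ?inE // fixs.
    left; apply/imsetP; exists (fingraph.root (circle_rel S) x).
      by rewrite inE roots_root //; apply: circle_rel_sym.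
    apply/eqP; rewrite /f eq_porbit_mem.
    have := connect_root (circle_rel S) x; rewrite connect_porbit.
    by rewrite porbit_sym /entering (negPf xs).
  - by move=> _ ->; exists (entering x).
  - by rewrite inE => xs ->; exists x; rewrite // fixs.
rewrite cardsU.
have -> : (f @: [set x | roots (circle_rel S) x]) :&:
    [set [set x] | x in [set x | shaded x]] = set0.
  apply/setP => B; rewrite !inE; apply/negP => /andP[/imsetP[x _ ->] /imsetP[y]].
  rewrite inE => ys fy; have := porbit_id (walk_perm S) (entering x).
  by rewrite -/(f x) fy inE => /eqP xy; have := enteringP x; rewrite xy ys.
rewrite cards0 subn0 (card_imset _ (@set1_inj _)).
rewrite card_in_imset; first by congr (_ + _)%N; apply: eq_card => x; rewrite inE.
move=> x y; rewrite !inE => /eqP xr /eqP yr /eqP; rewrite eq_porbit_mem.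
rewrite porbit_sym -connect_porbit => xy; rewrite -xr -yr.
by apply/eqP; rewrite root_connect //; apply: circle_rel_sym.
Qed.

Lemma card_circle S : #|circle S| = (#|roots (circle_rel S)| + nfree D)%N.
Proof. by rewrite card_sum card_ord card_sig; congr (_ + _)%N; apply: eq_card. Qed.

Lemma tait_setU1 S S' c : tait_set S' = c |: tait_set S -> c \notin tait_set S ->
  forall x, smooth S' x = smooth S (if x.1 == c then turn 2 x else x).
Proof.
move=> S'E cT x; have [xs|xs] := boolP (shaded x).
  rewrite smooth_shaded // smooth_shaded; last first.
    by case: ifP; rewrite ?shade_turn2.
  rewrite S'E in_setU1; case: eqP => [xc|_] //=.
  by rewrite xc (negPf cT) turn12.
rewrite smooth_unshaded // smooth_unshaded; last first.
  by case: ifP; rewrite ?shade_turn2.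
rewrite S'E in_setU1; case: eqP => [xc|_] //=.
by rewrite xc (negPf cT) turnN2.
Qed.

Lemma opposite_unshaded x y : ~~ shaded x -> ~~ shaded y -> x.1 = y.1 ->
  y = x \/ y = turn 2 x.
Proof.
rewrite (shade_parity x) (shade_parity y) => + + xy; rewrite xy.
move=> xs ys; have {xs ys} : odd x.2 = odd y.2.
  by move: xs ys; case: (shaded _); case: odd; case: odd.
case: x y xy => [c [j ltj]] [d [l ltl]] /= <- .
do 5?[case: j ltj => [|j] ltj //]; do 5?[case: l ltl => [|l] ltl //] => _;
  do ?[by left; congr (_, _); apply: val_inj];
  by right; congr (_, _); apply: val_inj.
Qed.

(** Changing the smoothing at c composes the walk with the transposition of the
    two unshaded sectors of c, which changes the number of orbits by one. *)
Lemma card_circle_step S S' c : tait_set S' = c |: tait_set S -> c \notin tait_set S ->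
  (#|circle S'| + (~~ connect (circle_rel S) (c, 0%R) (c, 2%R)).*2 = #|circle S| + 1)%N.
Proof.
move=> S'E cT; pose d : dart n := if shaded (c, 0) then turn 1 (c, 0) else (c, 0).
have ds : ~~ shaded d.
  by rewrite /d; case: ifP => [cs|/negbT //]; rewrite shade_adjacent cs.
have dne : d != turn 2 d := turn_neq2 d.
(* d is an unshaded sector at c *)
have E : walk_perm S' = (tperm d (turn 2 d) * walk_perm S)%g.
  apply/permP => x; rewrite permM [LHS]permE /walk_unshaded /walk.
  rewrite (tait_setU1 S'E cT).
  have dc : d.1 = c by rewrite /d; case: ifP.
  case: tpermP => [->|->|xd xd2]; rewrite [RHS]permE /walk_unshaded /walk.
  - by rewrite dc eqxx shade_turn2 (negPf ds).
  - by rewrite turn_fst dc eqxx shade_turn2 turn22 (negPf ds).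
  case: ifP => // /negbT xs; case: eqP => // xc.
  by case: (opposite_unshaded ds xs); rewrite ?xc.
have conn : (d \notin porbit (walk_perm S) (turn 2 d)) =
    ~~ connect (circle_rel S) ((c, 0) : dart n) (c, 2).
  congr (~~ _); have -> : (d \in porbit (walk_perm S) (turn 2 d)) =
      connect (circle_rel S) (turn 2 d) d.
    by rewrite connect_porbit /entering shade_turn2 (negPf ds).
  rewrite circle_rel_sym -[(c, 2)]turn_at /d; case: ifP => cs; last by [].
  have st j : connect (circle_rel S) (turn j ((c, 0) : dart n)) (smooth S (turn j ((c, 0) : dart n))).
    exact: connect_smooth.
  have c1 : shaded (turn 2 ((c, 0) : dart n)) by rewrite shade_turn2.
  have := st 0; rewrite turn0 smooth_shaded //= => h0.
  have := st 2; rewrite smooth_shaded //= => h2.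
  have same x y x' y' : connect (circle_rel S) x x' -> connect (circle_rel S) y y' ->
      connect (circle_rel S) x y = connect (circle_rel S) x' y'.
    move=> xx yy; rewrite (same_connect (circle_rel_sym S) xx).
    by rewrite circle_rel_sym (same_connect (circle_rel_sym S) yy) circle_rel_sym.
  rewrite (same _ _ _ _ h0 h2); case: (c \in tait_set S) => //=.
    by rewrite turnN2 turn21 circle_rel_sym.
  by rewrite turn12 turn21.
have := porbits_mul_tperm (walk_perm S) d (turn 2 d).
cbv zeta; rewrite -E dne conn (card_porbits_walk S) (card_porbits_walk S').
rewrite [X in _ -> (X + _)%N = _](card_circle S').
rewrite [X in _ -> _ = (X + _)%N](card_circle S).
have arith (p q r k b : nat) : (p + r + b = q + r + true -> p + k + b = q + k + 1)%N.
  by lia.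
exact: arith.
Qed.

End Circles.

(** * Regions and planarity *)

Section DotProductTheory.
Variables (F : fieldType) (J : finType).
Implicit Types u v w : freev F J.

Lemma dotpC u v : dotp u v = dotp v u.
Proof. by apply: eq_bigr => j _; rewrite mulrC. Qed.

Lemma dotp_basis u j : dotp u (basisv F j) = u j.
Proof.
rewrite /dotp (bigD1 j) //= ffunE eqxx mulr1 big1 ?addr0 // => i /negPf ij.
by rewrite ffunE ij mulr0.
Qed.

Lemma dotp_sumr (I : Type) (r : seq I) (P : pred I) (f : I -> freev F J) u :
  dotp u (\sum_(i <- r | P i) f i) = \sum_(i <- r | P i) dotp u (f i).
Proof. exact: sform_sumr. Qed.

Lemma dotp_suml (I : Type) (r : seq I) (P : pred I) (f : I -> freev F J) u :
  dotp (\sum_(i <- r | P i) f i) u = \sum_(i <- r | P i) dotp (f i) u.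
Proof. by rewrite dotpC dotp_sumr; apply: eq_bigr => i _; rewrite dotpC. Qed.

Lemma dotpZr a u v : dotp u (a *: v) = a * dotp u v.
Proof. by rewrite mulr_sumr; apply: eq_bigr => j _; rewrite ffunE [in LHS]mulrCA. Qed.

Lemma dotpZl a u v : dotp (a *: u) v = a * dotp u v.
Proof. by rewrite dotpC dotpZr dotpC. Qed.

Lemma dotpBr u v w : dotp w (u - v) = dotp w u - dotp w v.
Proof. by rewrite -sumrB; apply: eq_bigr => j _; rewrite !ffunE mulrBr. Qed.

Lemma dotpBl u v w : dotp (u - v) w = dotp u w - dotp v w.
Proof. by rewrite dotpC dotpBr !(dotpC w). Qed.

Lemma dotp0r u : dotp u 0 = 0.
Proof. by rewrite /dotp big1 // => j _; rewrite ffunE mulr0. Qed.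

End DotProductTheory.

Section Boundary.
Variables (D : link_diagram) (F : fieldType).
Local Notation n := (ncross D).
Local Notation glue := (@glue D).
Local Notation next := (next_sector glue).

Lemma froot_next x : froot next (next x) = froot next x.
Proof.
apply/esym/eqP; rewrite root_connect; first exact: fconnect1.
exact/fconnect_sym/next_inj.
Qed.

Section Color.
Variable color : checkerboard D.

Definition color_region : finType := {x : dart n | froots next x && color x}.

Definition color_vec (x : dart n) : freev F color_region :=
  [ffun v => (val v == froot next x)%:R : F^o].

Lemma color_vec_next x : color_vec (next x) = color_vec x.
Proof. by apply/ffunP => v; rewrite !ffunE froot_next. Qed.

Lemma color_fconnect x y : fconnect next x y -> color y = color x.
Proof.
move=> /connectP[p pp ->]; elim: p x pp => //= z p IH x /andP[/eqP xz pp].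
by rewrite (IH _ pp) -xz shade_region.
Qed.

Lemma color_froot x : color (froot next x) = color x.
Proof. exact: color_fconnect (connect_root _ _). Qed.

Lemma color_vec_root (v : color_region) : color_vec (val v) = basisv F v.
Proof.
have /andP[/eqP vr _] := valP v.
by apply/ffunP => w; rewrite !ffunE vr val_eqE.
Qed.

Lemma opposite_color x y : color x -> color y -> x.1 = y.1 -> y = x \/ y = turn 2 x.
Proof.
move=> xs ys xy.
have := @opposite_unshaded D color (turn 1 x) (turn 1 y).
rewrite !shade_adjacent xs ys => /(_ isT isT xy)[/turn_inj|yE]; first by left.
by right; apply: (@turn_inj _ 1); rewrite yE !turn_turn addrC.
Qed.

Definition diagram_components : finType := {x : dart n | roots (adjacent glue) x}.

Lemma adjacent_sym : connect_sym (adjacent glue).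
Proof.
have turn4 x (y : dart n) : y = turn 1 x -> connect (adjacent glue) y x.
  move=> ->; have st z : connect (adjacent glue) z (turn 1 z).
    by apply: connect1; rewrite /adjacent /= eqxx.
  have xE : x = turn 1 (turn 1 (turn 1 (turn 1 x))).
    by rewrite !turn_turn -[LHS]turn0; congr (turn _ _); apply: val_inj.
  rewrite [X in connect _ _ X]xE.
  exact: connect_trans (st _) (connect_trans (st _) (st _)).
have half x y : connect (adjacent glue) x y -> connect (adjacent glue) y x.
  case/connectP => p pp ->; elim: p x pp => [|z p IH] x //= /andP[xz /IH zp].
  apply: connect_trans zp _; case/orP: xz => /eqP zE; first exact: turn4.
  by apply: connect1; rewrite /adjacent /= zE glueK eqxx orbT.
by move=> x y; apply/idP/idP; apply: half.
Qed.

Variable t : 'I_n -> dart n.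
Hypothesis t_at : forall c, (t c).1 = c.
Hypothesis t_color : forall c, color (t c).

Definition color_edge c : freev F color_region :=
  color_vec (t c) - color_vec (turn 2 (t c)).

(** The functions on the regions of one colour, with the differences across the
    crossings: f |-> (f(t c) - f(opposite of t c))_c, where t chooses one of the
    two sectors of that colour at each crossing. *)
Definition coboundary (f : freev F color_region) : freev F 'I_n :=
  [ffun c => dotp f (color_edge c) : F^o].

Fact coboundary_is_linear : linear coboundary.
Proof. by move=> a f g; apply/ffunP => c; rewrite !ffunE linearPl. Qed.
HB.instance Definition _ :=
  GRing.isLinear.Build F (freev F color_region) (freev F 'I_n) *:%R
    coboundary coboundary_is_linear.

(** The kernel consists of the functions that take the same value on opposite
    sectors, which are constant on the components of the diagram. *)
Lemma dim_coboundary :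
  (#|color_region| <= \dim (limg (linfun coboundary)) + #|diagram_components|)%N.
Proof.
pose side x := if color x then x else turn (-1) x.
pose ev (f : freev F color_region) : freev F diagram_components :=
  [ffun k => dotp f (color_vec (side (val k))) : F^o].
have ev_lin : linear ev by move=> a f g; apply/ffunP => c; rewrite !ffunE linearPl.
pose evL := GRing.isLinear.Build F _ _ _ ev ev_lin.
pose evl : {linear freev F color_region -> freev F diagram_components} :=
  HB.pack ev evL.
have := limg_ker_dim (linfun coboundary) fullv; rewrite capfv dim_freev => <-.
rewrite addnC leq_add2l.
have <- : \dim (linfun evl @: lker (linfun coboundary)) = \dim (lker (linfun coboundary)).
  apply: limg_dim_eq; apply/eqP; rewrite -subv0; apply/subvP => f.
  rewrite memv_cap !memv_ker !lfunE memv0 => /andP[/eqP kf /eqP ef].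
  have kerf c : dotp f (color_vec (t c)) = dotp f (color_vec (turn 2 (t c))).
    have /ffunP/(_ c) := kf; rewrite !ffunE linearBr /= => /eqP.
    by rewrite subr_eq0 => /eqP.
  have opp x : color x -> dotp f (color_vec (turn 2 x)) = dotp f (color_vec x).
    move=> xs; pose c := x.1.
    have [] : x = t c \/ x = turn 2 (t c).
      apply: (opposite_color (t_color c) xs); exact: t_at.
      by move=> ->; rewrite kerf.
    by move=> ->; rewrite turn22 kerf.
  have adj x y : connect (adjacent glue) x y ->
      dotp f (color_vec (side x)) = dotp f (color_vec (side y)).
    case/connectP => p pp ->; elim: p x pp => //= z p IH x /andP[xz /IH <-].
    rewrite /side; case/orP: xz => /eqP ->.
      rewrite shade_adjacent; case: (boolP (color x)) => xs /=; first by rewrite turnN1.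
      by rewrite -[turn 1 x]turn2N opp // shade_turnN1.
    rewrite shade_glue; case: (boolP (color x)) => xs /=.
      by rewrite -/(next x) color_vec_next.
    by rewrite -next_glue color_vec_next.
  apply/eqP/ffunP => v; rewrite [RHS]ffunE -dotp_basis -color_vec_root.
  have vs : color (val v) by case/andP: (valP v).
  have -> : val v = side (val v) by rewrite /side vs.
  rewrite (adj _ _ (connect_root _ _)).
  have rt : roots (adjacent glue) (fingraph.root (adjacent glue) (val v)).
    exact: (roots_root adjacent_sym).
  have /ffunP/(_ (Sub _ rt)) := ef.
  by rewrite !ffunE.
by rewrite -(dim_freev F diagram_components) dimvS ?subvf.
Qed.
End Color.
End Boundary.

(** * A potential on the unshaded regions *)

Lemma graph_vec_coord (F : fieldType) (I K : finType) (a b : I -> K) e v :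
  graph_vec F a b e v = (v == a e)%:R - (v == b e)%:R.
Proof. by rewrite !ffunE. Qed.

Section Dual.
Variables (D : link_diagram) (F : fieldType).
Hypothesis charF : [pchar F] =i pred0.
Variables (shaded : checkerboard D) (edge_dir : 'I_(ncross D) -> bool).
Local Notation n := (ncross D).
Local Notation glue := (@glue D).
Local Notation next := (next_sector glue).
Local Notation source := (edge_source shaded edge_dir).
Local Notation edge := (@edge_vec D F shaded edge_dir).

Fact neg_region x : ~~ shaded (next x) = ~~ shaded x.
Proof. by rewrite shade_region. Qed.
Fact neg_adjacent x : ~~ shaded (turn 1 x) = ~~ ~~ shaded x.
Proof. by rewrite shade_adjacent. Qed.
(** The opposite colouring, whose coloured regions are the faces of the Tait
    graph. *)
Definition dual_board : checkerboard D := Checkerboard neg_region neg_adjacent.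

Lemma source_at c : (source c).1 = c. Proof. by []. Qed.

Lemma source_shaded c : shaded (source c).
Proof.
rewrite /edge_source; have sh : shaded (turn (if shaded (c, 0) then 0 else 1) (c, 0)).
  by case: ifP => cs; rewrite ?turn0 // shade_adjacent cs.
case: (edge_dir c) => //; rewrite -[(c, 2)]turn_at turn_turn addrC -turn_turn.
by rewrite shade_turn2.
Qed.

Fact tait_vertex_subproof x : shaded x -> froots next (froot next x) && shaded (froot next x).
Proof.
move=> xs; rewrite color_froot xs andbT.
by apply: roots_root; apply: fconnect_sym; apply: next_inj.
Qed.

Definition region_vertex x (xs : shaded x) : tait_vertex shaded :=
  inl (exist _ (froot next x) (tait_vertex_subproof xs)).

Lemma region_vecE x (xs : shaded x) : region_vec F shaded x = basisv F (region_vertex xs).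
Proof.
by apply/ffunP => -[v|i]; rewrite !ffunE.
Qed.

Lemma region_vec_next x : region_vec F shaded (next x) = region_vec F shaded x.
Proof.
apply/ffunP => -[v|i]; last by rewrite !ffunE.
by rewrite !ffunE froot_next.
Qed.

Lemma target_shaded c : shaded (turn 2 (source c)).
Proof. by rewrite shade_turn2 source_shaded. Qed.

Lemma edge_vecE c : edge c =
  graph_vec F (fun c => region_vertex (source_shaded c))
    (fun c => region_vertex (target_shaded c)) c.
Proof.
by rewrite /edge_vec (region_vecE (source_shaded c)) (region_vecE (target_shaded c)).
Qed.

Lemma edge_vec_int c v : edge c v =
  ((v == region_vertex (source_shaded c))%:R - (v == region_vertex (target_shaded c))%:R : int)%:~R.
Proof.
rewrite edge_vecE graph_vec_coord intrB.
by congr (_ - _); case: (v == _).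
Qed.

Lemma sum_shaded (A : nmodType) (h : dart n -> A) :
  \sum_(x | shaded x) h x = \sum_c (h (source c) + h (turn 2 (source c))).
Proof.
rewrite (partition_big (fun x : dart n => x.1) predT) //=.
apply: eq_bigr => c _.
rewrite (bigD1 (source c)) /=; last by rewrite source_shaded eqxx.
rewrite (bigD1 (turn 2 (source c))) /=; last first.
  by rewrite target_shaded eqxx eq_sym turn_neq2.
rewrite big1 ?addr0 // => x /andP[/andP[/andP[xs /eqP xc] x1] x2].
have [|xE|xE] := @opposite_color D shaded (source c) x (source_shaded c) xs.
- by rewrite xc.
- by rewrite xE eqxx in x1.
- by rewrite xE eqxx in x2.
Qed.

(** The edges around an unshaded region form a cycle of the Tait graph: going
    around the region, each shaded neighbour is entered and left. *)
Lemma boundary_relation f :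
  relation edge (coboundary (color := dual_board) (fun c => turn 1 (source c)) f).
Proof.
pose u x : F := dotp f (color_vec F dual_board x).
have un x : u (next x) = u x by rewrite /u color_vec_next.
pose r x := region_vec F shaded x.
rewrite /relation; under eq_bigr => c _.
  rewrite ffunE /color_edge linearBr /= -/(u _) -/(u _) turn_turn.
  rewrite (_ : edge c = r (source c) - r (turn 2 (source c))) //.
  over.
rewrite /= (eq_bigr (fun c => (fun x => u (turn 1 x) *: r x - u (turn (-1) x) *: r x) (source c)
   + (fun x => u (turn 1 x) *: r x - u (turn (-1) x) *: r x) (turn 2 (source c)))); last first.
  move=> c _ /=; rewrite turn12 turnN2.
  have -> : turn (1 + 2) (source c) = turn (-1) (source c).
    by congr (turn _ _); apply: val_inj.
  rewrite scalerBl !scalerBr opprB [X in _ + X]addrC addrACA.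
  by congr (_ + _); rewrite addrC.
rewrite -(sum_shaded (fun x => u (turn 1 x) *: r x - u (turn (-1) x) *: r x)).
rewrite sumrB subr_eq0 (reindex_inj (@next_inj D)) /=.
apply/eqP; apply: eq_big => x; first exact: shade_region.
move=> _; rewrite /r region_vec_next /next_sector turn1N.
by rewrite -[u (glue x)]un next_glue.
Qed.

Lemma relation_color w : relation edge w ->
  relation (color_edge F shaded source) w.
Proof.
rewrite /relation => /eqP w0; apply/eqP/ffunP => v.
have E : (\sum_i (w i : F) *: edge i) (inl v) = 0 by rewrite w0 ffunE.
rewrite sum_ffunE in E; rewrite sum_ffunE [RHS]ffunE -[RHS]E.
by apply: eq_bigr => c _; rewrite !ffunE.
Qed.

Definition relation_space (V : vectType F) (vec : 'I_n -> V) : {vspace freev F 'I_n} :=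
  lker (linfun (fun w : freev F 'I_n => \sum_i (w i : F) *: vec i)).

Lemma mem_relation_space (V : vectType F) (vec : 'I_n -> V) w :
  (w \in relation_space vec) = relation vec w.
Proof.
pose g (w : freev F 'I_n) := \sum_i (w i : F) *: vec i.
have glin : linear g.
  move=> a x y; rewrite /g scaler_sumr -big_split; apply: eq_bigr => i _.
  by rewrite !ffunE scalerDl scalerA.
pose gL := GRing.isLinear.Build F _ _ _ g glin.
pose gl : {linear freev F 'I_n -> V} := HB.pack g gL.
by rewrite memv_ker -[linfun _]/(linfun gl) lfunE.
Qed.

(** The cycle space is cut out by equations with integer coefficients. *)
Lemma nondeg_relations (T : {set 'I_n}) (U : {vspace freev F 'I_n}) :
  (forall w, (w \in U) = relation edge w && [forall e, (e \notin T) ==> (w e == 0)]) ->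
  nondeg (@dotp F 'I_n) U.
Proof.
move=> UE u uU uo.
pose k (i : (tait_vertex shaded + 'I_n)%type) (e : 'I_n) : int :=
  match i with
  | inl v => (v == region_vertex (source_shaded e))%:R
             - (v == region_vertex (target_shaded e))%:R
  | inr r => ((r \notin T) && (r == e))%:R
  end.
have kP w : (w \in U) <-> (forall i, \sum_j (k i j)%:~R * w j = 0).
  rewrite UE; split=> [/andP[/eqP wr /forallP wT] [v|r] | wk].
  - have E : (\sum_i (w i : F) *: edge i) v = 0 by rewrite wr ffunE.
    rewrite sum_ffunE in E; rewrite -[RHS]E; apply: eq_bigr => e _.
    by rewrite [in RHS]ffunE edge_vec_int mulrC.
  - rewrite (bigD1 r) //= eqxx andbT big1 ?addr0.
      case: (boolP (r \in T)) => rT; first by rewrite mul0r.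
      by have := wT r; rewrite rT /= => /eqP ->; rewrite mulr0.
    by move=> e er; rewrite eq_sym (negPf er) andbF mul0r.
  apply/andP; split.
    apply/eqP/ffunP => v; rewrite sum_ffunE [RHS]ffunE -[RHS](wk (inl v)).
    by apply: eq_bigr => e _; rewrite [in LHS]ffunE edge_vec_int mulrC.
  apply/forallP => r; apply/implyP => rT.
  have := wk (inr r); rewrite (bigD1 r) //= eqxx rT big1 ?addr0 => [|e er].
    by rewrite mul1r => /eqP.
  by rewrite eq_sym (negPf er) andbF mul0r.
apply: (int_system_nondegenerate charF (k := k)); first exact/kP.
by move=> v /kP/uo.
Qed.

Lemma card_regions :
  (#|color_region shaded| + #|color_region dual_board| = n + 2 * #|diagram_components D|)%N.
Proof.
have -> : #|diagram_components D| = n_comp (adjacent glue) predT.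
  by rewrite card_sig; apply: eq_card => x; rewrite !inE andbT.
rewrite -(ld_planar D) !card_sig /n_comp_mem.
have -> : #|[predI froots next & predT]| = #|froots next|.
  by apply: eq_card => x; rewrite !inE andbT.
rewrite -(cardID (mem [pred x | shaded x]) (froots next)).
by congr (_ + _)%N; apply: eq_card => x; rewrite !inE // andbC.
Qed.

(** Planarity enters here. The boundaries of unshaded regions are cycles, and the
    coboundaries of shaded regions are orthogonal to the cycles. By Euler's
    formula the lower bounds of [dim_coboundary] for the two colours add up to
    n, so all the inclusions are equalities. *)
Lemma relations_are_boundaries :
  relation_space edge =
  limg (linfun (coboundary (F := F) (color := dual_board) (fun c => turn 1 (source c)))).
Proof.
set B := limg _; apply/eqP; rewrite eq_sym eqEdim; apply/andP; split.
  apply/subvP => w /memv_imgP[f _ ->]; rewrite mem_relation_space lfunE.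
  exact: boundary_relation.
have d1 : (#|color_region dual_board| <= \dim B + #|diagram_components D|)%N.
  apply: dim_coboundary => // c.
  by rewrite /= shade_adjacent source_shaded.
have d2 := dim_coboundary F source_at source_shaded.
set B' := limg _ in d2.
have nd : nondeg (@dotp F 'I_n) (relation_space edge).
  apply: (@nondeg_relations setT) => w; rewrite mem_relation_space.
  by rewrite (_ : [forall e, _] = true) ?andbT //; apply/forallP => e; rewrite inE.
have B'W : (B' <= orthov (@dotp F 'I_n) (relation_space edge))%VS.
  apply/subvP => _ /memv_imgP[f _ ->]; rewrite lfunE; apply/mem_orthovP => w.
  rewrite mem_relation_space => /relation_color/eqP wr.
  transitivity (dotp f (\sum_c (w c : F) *: color_edge F shaded source c)).
    rewrite dotp_sumr; apply: eq_bigr => c _.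
    by rewrite ffunE dotpZr mulrC.
  by rewrite wr dotp0r.
have := dimvS B'W; have := card_regions.
have : (\dim (relation_space edge) + \dim (orthov (@dotp F 'I_n) (relation_space edge)) = n)%N.
  rewrite -dimv_disjoint_sum ?nondeg_cap // nondeg_sum // dim_freev.
  by rewrite card_ord.
move: d1 d2; move: #|_| #|_| #|_| (\dim _) (\dim _) (\dim _) (\dim _) => a b c d e f g.
by lia.
Qed.

(** A primitive, on the unshaded regions, of the coordinate functionals w |-> w c
    on the cycle space: its jump across the edge c is the coordinate c. As
    cycles are boundaries w = d f, the functional w |-> f(u) at a region u is
    such a primitive, after a choice of f for each w. *)
Lemma dual_potential : exists y : dart n -> freev F 'I_n,
  (forall x, y (next x) = y x) /\
  (forall c w, relation edge w ->
    dotp (y (turn 1 (source c)) - y (turn 3 (source c))) w = w c).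
Proof.
pose t c := turn 1 (source c).
pose L := (linfun (coboundary (F := F) (color := dual_board) t))^-1%VF.
exists (fun x => [ffun c => dotp (L (basisv F c)) (color_vec F dual_board x) : F^o]); split.
  by move=> x; apply/ffunP => c; rewrite !ffunE color_vec_next.
move=> c w wr.
have yE x : dotp ([ffun c => dotp (L (basisv F c)) (color_vec F dual_board x) : F^o]
     : freev F 'I_n) w = dotp (L w) (color_vec F dual_board x).
  rewrite [in RHS](freev_sum w) linear_sum dotp_suml; apply: eq_bigr => e _.
  by rewrite ffunE linearZ dotpZl mulrC.
rewrite dotpBl !yE -dotpBr.
have /ffunP/(_ c) : linfun (coboundary (F := F) (color := dual_board) t) (L w) = w.
  apply: limg_lfunVK; rewrite -relations_are_boundaries.
  by rewrite mem_relation_space.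
rewrite lfunE ffunE => <-; congr (dotp _ (_ - color_vec _ _ _)).
by rewrite /t turn_turn; congr (turn _ _); apply: val_inj.
Qed.
End Dual.

(** * The subspaces of a link arrangement *)

Lemma graph_vec_sum (F : fieldType) (I K : finType) (a b : I -> K) e :
  \sum_v graph_vec F a b e v = 0.
Proof.
have one k : \sum_v (v == k)%:R = 1 :> F.
  by rewrite (bigD1 k) //= eqxx big1 ?addr0 // => v /negPf ->.
by under eq_bigr do rewrite graph_vec_coord; rewrite sumrB !one subrr.
Qed.

Section Arrangement.
Variables (D : link_diagram) (F : fieldType).
Variable charF : [pchar F] =i pred0.
Variables (shaded : checkerboard D) (edge_dir : 'I_(ncross D) -> bool).
Local Notation n := (ncross D).
Local Notation edge := (@edge_vec D F shaded edge_dir).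
Local Notation A := (link_arrangement charF shaded edge_dir).
Local Notation V := (sa_space A).
Local Notation form := (sa_form A).
Local Notation nu := (@sa_vec F n A).
Implicit Types (T : {set 'I_n}) (e : 'I_n).

Local Notation tspace := (@tait_space D F shaded).

Lemma mem_tait_space (u : freev F (tait_vertex shaded)) :
  (u \in tspace) = (\sum_v u v == 0).
Proof.
rewrite mem_orthov1; congr (_ == _); apply: eq_bigr => v _.
by rewrite ffunE mulr1.
Qed.

Lemma edge_tait e : edge e \in tspace.
Proof.
by rewrite mem_tait_space edge_vecE graph_vec_sum.
Qed.

Lemma vsval_nu e : vsval (nu e) = edge e.
Proof. exact: (vsprojK (edge_tait e)). Qed.

Lemma relation_nu w : relation nu w = relation edge w.
Proof.
rewrite /relation.
have E : vsval (\sum_i (w i : F) *: nu i) = \sum_i (w i : F) *: edge i.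
  by rewrite linear_sum; apply: eq_bigr => i _; rewrite linearZ /= vsval_nu.
apply/eqP/eqP => [w0|w0]; first by rewrite -E w0.
by apply: val_inj; rewrite /= E w0.
Qed.

Lemma formE (u v : V) : form u v = dotp (vsval u) (vsval v).
Proof. by []. Qed.

Lemma mem_sa_H T (v : V) : (v \in sa_H A T) = [forall s in T, form v (nu s) == 0].
Proof.
rewrite memvE; apply/subv_bigcapP/forall_inP => vT s sT.
  by have := vT s sT; rewrite -memvE mem_orthov1.
by rewrite -memvE mem_orthov1 vT.
Qed.

Lemma sa_H_orthov T : sa_H A T = orthov form (sa_span A T).
Proof.
apply/vspaceP => v; rewrite mem_sa_H; apply/forall_inP/mem_orthovP => [vT w|vT s sT].
  case/memv_sumP => ws wsP ->; rewrite sform_sumr big1 // => s sT.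
  by have /vlineP[k ->] := wsP s sT; rewrite sformZr (eqP (vT s sT)) mulr0.
apply/eqP/vT; apply: (subvP (sumv_sup s sT (subvv _))); exact: memv_line.
Qed.

Lemma mem_sa_W T w : (w \in sa_W A T) =
  relation edge w && [forall e, (e \notin T) ==> (w e == 0)].
Proof.
rewrite memv_cap; congr (_ && _); first by rewrite -relation_nu -mem_relation_space.
pose ev e (w : freev F 'I_n) : F^o := w e.
have evl e : linear (ev e) by move=> a x y; rewrite /ev !ffunE.
have evE e x : linfun (fun w : freev F 'I_n => w e : F^o) x = x e.
  pose gL := GRing.isLinear.Build F _ _ _ (ev e) (evl e).
  pose gl : {linear freev F 'I_n -> F^o} := HB.pack (ev e) gL.
  by rewrite -[linfun _]/(linfun gl) lfunE.
rewrite memvE; apply/subv_bigcapP/forallP => wT e.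
  by apply/implyP => /wT; rewrite -memvE memv_ker evE.
by move=> eT; rewrite -memvE memv_ker evE (implyP (wT e)).
Qed.

Lemma nondeg_W T : nondeg (@dotp F 'I_n) (sa_W A T).
Proof. by apply: (nondeg_relations charF (T := T)) => w; rewrite mem_sa_W. Qed.

(** H_T is cut out of the ambient space by the equations given by the edge
    vectors and by the all-one vector, which have integer coefficients. *)
Lemma nondeg_H T : nondeg form (sa_H A T).
Proof.
move=> u uT uo.
pose k (i : option 'I_n) (v : tait_vertex shaded) : int :=
  match i with
  | None => 1
  | Some e => if e \in T then (v == region_vertex (source_shaded shaded edge_dir e))%:R
             - (v == region_vertex (target_shaded shaded edge_dir e))%:R else 0
  end.
have kP (w : freev F (tait_vertex shaded)) : (forall i, \sum_j (k i j)%:~R * w j = 0) <->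
    (exists2 v, v \in sa_H A T & w = vsval v).
  have kE e : e \in T -> \sum_j (k (Some e) j)%:~R * w j = dotp w (edge e).
    by move=> eT; apply: eq_bigr => v _; rewrite /k eT -edge_vec_int mulrC.
  split=> [wk|[v vT ->]].
    have wt : w \in tspace.
      by rewrite mem_tait_space -[X in _ == X](wk None); apply/eqP/eq_bigr => v _; rewrite mul1r.
    exists (vsproj tspace w); last by rewrite vsprojK.
    rewrite mem_sa_H; apply/forall_inP => e eT.
    by rewrite formE vsprojK // vsval_nu -kE // wk.
  case=> [e|]; last first.
    rewrite -[RHS](eqP (_ : \sum_t vsval v t == 0)) -?mem_tait_space ?subvsP //.
    by apply: eq_bigr => t _; rewrite mul1r.
  have [eT|eT] := boolP (e \in T); last first.
    by rewrite big1 // => t _; rewrite /k (negPf eT) mul0r.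
  transitivity (dotp (vsval v) (edge e)).
    by apply: eq_bigr => t _; rewrite /k eT -edge_vec_int mulrC.
  rewrite -vsval_nu -formE; apply/eqP.
  by move: vT; rewrite mem_sa_H => /forall_inP; apply.
apply: val_inj; apply: (int_system_nondegenerate charF (k := k)).
  by apply/kP; exists u.
by move=> _ /kP[v vT ->]; apply: uo.
Qed.

Lemma sa_H_anti T T' : T \subset T' -> (sa_H A T' <= sa_H A T)%VS.
Proof.
move=> /subsetP TT'; apply/subvP => v; rewrite !mem_sa_H => /forall_inP vT.
by apply/forall_inP => s /TT'/vT.
Qed.

Lemma sa_W_mono T T' : T \subset T' -> (sa_W A T <= sa_W A T')%VS.
Proof.
move=> /subsetP TT'; apply/subvP => w; rewrite !mem_sa_W => /andP[-> /forallP wT].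
apply/forallP => e; apply/implyP => eT'; apply: (implyP (wT e)).
by apply: contra eT'; apply: TT'.
Qed.

(** The projections onto H_T and W_T. Both are compatible with the maps of the
    arrangement complex: exactly for the projections between these spaces, and
    modulo one vector for the inclusions ([sub_inclH], [sub_inclW]). *)
Definition pH T : V -> subvs_of (sa_H A T) := oproj form (sa_H A T).
Definition qW T : freev F 'I_n -> subvs_of (sa_W A T) := oproj (@dotp F 'I_n) (sa_W A T).
HB.instance Definition _ T := GRing.Linear.on (pH T).
HB.instance Definition _ T := GRing.Linear.on (qW T).

Lemma pH_surj T h : pH T (vsval h) = h.
Proof. exact/oproj_surj/nondeg_H. Qed.

Lemma qW_surj T w : qW T (vsval w) = w.
Proof. exact/oproj_surj/nondeg_W. Qed.

Lemma qW_congr T u v : (forall w, relation edge w -> dotp u w = dotp v w) -> qW T u = qW T v.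
Proof.
move=> uv; apply: oproj_congr; first exact: nondeg_W.
by move=> w; rewrite mem_sa_W => /andP[/uv].
Qed.

Lemma qW_eq0 T z : qW T z = 0 <-> (forall w, w \in sa_W A T -> dotp z w = 0).
Proof. exact: oproj_eq0 (@nondeg_W T). Qed.

Lemma sub_projH T T' v : T \subset T' -> sub_proj_H T' (pH T v) = pH T' v.
Proof. by move=> TT'; apply: oproj_oproj; [exact: nondeg_H..|exact: sa_H_anti]. Qed.

Lemma sub_projW T T' z : T \subset T' -> sub_proj_W T (qW T' z) = qW T z.
Proof. by move=> TT'; apply: oproj_oproj; [exact: nondeg_W..|exact: sa_W_mono]. Qed.

Lemma sub_inclH T e v :
  exists k, sub_incl_H T (pH (e |: T) v) = pH T v + k *: pH T (nu e).
Proof.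
have TT : T \subset e |: T by apply: subsetUr.
have [] := @oproj_hyperplane _ _ form _ _ v (nu e) (@nondeg_H T) (@nondeg_H (e |: T)) (sa_H_anti TT).
  move=> u; rewrite !mem_sa_H => /forall_inP uT ue; apply/forall_inP => s.
  by rewrite in_setU1 => /predU1P[->|/uT //]; rewrite sformC ue.
move=> k kE; exists k; rewrite -kE; apply/esym/oproj_incl; first exact: nondeg_H.
by apply: (subvP (sa_H_anti TT)); apply: subvsP.
Qed.

Lemma sub_inclW T e z :
  exists k, sub_incl_W (e |: T) (qW T z) = qW (e |: T) z + k *: qW (e |: T) (basisv F e).
Proof.
have TT : T \subset e |: T by apply: subsetUr.
have [] := @oproj_hyperplane _ _ (@dotp F 'I_n) _ _ z (basisv F e) (@nondeg_W (e |: T)) (@nondeg_W T) (sa_W_mono TT).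
  move=> w; rewrite !mem_sa_W => /andP[-> /forallP wT].
  rewrite -[sesquilinear.Hermitian.sort _ _ _]/(dotp (basisv F e) w) dotpC dotp_basis => we.
  apply/forallP => f; apply/implyP => fT; have [->|fe] := eqVneq f e; first by rewrite we.
  by apply: (implyP (wT f)); rewrite in_setU1 negb_or fe.
move=> k kE; exists k; rewrite -kE; apply/esym/oproj_incl; first exact: nondeg_W.
by apply: (subvP (sa_W_mono TT)); apply: subvsP.
Qed.

(** H_T is the orthogonal of the span of T, so this is a double orthogonal. *)
Lemma pH_nu T e : (pH T (nu e) == 0) = (nu e \in sa_span A T).
Proof.
apply/eqP/idP => [/(oproj_eq0 _ (@nondeg_H T)) e0|eT].
  have ndH := @nondeg_H T; rewrite sa_H_orthov in e0 ndH.
  exact: (orth_orth ndH e0).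
apply/(oproj_eq0 _ (@nondeg_H T)) => h; rewrite sa_H_orthov => /mem_orthovP hT.
by rewrite sformC hT.
Qed.

Lemma pH_nu_in T e : e \in T -> pH T (nu e) = 0.
Proof.
move=> eT; apply/eqP; rewrite pH_nu.
by apply: (subvP (sumv_sup e eT (subvv _))); apply: memv_line.
Qed.

Lemma qW_notin T e : e \notin T -> qW T (basisv F e) = 0.
Proof.
move=> eT; apply/qW_eq0 => w; rewrite mem_sa_W => /andP[_ /forallP wT].
by rewrite dotpC dotp_basis; apply/eqP/(implyP (wT e)).
Qed.

(** The functional w |-> w e vanishes on W unless some cycle in e |: T passes
    through e. *)
Lemma qW_basis T e : e \notin T ->
  (qW (e |: T) (basisv F e) == 0) = (nu e \notin sa_span A T).
Proof.
move=> eT; apply/eqP/idP => [/qW_eq0 e0|].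
  apply/negP => /(vspanP nu eT)[w [wr we wT]].
  move: we; rewrite -dotp_basis dotpC e0 ?eqxx // mem_sa_W -relation_nu wr.
  by apply/forallP => f; apply/implyP => fT; apply/eqP; apply: supp_sub wT fT.
move=> ne; apply/qW_eq0 => w; rewrite mem_sa_W => /andP[wr /forallP wT].
rewrite dotpC dotp_basis; apply/eqP; apply: contraNT ne => we.
apply/(vspanP nu eT); exists w; split=> //; first by rewrite relation_nu.
by apply/subsetP => f; rewrite inE; apply: contraR => fT; apply: (implyP (wT f)).
Qed.

Lemma sa_dualE T e :
  vsproj (sa_W A T) (sa_coproj (sa_W A T) (sa_dual A e)) = qW T (basisv F e).
Proof.
apply: oproj_congr; first exact: nondeg_W.
move=> w wT; rewrite /sa_dual /sa_coproj -[orth_proj _ _ _](vsval_oproj (@dotp F 'I_n)).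
have E x : (x \in sa_relations A) = relation edge x.
  by rewrite -relation_nu -mem_relation_space.
apply: oprojP; last by move: wT; rewrite mem_sa_W E => /andP[].
apply: (nondeg_relations charF (T := setT)) => x; rewrite E.
by rewrite (_ : [forall e, _] = true) ?andbT //; apply/forallP => f; rewrite inE.
Qed.

Lemma tait_set_pos S r : r \in positive_edges shaded ->
  tait_set shaded (r |: S) = r |: tait_set shaded S.
Proof.
move=> rp; apply/setP => c; rewrite in_setU1 !in_tait_set in_setU1.
by case: (eqVneq c r) => [->|_] //=; rewrite rp.
Qed.

Lemma tait_set_neg (S : {set 'I_n}) r : r \notin positive_edges shaded -> r \notin S ->
  tait_set shaded S = r |: tait_set shaded (r |: S).
Proof.
move=> rp rS; apply/setP => c; rewrite in_setU1 !in_tait_set in_setU1.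
by case: (eqVneq c r) => [->|_] //=; rewrite (negPf rp) (negPf rS).
Qed.

(** The relations between the nu_e are those of the edge vectors of a graph. *)
Lemma unimodular_nu w : circuit_vec nu w ->
  exists2 k, k != 0 & forall i, i \in supp w -> w i = k \/ w i = - k.
Proof.
case=> wr w0 wm; apply: (@graph_unimodular F _ (tait_vertex shaded)
  (fun c => region_vertex (source_shaded shaded edge_dir c))
  (fun c => region_vertex (target_shaded shaded edge_dir c))).
have relE z : relation (graph_vec F (fun c => region_vertex (source_shaded shaded edge_dir c))
  (fun c => region_vertex (target_shaded shaded edge_dir c))) z = relation nu z.
  rewrite relation_nu /relation; congr (_ == _); apply: eq_bigr => i _.
  by rewrite edge_vecE.
split; rewrite ?relE // => z; rewrite relE; exact: wm.
Qed.

Lemma dim_sa_H_step T e : (\dim (sa_H A T) <= (\dim (sa_H A (e |: T))).+1)%N.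
Proof.
have -> : sa_H A (e |: T) = (sa_H A T :&: orthov form <[nu e]>)%VS.
  apply/vspaceP => v; rewrite memv_cap !mem_sa_H mem_orthov1.
  apply/forall_inP/andP => [vT|[/forall_inP vT ve] s].
    by split; [apply/forall_inP => s sT; apply: vT; rewrite in_setU1 sT orbT | apply: vT; rewrite setU11].
  by rewrite in_setU1 => /predU1P[->|/vT].
by have := leq_dim_orthov1 form (nu e) (sa_H A T); lia.
Qed.

Lemma sa_H_eq T e : nu e \in sa_span A T -> sa_H A (e |: T) = sa_H A T.
Proof.
move=> eT; apply/eqP; rewrite eqEsubv sa_H_anti ?subsetUr //=.
apply/subvP => v; rewrite sa_H_orthov => /mem_orthovP vT.
rewrite mem_sa_H; apply/forall_inP => s; rewrite in_setU1 => /predU1P[->|sT].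
  by rewrite vT.
rewrite vT //; apply: (subvP (sumv_sup s sT (subvv _))); exact: memv_line.
Qed.

Lemma dim_sa_W_step T e : e \notin T -> nu e \in sa_span A T ->
  (\dim (sa_W A T) < \dim (sa_W A (e |: T)))%N.
Proof.
move=> eT /(vspanP nu eT)[w [wr we wT]].
have sub := sa_W_mono (subsetUr [set e] T).
rewrite ltn_neqAle dimvS // andbT; apply: contra we => /eqP dE.
have : (sa_W A T == sa_W A (e |: T))%VS by rewrite eqEdim sub dE leqnn.
move/eqP/vspaceP/(_ w); rewrite !mem_sa_W -relation_nu wr /=.
have -> : [forall f, (f \notin e |: T) ==> (w f == 0)].
  by apply/forallP => f; apply/implyP => fT; apply/eqP; apply: supp_sub wT fT.
by move/forallP/(_ e)/implyP; apply.
Qed.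

End Arrangement.

(** * Circles in terms of the arrangement *)

Lemma basisv_inj (F : fieldType) (J : finType) : injective (@basisv F J).
Proof.
move=> i j /ffunP/(_ i); rewrite !ffunE eqxx; case: eqP => // _ /eqP.
by rewrite oner_eq0.
Qed.

Section CircleVectors.
Variables (D : link_diagram) (F : fieldType).
Local Notation n := (ncross D).
Implicit Types (S : {set 'I_n}) (x : dart n).

Fact circle_root_subproof (shaded : checkerboard D) S x :
  roots (circle_rel S) (fingraph.root (circle_rel S) x).
Proof. exact: (roots_root (circle_rel_sym shaded S)). Qed.

Definition circle_of (shaded : checkerboard D) S x : circle S :=
  inl (exist (fun z => is_true (roots (circle_rel S) z)) _ (circle_root_subproof shaded S x)).

Lemma circle_throughE (shaded : checkerboard D) S x :
  circle_through F S x = basisv F (circle_of shaded S x).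
Proof. by apply/ffunP => -[v|i]; rewrite !ffunE. Qed.

Lemma circle_of_connect (shaded : checkerboard D) S x x' :
  (circle_of shaded S x == circle_of shaded S x') = connect (circle_rel S) x x'.
Proof.
rewrite -(root_connect (circle_rel_sym shaded S)).
by apply/eqP/eqP => [[]|E] //; congr inl; apply: val_inj.
Qed.

Lemma circle_through_connect (shaded : checkerboard D) S x x' :
  (circle_through F S x == circle_through F S x') = connect (circle_rel S) x x'.
Proof.
rewrite -(circle_of_connect shaded) !(circle_throughE shaded).
by apply/eqP/eqP => [/basisv_inj|-> //].
Qed.

End CircleVectors.

Section Theta.
Variables (D : link_diagram) (F : fieldType).
Variable charF : [pchar F] =i pred0.
Variables (shaded : checkerboard D) (edge_dir : 'I_(ncross D) -> bool).
Local Notation n := (ncross D).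
Local Notation edge := (@edge_vec D F shaded edge_dir).
Local Notation source := (edge_source shaded edge_dir).
Local Notation A := (link_arrangement charF shaded edge_dir).
Local Notation V := (sa_space A).
Local Notation nu := (@sa_vec F n A).
Local Notation pH := (@pH D F charF shaded edge_dir).
Local Notation qW := (@qW D F charF shaded edge_dir).
Local Notation ts := (tait_set shaded).
Local Notation tspace := (@tait_space D F shaded).
Local Notation next := (next_sector (@glue D)).
Implicit Types (S T : {set 'I_n}) (e c : 'I_n) (x : dart n).

Variables (g : {linear V -> V}) (lam : 'I_n -> F) (y : dart n -> freev F 'I_n).
Hypothesis g_nu : forall e, g (nu e) = lam e *: nu e.
Hypothesis g_surj : forall v, exists u, v = g u.
Hypothesis lam_neq0 : forall e, lam e != 0.
Hypothesis y_next : forall x, y (next x) = y x.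
Hypothesis y_jump : forall c w, relation edge w ->
  dotp (y (turn 1 (source c)) - y (turn 3 (source c))) w = w c.

(** The exterior algebra of this space is the group T_S of the arrangement. *)
Definition HW T : vectType F := (subvs_of (sa_H A T) * subvs_of (sa_W A T))%type.

(** The automorphism g, which scales each nu_e by lam e, is the freedom that
    absorbs the holonomy of the scalars at the end. *)
Definition tait_proj T (u : freev F (tait_vertex shaded)) : subvs_of (sa_H A T) :=
  pH T (g (vsproj tspace u)).
Fact tait_proj_is_linear T : linear (tait_proj T).
Proof. by move=> a u v; rewrite /tait_proj !linearP. Qed.
HB.instance Definition _ T :=
  GRing.isLinear.Build F (freev F (tait_vertex shaded)) (subvs_of (sa_H A T)) *:%R
    (tait_proj T) (tait_proj_is_linear T).

(** The value of theta on the circle through x: the shaded region next to x,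
    projected to H_T, and the potential of the unshaded one, projected to W_T. *)
Definition zeta T x : HW T :=
  (tait_proj T (region_vec F shaded (shaded_side shaded x)),
   qW T (y (unshaded_side shaded x))).

Definition sgn_unit (s : F) := s = 1 \/ s = -1.

Lemma sgn_unit_neq0 s : sgn_unit s -> s != 0.
Proof. by case=> ->; rewrite ?oppr_eq0 oner_neq0. Qed.

Lemma tait_proj_edge T e : tait_proj T (edge e) = lam e *: pH T (nu e).
Proof. by rewrite /tait_proj -[vsproj _ _]/(nu e) g_nu linearZ. Qed.

(** The signs in the next lemmas are named, rather than quantified, because they
    must not depend on g and lam. *)
Definition edge_sign x : F := if x == source x.1 then 1 else -1.
Definition dual_sign x : F := if x == turn 1 (source x.1) then 1 else -1.

Lemma edge_signP x : sgn_unit (edge_sign x).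
Proof. by rewrite /edge_sign; case: ifP; [left|right]. Qed.

Lemma dual_signP x : sgn_unit (dual_sign x).
Proof. by rewrite /dual_sign; case: ifP; [left|right]. Qed.

Lemma region_jump T x : shaded x ->
  tait_proj T (region_vec F shaded x) - tait_proj T (region_vec F shaded (turn 2 x)) =
    (edge_sign x * lam x.1) *: pH T (nu x.1).
Proof.
move=> xs; have E : tait_proj T (region_vec F shaded (source x.1)) -
    tait_proj T (region_vec F shaded (turn 2 (source x.1))) = lam x.1 *: pH T (nu x.1).
  by rewrite -tait_proj_edge -linearB.
have [//|xE|xE] := opposite_color (source_shaded shaded edge_dir x.1) xs.
  have -> : edge_sign x = 1 by rewrite /edge_sign -xE eqxx.
  by rewrite mul1r -E -!xE.
have -> : edge_sign x = -1.
  by rewrite /edge_sign {1}xE eq_sym (negPf (turn_neq2 _)).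
have tE : turn 2 x = source x.1 by rewrite {1}xE turn22.
by rewrite mulN1r scaleNr -E opprB -xE tE.
Qed.

Lemma dual_jump T x : ~~ shaded x ->
  qW T (y x) - qW T (y (turn 2 x)) = dual_sign x *: qW T (basisv F x.1).
Proof.
move=> xs; have E : qW T (y (turn 1 (source x.1))) - qW T (y (turn 3 (source x.1))) =
    qW T (basisv F x.1).
  rewrite -linearB; apply: qW_congr => w wr.
  by rewrite y_jump // dotpC dotp_basis.
have d1 : ~~ shaded (turn 1 (source x.1)) by rewrite shade_adjacent source_shaded.
have t31 z : turn 2 (turn 1 z) = turn 3 z :> dart n by rewrite turn_turn.
have [//|xE|xE] := opposite_unshaded d1 xs.
  have -> : dual_sign x = 1 by rewrite /dual_sign -xE eqxx.
  by rewrite scale1r -E -t31 -!xE.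
have -> : dual_sign x = -1.
  by rewrite /dual_sign {1}xE eq_sym (negPf (turn_neq2 _)).
have tE : turn 2 x = turn 1 (source x.1) by rewrite {1}xE turn22.
by rewrite scaleN1r -E -t31 opprB -xE tE.
Qed.

(** Crossing an edge changes the shaded region by nu_e and the potential by the
    coordinate of e. *)
Lemma zeta_jumpE T x : zeta T x - zeta T (turn 2 x) =
  ((edge_sign (shaded_side shaded x) * lam x.1) *: pH T (nu x.1),
   dual_sign (unshaded_side shaded x) *: qW T (basisv F x.1)).
Proof.
rewrite /zeta /shaded_side /unshaded_side shade_turn2.
have t2N : turn (-1) (turn 2 x) = turn 2 (turn (-1) x) by rewrite turnN2 turn2N.
case: (boolP (shaded x)) => xs; rewrite t2N; congr (_, _).
- exact: region_jump.
- by apply: dual_jump; rewrite shade_turnN1 xs.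
- by apply: region_jump; rewrite shade_turnN1 xs.
- exact: dual_jump.
Qed.

Lemma zeta_jump T x : exists s1 s2, [/\ sgn_unit s1, sgn_unit s2 &
  zeta T x - zeta T (turn 2 x) =
    ((s1 * lam x.1) *: pH T (nu x.1), s2 *: qW T (basisv F x.1))].
Proof.
exists (edge_sign (shaded_side shaded x)), (dual_sign (unshaded_side shaded x)).
by split; [exact: edge_signP | exact: dual_signP | exact: zeta_jumpE].
Qed.

(** Along a circle the shaded region changes only across edges of T, where pH nu_e
    vanishes, and the unshaded one only across the others, where qW vanishes. *)
Lemma zeta_connect S x x' : connect (circle_rel S) x x' -> zeta (ts S) x = zeta (ts S) x'.
Proof.
move=> xx'; congr (_, _).
  apply: (shaded_side_circle (shaded := shaded) (S := S)
    (h := fun z => tait_proj (ts S) (region_vec F shaded z))) xx' => z.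
    by rewrite region_vec_next.
  move=> zs zT; have E := region_jump (ts S) zs.
  by apply/esym/eqP; rewrite -subr_eq0 E pH_nu_in // scaler0.
apply: (unshaded_side_circle (shaded := shaded) (S := S)
    (h := fun z => qW (ts S) (y z))) xx' => z.
  by rewrite y_next.
move=> zs zT; have E := dual_jump (ts S) zs.
by apply/esym/eqP; rewrite -subr_eq0 E qW_notin // scaler0.
Qed.

Definition circle_val S T (a : circle S) : HW T :=
  match a with
  | inl z => zeta T (val z)
  | inr i => (tait_proj T (basisv F (inr i)), 0)
  end.

(** The linear extension of zeta to the space spanned by the circles of S, with
    values at an arbitrary T; it is used at the set T of S itself ([theta]) and
    at that of a neighbour of S in the cube. *)
Definition theta_at S T (v : freev F (circle S)) : HW T :=
  \sum_a (v a : F) *: circle_val T a.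
Fact theta_at_is_linear S T : linear (@theta_at S T).
Proof.
move=> a u v; rewrite /theta_at scaler_sumr -big_split; apply: eq_bigr => i _.
by rewrite !ffunE scalerDl scalerA.
Qed.
HB.instance Definition _ S T :=
  GRing.isLinear.Build F (freev F (circle S)) (HW T) *:%R
    (@theta_at S T) (@theta_at_is_linear S T).

Definition theta S := @theta_at S (ts S).
HB.instance Definition _ S := GRing.Linear.on (@theta S).

Lemma theta_at_basis S T (a : circle S) : theta_at T (basisv F a) = circle_val T a.
Proof.
rewrite /theta_at (bigD1 a) //= basisvE eqxx scale1r big1 ?addr0 // => b ba.
by rewrite basisvE (negPf ba) scale0r.
Qed.

Lemma theta_circle_through S x : theta (circle_through F S x) = zeta (ts S) x.
Proof.
rewrite /theta (circle_throughE F shaded) theta_at_basis; apply/esym/zeta_connect.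
exact: connect_root.
Qed.

Lemma theta_transfer S S' (v : freev F (circle S)) :
  theta (transfer S' v) = theta_at (ts S') v.
Proof.
rewrite /transfer linear_sum; apply: eq_bigr => a _; rewrite linearZ /=; congr (_ *: _).
case: a => [z|i]; first by rewrite theta_circle_through.
by rewrite /theta theta_at_basis /circle_val.
Qed.

Lemma theta_at_H T T' S (v : freev F (circle S)) : T \subset T' ->
  (theta_at T' v).1 = sub_proj_H T' (theta_at T v).1.
Proof.
move=> TT'; pose p := @sub_proj_H F n A T T'.
have plin : linear p by move=> a u w; rewrite /p /sub_proj_H !linearP.
pose pL := GRing.isLinear.Build F _ _ _ p plin.
pose pl : {linear subvs_of (sa_H A T) -> subvs_of (sa_H A T')} := HB.pack p pL.
have fst_sum (X : {set 'I_n}) : (theta_at X v).1 = \sum_a (v a : F) *: (circle_val X a).1.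
  exact: (big_morph (fun z : HW X => z.1) (fun _ _ => erefl) erefl).
rewrite !fst_sum -[sub_proj_H _ _]/(pl _) linear_sum; apply: eq_bigr => a _.
rewrite linearZ; congr (_ *: _).
by case: a => [z|i]; rewrite /= /tait_proj -[RHS]/(sub_proj_H T' _) sub_projH.
Qed.

Lemma theta_at_W T T' S (v : freev F (circle S)) : T \subset T' ->
  (theta_at T v).2 = sub_proj_W T (theta_at T' v).2.
Proof.
move=> TT'; pose p := @sub_proj_W F n A T' T.
have plin : linear p by move=> a u w; rewrite /p /sub_proj_W !linearP.
pose pL := GRing.isLinear.Build F _ _ _ p plin.
pose pl : {linear subvs_of (sa_W A T') -> subvs_of (sa_W A T)} := HB.pack p pL.
have snd_sum (X : {set 'I_n}) : (theta_at X v).2 = \sum_a (v a : F) *: (circle_val X a).2.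
  exact: (big_morph (fun z : HW X => z.2) (fun _ _ => erefl) erefl).
rewrite !snd_sum -[sub_proj_W _ _]/(pl _) linear_sum; apply: eq_bigr => a _.
rewrite linearZ; congr (_ *: _).
case: a => [z|i]; first by rewrite /= -[RHS]/(sub_proj_W T _) sub_projW.
by rewrite /= -[RHS]/(pl 0) linear0.
Qed.

(** The components of theta at T and at e |: T are related by the maps of the
    arrangement complex, up to multiples of the projections of e. *)
Lemma theta_at_inclW T e S (v : freev F (circle S)) : exists k,
  sub_incl_W (e |: T) (theta_at T v).2 =
  (theta_at (e |: T) v).2 + k *: qW (e |: T) (basisv F e).
Proof.
pose p := @sub_incl_W F n A T (e |: T).
have plin : linear p by move=> a u w; rewrite /p /sub_incl_W !linearP.
pose pL := GRing.isLinear.Build F _ _ _ p plin.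
pose pl : {linear subvs_of (sa_W A T) -> subvs_of (sa_W A (e |: T))} := HB.pack p pL.
have snd_sum (X : {set 'I_n}) : (theta_at X v).2 = \sum_a (v a : F) *: (circle_val X a).2.
  exact: (big_morph (fun z : HW X => z.2) (fun _ _ => erefl) erefl).
suff /vlineP[k kE] : pl (theta_at T v).2 - (theta_at (e |: T) v).2 \in
    <[qW (e |: T) (basisv F e)]>%VS.
  by exists k; rewrite -kE addrC subrK.
rewrite !snd_sum linear_sum -sumrB memv_suml // => a _.
rewrite linearZ -scalerBr memvZ //; case: a => [z|i] /=; last first.
  by rewrite -[X in X - _]/(pl 0) linear0 subrr mem0v.
have [k kE] := @sub_inclW D F charF shaded edge_dir T e (y (unshaded_side shaded (val z))).
by rewrite -[X in X - _]/(sub_incl_W (e |: T) _) kE addrAC subrr add0r memvZ // memv_line.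
Qed.

Lemma theta_at_inclH T e S (v : freev F (circle S)) : exists k,
  sub_incl_H T (theta_at (e |: T) v).1 = (theta_at T v).1 + k *: pH T (nu e).
Proof.
pose p := @sub_incl_H F n A (e |: T) T.
have plin : linear p by move=> a u w; rewrite /p /sub_incl_H !linearP.
pose pL := GRing.isLinear.Build F _ _ _ p plin.
pose pl : {linear subvs_of (sa_H A (e |: T)) -> subvs_of (sa_H A T)} := HB.pack p pL.
have fst_sum (X : {set 'I_n}) : (theta_at X v).1 = \sum_a (v a : F) *: (circle_val X a).1.
  exact: (big_morph (fun z : HW X => z.1) (fun _ _ => erefl) erefl).
suff /vlineP[k kE] : pl (theta_at (e |: T) v).1 - (theta_at T v).1 \in <[pH T (nu e)]>%VS.
  by exists k; rewrite -kE addrC subrK.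
rewrite !fst_sum linear_sum -sumrB memv_suml // => a _.
rewrite linearZ -scalerBr memvZ //.
have key (u : freev F (tait_vertex shaded)) : pl (tait_proj (e |: T) u) - tait_proj T u \in <[pH T (nu e)]>%VS.
  have [k kE] := @sub_inclH D F charF shaded edge_dir T e (g (vsproj tspace u)).
  by rewrite -[X in X - _]/(sub_incl_H T _) kE addrAC subrr add0r memvZ // memv_line.
by case: a => [z|i] /=; apply: key.
Qed.

End Theta.

(** * Reduced chain groups and the number of circles *)

Section ReducedSpace.
Variables (D : link_diagram) (F : fieldType).
Local Notation n := (ncross D).

Implicit Types S : {set 'I_n}.

Definition coord_sum S (v : freev F (circle S)) : F^o := \sum_(a : circle S) v a.
Fact coord_sum_is_linear S : linear (@coord_sum S).
Proof.
move=> a u v; rewrite /coord_sum scaler_sumr -big_split; apply: eq_bigr => i _.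
by rewrite !ffunE.
Qed.
HB.instance Definition _ S :=
  GRing.isLinear.Build F (freev F (circle S)) F^o *:%R (@coord_sum S) (@coord_sum_is_linear S).

Lemma mem_reduced S v : (v \in @reduced D F S) = (coord_sum v == 0).
Proof. by rewrite memv_ker -[linfun _]/(linfun (@coord_sum S)) lfunE. Qed.

Lemma coord_sum_basis S (a : circle S) : coord_sum (basisv F a) = 1.
Proof.
rewrite /coord_sum (bigD1 a) //= ffunE eqxx big1 ?addr0 // => b /negPf ba.
by rewrite ffunE ba.
Qed.

Lemma basis_sub_reduced S (a b : circle S) : basisv F a - basisv F b \in reduced F S.
Proof. by rewrite mem_reduced linearB /= !coord_sum_basis subrr. Qed.

Lemma circle_through_sub_reduced (shaded : checkerboard D) S x x' :
  circle_through F S x - circle_through F S x' \in reduced F S.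
Proof. by rewrite !(circle_throughE F shaded) basis_sub_reduced. Qed.

(** The diagram is non-empty, so the sum of coordinates is onto. *)
Lemma dim_reduced S (a : circle S) : (\dim (reduced F S)).+1 = #|circle S|.
Proof.
rewrite -(dim_freev F) -(limg_ker_dim (linfun (@coord_sum S)) fullv) capfv.
rewrite -addn1; congr (_ + _)%N.
apply/esym/eqP; rewrite eqn_leq; apply/andP; split.
  by rewrite -[X in (_ <= X)%N](dimvf [the vectType F of F^o]) dimvS ?subvf.
rewrite lt0n dimv_eq0; apply/eqP => im0.
have : linfun (@coord_sum S) (basisv F a) \in limg (linfun (@coord_sum S)).
  by rewrite memv_img ?memvf.
by rewrite im0 memv0 lfunE /= coord_sum_basis oner_eq0.
Qed.
End ReducedSpace.

Section ThetaBijective.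
Variables (D : link_diagram) (F : fieldType).
Variable charF : [pchar F] =i pred0.
Variables (shaded : checkerboard D) (edge_dir : 'I_(ncross D) -> bool).
Local Notation n := (ncross D).
Local Notation edge := (@edge_vec D F shaded edge_dir).
Local Notation source := (edge_source shaded edge_dir).
Local Notation A := (link_arrangement charF shaded edge_dir).
Local Notation V := (sa_space A).
Local Notation nu := (@sa_vec F n A).
Local Notation pH := (@pH D F charF shaded edge_dir).
Local Notation qW := (@qW D F charF shaded edge_dir).
Local Notation ts := (tait_set shaded).
Local Notation tspace := (@tait_space D F shaded).
Local Notation next := (next_sector (@glue D)).
Implicit Types (S T : {set 'I_n}) (e c : 'I_n) (x : dart n).

Variables (g : {linear V -> V}) (lam : 'I_n -> F) (y : dart n -> freev F 'I_n).
Hypothesis g_nu : forall e, g (nu e) = lam e *: nu e.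
Hypothesis g_surj : forall v, exists u, v = g u.
Hypothesis lam_neq0 : forall e, lam e != 0.
Hypothesis y_next : forall x, y (next x) = y x.
Hypothesis y_jump : forall c w, relation edge w ->
  dotp (y (turn 1 (source c)) - y (turn 3 (source c))) w = w c.

Local Notation HW := (@HW D F charF shaded edge_dir).
Local Notation projT := (@tait_proj D F charF shaded edge_dir g).
Local Notation zeta := (@zeta D F charF shaded edge_dir g y).
Local Notation Theta := (@theta D F charF shaded edge_dir g y _).

(** Two differences of half-edges at a crossing of T give (0, qW e), and these
    generate W_T; the differences of shaded regions then give H_T modulo W_T. *)
Lemma theta_surj S (p : HW (ts S)) : exists2 v, v \in reduced F S & Theta v = p.
Proof.
set T := ts S in p *.
pose I := (linfun (@theta D F charF shaded edge_dir g y S) @: reduced F S)%VS.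
suff : p \in I.
  by case/memv_imgP => v vr ->; exists v; rewrite ?lfunE.
have Ith v : v \in reduced F S -> Theta v \in I.
  by move=> vr; rewrite -[Theta v](lfunE (@theta D F charF shaded edge_dir g y S)) memv_img.
have Izeta x x' : zeta T x - zeta T x' \in I.
  rewrite -!(theta_circle_through g_nu y_next y_jump) -linearB Ith //.
  exact: (circle_through_sub_reduced F shaded).
have Ie e : (0, qW T (basisv F e)) \in I.
  have [eT|eT] := boolP (e \in T); last by rewrite qW_notin // mem0v.
  have [s1 [s2 [_ s2u E]]] := zeta_jump g_nu y_jump T (source e).
  have := Izeta (source e) (turn 2 (source e)); rewrite E /= pH_nu_in // scaler0.
  move/(memvZ s2^-1); rewrite -[_ *: _]/(s2^-1 *: 0, s2^-1 *: _).
  by rewrite scaler0 scalerA mulVf ?scale1r // sgn_unit_neq0.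
have IW w : (0, w) \in I.
  rewrite -[w]qW_surj [vsval w]freev_sum linear_sum.
  rewrite (_ : (0, _) = \sum_e (vsval w e : F) *: ((0, qW T (basisv F e)) : HW T)).
    by rewrite memv_suml // => e _; rewrite memvZ.
  have snd_sum (f : 'I_n -> HW T) : (\sum_e f e).2 = \sum_e (f e).2.
    exact: (big_morph (fun z : HW T => z.2) (fun _ _ => erefl) erefl).
  have fst_sum (f : 'I_n -> HW T) : (\sum_e f e).1 = \sum_e (f e).1.
    exact: (big_morph (fun z : HW T => z.1) (fun _ _ => erefl) erefl).
  rewrite [RHS]surjective_pairing fst_sum snd_sum; congr (_, _).
    by rewrite big1 // => e _; rewrite /= scaler0.
  by apply: eq_bigr => e _; rewrite linearZ.
have Iv (t t' : tait_vertex shaded) : (projT T (basisv F t) - projT T (basisv F t'), 0) \in I.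
  have cv (u : tait_vertex shaded) : exists2 a : circle S,
      True & (circle_val (charF := charF) (edge_dir := edge_dir) g y T a).1 = projT T (basisv F u).
    case: u => [r|i]; last by exists (inr i).
    have /andP[/eqP rr rs] := valP r.
    exists (circle_of shaded S (val r)) => //.
    have := theta_circle_through g_nu y_next y_jump S (val r).
    rewrite (circle_throughE F shaded) /theta theta_at_basis -/T => -> /=.
    rewrite /shaded_side rs (region_vecE F rs); congr (projT T (basisv F _)).
    by congr inl; apply: val_inj.
  have [a _ aE] := cv t; have [b _ bE] := cv t'.
  have := Ith _ (basis_sub_reduced F a b).
  rewrite linearB /= /theta !theta_at_basis => h.
  rewrite -aE -bE; set p1 := circle_val _ _ _ _ in h *; set p2 := circle_val _ _ _ _ in h *.
  have -> : (p1.1 - p2.1, 0) = p1 - p2 - (0, (p1 - p2).2) :> HW T.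
    by rewrite [p1 - p2]surjective_pairing; congr (_, _); rewrite /= ?subr0 ?subrr.
  by rewrite memvB.
have IH h : (h, 0) \in I.
  have [u uE] := g_surj (vsval h).
  have hE : h = projT T (vsval u).
    by rewrite /tait_proj vsvalK -uE pH_surj.
  have su : \sum_t vsval u t = 0 by apply/eqP; rewrite -mem_tait_space subvsP.
  have hS : h = \sum_t (vsval u t : F) *: projT T (basisv F t).
    rewrite hE {1}[vsval u]freev_sum linear_sum.
    by apply: eq_bigr => t _; rewrite linearZ.
  have [t0 _|no] := pickP (mem (tait_vertex shaded)); last first.
    rewrite hS big1 ?mem0v // => t _.
    by have := no t; rewrite inE.
  have -> : (h, 0) = \sum_t (vsval u t : F) *:
      ((projT T (basisv F t) - projT T (basisv F t0), 0) : HW T).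
    have snd_sum (f : tait_vertex shaded -> HW T) : (\sum_e f e).2 = \sum_e (f e).2.
      exact: (big_morph (fun z : HW T => z.2) (fun _ _ => erefl) erefl).
    have fst_sum (f : tait_vertex shaded -> HW T) : (\sum_e f e).1 = \sum_e (f e).1.
      exact: (big_morph (fun z : HW T => z.1) (fun _ _ => erefl) erefl).
    rewrite [RHS]surjective_pairing fst_sum snd_sum; congr (_, _); last first.
      by rewrite big1 // => t _; rewrite /= scaler0.
    under eq_bigr do rewrite /= scalerBr.
    by rewrite sumrB -hS -scaler_suml su scale0r subr0.
  by rewrite memv_suml // => t _; rewrite memvZ.
have -> : p = (p.1, 0) + (0, p.2).
  by case: p => h w; congr (_, _); rewrite /= ?addr0 ?add0r.
by rewrite memvD.
Qed.

Lemma circle_nonempty S : exists a : circle S, True.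
Proof.
have := ld_nonempty D; case: (posnP (nfree D)) => [->|nf _]; last by exists (inr (Ordinal nf)).
rewrite addn0 => nc.
by exists (circle_of shaded S (Ordinal nc, 0)).
Qed.

Lemma dim_HW T : \dim {:HW T} = (\dim (sa_H A T) + \dim (sa_W A T))%N.
Proof. by rewrite dimvf. Qed.

(** On the full space of circles theta is not injective; its restriction to the
    differences of circles is. *)
Definition theta_red S (v : subvs_of (reduced F S)) : HW (ts S) := Theta (vsval v).
Fact theta_red_is_linear S : linear (@theta_red S).
Proof. by move=> a u v; rewrite /theta_red !linearP. Qed.
HB.instance Definition _ S :=
  GRing.isLinear.Build F (subvs_of (reduced F S)) (HW (ts S)) *:%R
    (@theta_red S) (@theta_red_is_linear S).

Lemma theta_red_surj S p : exists v, p = @theta_red S v.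
Proof.
have [v vr <-] := theta_surj p; exists (vsproj (reduced F S) v).
by rewrite /theta_red vsprojK.
Qed.

Lemma card_circle_ge S :
  (\dim (sa_H A (ts S)) + \dim (sa_W A (ts S)) < #|circle S|)%N.
Proof.
have [a _] := circle_nonempty S; rewrite -(dim_reduced F a) ltnS -dim_HW.
have -> : fullv = limg (linfun (@theta_red S)).
  apply/esym/vspaceP => p; rewrite memvf; have [v ->] := theta_red_surj p.
  by rewrite -[theta_red v](lfunE (@theta_red S)) memv_img ?memvf.
have E : \dim {: subvs_of (reduced F S)} = \dim (reduced F S) by rewrite dimvf.
by rewrite -E -[X in (_ <= X)%N](limg_ker_dim (linfun (@theta_red S)) fullv) leq_addl.
Qed.

(** Without edges the circles are the boundaries of the shaded regions. *)
Lemma card_circle_empty : (#|circle (ts set0)| <= #|tait_vertex shaded|)%N.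
Proof.
set S := ts set0.
have T0 : ts S = set0 by apply: tait_setK.
have nextc x : shaded x -> connect (circle_rel S) x (next x).
  move=> xs; rewrite /next_sector.
  have gs : ~~ shaded (glue x) by rewrite shade_glue xs.
  have := smooth_unshaded S gs; rewrite T0 inE => <-.
  exact: connect_trans (connect_glue S x) (connect_smooth S _).
have fnext x x' : shaded x -> fconnect next x x' -> connect (circle_rel S) x x'.
  move=> xs /connectP[p pp ->]; elim: p x xs pp => //= z p IH x xs /andP[/eqP xz pp].
  have zs : shaded z by rewrite -xz shade_region.
  by apply: connect_trans (IH z zs pp); rewrite -xz nextc.
have side x : connect (circle_rel S) x (shaded_side shaded x).
  rewrite /shaded_side; case: ifP => // /negbT xs.
  by have := smooth_unshaded S xs; rewrite T0 inE => <-; apply: connect_smooth.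
pose f (v : {x : dart n | roots (circle_rel S) x}) : {x : dart n | froots next x && shaded x} :=
  exist (fun x => is_true (froots next x && shaded x)) _ (tait_vertex_subproof (shaded_sideP shaded (val v))).
have finj : injective f.
  move=> u v [] uv; apply: val_inj; rewrite /=.
  have /eqP <- := valP u; have /eqP <- := valP v.
  apply/eqP; rewrite (root_connect (circle_rel_sym shaded S)).
  have cs := circle_rel_sym shaded S.
  apply: connect_trans (side _) _; rewrite cs; apply: connect_trans (side _) _.
  apply: fnext; first exact: shaded_sideP.
  by rewrite -(root_connect (fconnect_sym (@next_inj D))) uv.
rewrite card_sum [X in (_ <= X)%N]card_sum leq_add2r.
exact: leq_card finj.
Qed.

(** Two half-edges on one circle have the same zeta, so the jump vanishes. *)
Lemma connect_jump S c : connect (circle_rel S) ((c, 0) : dart n) (c, 2) ->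
  pH (ts S) (nu c) = 0 /\ qW (ts S) (basisv F c) = 0.
Proof.
move=> conn; have [s1 [s2 [s1u s2u E]]] := zeta_jump g_nu y_jump (ts S) (c, 0).
have : zeta (ts S) (c, 0) - zeta (ts S) (turn 2 (c, 0)) = 0.
  by rewrite turn_at (zeta_connect g_nu y_next y_jump conn) subrr.
rewrite E => E0; split; apply/eqP.
  have /eqP := congr1 (fun p : HW (ts S) => p.1) E0.
  by rewrite /= scaler_eq0 mulf_eq0 (negPf (sgn_unit_neq0 s1u)) (negPf (lam_neq0 _)).
have /eqP := congr1 (fun p : HW (ts S) => p.2) E0.
by rewrite /= scaler_eq0 (negPf (sgn_unit_neq0 s2u)).
Qed.

(** At least this many circles, as theta is onto. For the converse, add the edges
    one at a time: [card_circle_step] bounds the growth of the number of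
    circles, and the right-hand side grows as fast. *)
Lemma card_circle_HW T :
  #|circle (ts T)| = (\dim (sa_H A T) + \dim (sa_W A T)).+1.
Proof.
have ge X : (\dim (sa_H A X) + \dim (sa_W A X) < #|circle (ts X)|)%N.
  by have := card_circle_ge (ts X); rewrite tait_setK.
have [k kE] := ubnP #|T|; elim: k => // k IH in T kE *.
have [->|[e eT]] := set_0Vmem T.
  apply/eqP; rewrite eqn_leq ge andbT; apply: leq_trans card_circle_empty _.
  have -> : sa_H A set0 = fullv.
    apply/vspaceP => v; rewrite memvf mem_sa_H; apply/forall_inP => s.
    by rewrite inE.
  have -> : \dim {:V} = \dim tspace by rewrite dimvf.
  rewrite addnC -ltnS -addnS; apply: leq_trans (leq_addl _ _).
  have := dim_orthov_ge (@dotp F (tait_vertex shaded)) <[[ffun=> 1] : freev F (tait_vertex shaded)]>%VS.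
  rewrite dim_freev => h; apply: leq_trans h _.
  by rewrite -add1n leq_add2r dim_vline; case: (_ != 0).
have TE : T = e |: (T :\ e) by rewrite setD1K.
have eT' : e \notin T :\ e by rewrite !inE eqxx.
move: (T :\ e) TE eT' => T' TE eT'; rewrite {}TE in kE *.
have {}IH : #|circle (ts T')| = (\dim (sa_H A T') + \dim (sa_W A T')).+1.
  by apply: IH; move: kE; rewrite cardsU1 eT' add1n ltnS.
have step := @card_circle_step D shaded (ts T') (ts (e |: T')) e.
rewrite !tait_setK in step; have {}step := step erefl eT'.
have geT := ge (e |: T').
have arith1 (a b c d h w h' w' : nat) : (c + d.*2 = a + 1 -> a = (h + w).+1 ->
   d = 1 -> h <= h'.+1 -> w <= w' -> h' + w' < c -> c = (h' + w').+1)%N by lia.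
have arith2 (a b c d h w h' w' : nat) : (c + d.*2 = a + 1 -> a = (h + w).+1 ->
   h = h' -> w < w' -> h' + w' < c -> c = (h' + w').+1)%N by lia.
have [es|es] := boolP (nu e \in sa_span A T').
  apply: (arith2 _ 0 _ _ _ _ _ _ step IH _ _ geT).
    by rewrite sa_H_eq.
  exact: dim_sa_W_step.
apply: (arith1 _ 0 _ _ _ _ _ _ step IH _ _ _ geT).
- case: (boolP (connect _ _ _)) => // conn; exfalso.
  have [+ _] := connect_jump conn; rewrite tait_setK => /eqP.
  by rewrite pH_nu (negPf es).
- exact: dim_sa_H_step.
- by apply: dimvS; apply: sa_W_mono; apply: subsetUr.
Qed.

Lemma theta_red_bij S : bijective (@theta_red S).
Proof.
apply: surj_dim_bij; first by move=> p; apply: theta_red_surj.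
have [a _] := circle_nonempty S.
rewrite dim_HW dimvf -ltnS (dim_reduced F a) -[S in #|circle S|](tait_setK shaded).
by rewrite card_circle_HW.
Qed.

(** The circle splits at c iff (c, 0) and (c, 2) are on one circle, iff the jump of
    zeta at c vanishes, as theta is injective on differences of circles. *)
Lemma splitsE S c : c \notin S -> splits c S =
  if c \in positive_edges shaded then nu c \in sa_span A (ts S)
  else nu c \notin sa_span A (ts S :\ c).
Proof.
move=> cS; rewrite /splits (root_connect (circle_rel_sym shaded S)).
have cT : (c \in ts S) = (c \notin positive_edges shaded).
  by rewrite in_tait_set (negPf cS); case: (c \in _).
have zero : connect (circle_rel S) ((c, 0) : dart n) (c, 2) =
    (pH (ts S) (nu c) == 0) && (qW (ts S) (basisv F c) == 0).
  apply/idP/andP => [/connect_jump[-> ->] //|[/eqP p0 /eqP q0]].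
  rewrite -(circle_through_connect F shaded) -subr_eq0.
  have vr := circle_through_sub_reduced F shaded S (c, 0) (c, 2).
  rewrite -(vsprojK vr); have inj := bij_inj (theta_red_bij S).
  suff -> : vsproj (reduced F S) (circle_through F S (c, 0) - circle_through F S (c, 2)) = 0 by [].
  apply: inj; rewrite linear0 /theta_red vsprojK // linearB /=.
  rewrite !(theta_circle_through g_nu y_next y_jump) -[(c, 2)]turn_at.
  have [s1 [s2 [_ _ ->]]] := zeta_jump g_nu y_jump (ts S) (c, 0).
  by rewrite /= p0 q0 !scaler0.
rewrite zero; case: ifP => cp.
  by rewrite pH_nu qW_notin ?eqxx ?andbT // cT cp.
have cT' : c \in ts S by rewrite cT cp.
rewrite pH_nu_in // eqxx /=.
have cn : c \notin ts S :\ c by rewrite !inE eqxx.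
by rewrite -(qW_basis charF shaded edge_dir cn) setD1K.
Qed.

End ThetaBijective.

(** * Circles along an edge of the cube *)

Lemma linear_comb_is_linear (F : fieldType) (J : finType) (M : lmodType F) (f : J -> M) :
  linear (fun v : freev F J => \sum_j (v j : F) *: f j).
Proof.
move=> k u v; rewrite scaler_sumr -big_split; apply: eq_bigr => a _.
by rewrite !ffunE scalerDl scalerA.
Qed.

Section Transfer.
Variables (D : link_diagram) (F : fieldType).
Local Notation n := (ncross D).
Implicit Types S : {set 'I_n}.

Definition circle_image S S' (a : circle S) : freev F (circle S') :=
  match a with
  | inl z => circle_through F S' (val z)
  | inr i => basisv F (inr i : circle S')
  end.

(** The indirection through [circle_image] keeps the types of the circles at S and
    at S' apart, which would otherwise be unfolded and compared. *)
Lemma transferE S S' v :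
  @transfer D F S S' v = \sum_(a : circle S) (v a : F) *: circle_image S' a.
Proof. by []. Qed.

Fact transfer_is_linear S S' : linear (@transfer D F S S').
Proof. exact: (linear_comb_is_linear (@circle_image S S')). Qed.
HB.instance Definition _ S S' :=
  GRing.isLinear.Build F (freev F (circle S)) (freev F (circle S')) *:%R
    (@transfer D F S S') (@transfer_is_linear S S').

Lemma transfer_basis S S' (a : circle S) : transfer S' (basisv F a) = circle_image S' a.
Proof.
rewrite transferE (bigD1 a) //= basisvE eqxx scale1r big1 ?addr0 // => b ba.
by rewrite basisvE (negPf ba) scale0r.
Qed.

Lemma transfer_circle (shaded : checkerboard D) S S' x :
  transfer S' (circle_through F S x) = circle_through F S' (fingraph.root (circle_rel S) x).
Proof. by rewrite (circle_throughE F shaded) transfer_basis. Qed.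

Lemma coord_sum_transfer (shaded : checkerboard D) S S' v : coord_sum (@transfer D F S S' v) = coord_sum v.
Proof.
pose h1 : {linear _ -> _} := @coord_sum D F S' \o @transfer D F S S'.
rewrite -[LHS]/(h1 v); move: v; apply: linear_freev_eq => a.
rewrite -[LHS]/(coord_sum (transfer S' (basisv F a))) -[RHS]/(coord_sum (basisv F a)).
rewrite transfer_basis coord_sum_basis.
by case: a => [z|i]; rewrite /= ?(circle_throughE F shaded) coord_sum_basis.
Qed.

Lemma transfer_reduced (shaded : checkerboard D) S S' v :
  v \in reduced F S -> transfer S' v \in reduced F S'.
Proof.
move=> vr; rewrite (@mem_reduced D F S' (transfer S' v)) (coord_sum_transfer shaded).
by rewrite (@mem_reduced D F S v) in vr.
Qed.

Lemma vsval_reduced_transfer (shaded : checkerboard D) S S' (v : subvs_of (reduced F S)) :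
  vsval (reduced_transfer S' v) = transfer S' (vsval v).
Proof. exact: (vsprojK (@transfer_reduced shaded S S' (vsval v) (subvsP v))). Qed.

Fact reduced_transfer_is_linear S S' : linear (@reduced_transfer D F S S').
Proof. by move=> a u v; rewrite /reduced_transfer !linearP. Qed.
HB.instance Definition _ S S' :=
  GRing.isLinear.Build F (subvs_of (reduced F S)) (subvs_of (reduced F S')) *:%R
    (@reduced_transfer D F S S') (@reduced_transfer_is_linear S S').

(** A difference of two circles. *)
Lemma split_vec_reduced (shaded : checkerboard D) arrows c S :
  split_vec F arrows c S \in reduced F S.
Proof. exact: (circle_through_sub_reduced F shaded). Qed.

End Transfer.

Section Steps.
Variables (D : link_diagram) (F : fieldType).
Variable charF : [pchar F] =i pred0.
Variables (shaded : checkerboard D) (edge_dir : 'I_(ncross D) -> bool).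
Variable arrows : 'I_(ncross D) -> bool.
Local Notation n := (ncross D).
Local Notation edge := (@edge_vec D F shaded edge_dir).
Local Notation source := (edge_source shaded edge_dir).
Local Notation A := (link_arrangement charF shaded edge_dir).
Local Notation V := (sa_space A).
Local Notation nu := (@sa_vec F n A).
Local Notation pH := (@pH D F charF shaded edge_dir).
Local Notation qW := (@qW D F charF shaded edge_dir).
Local Notation ts := (tait_set shaded).
Local Notation next := (next_sector (@glue D)).
Local Notation pos := (positive_edges shaded).
Implicit Types (S T : {set 'I_n}) (e c : 'I_n) (x : dart n).

Variables (g : {linear V -> V}) (lam : 'I_n -> F) (y : dart n -> freev F 'I_n).
Hypothesis g_nu : forall e, g (nu e) = lam e *: nu e.
Hypothesis g_surj : forall v, exists u, v = g u.
Hypothesis lam_neq0 : forall e, lam e != 0.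
Hypothesis y_next : forall x, y (next x) = y x.
Hypothesis y_jump : forall c w, relation edge w ->
  dotp (y (turn 1 (source c)) - y (turn 3 (source c))) w = w c.

Local Notation HW := (@HW D F charF shaded edge_dir).
Local Notation zetaT := (@zeta D F charF shaded edge_dir g y).
Local Notation tred S := (@theta_red D F charF shaded edge_dir g y S).
Local Notation tail := (Defs.tail arrows).

Definition edge_sign_at c : F :=
  edge_sign F shaded edge_dir (shaded_side shaded (turn 1 (tail c))).
Definition dual_sign_at c : F :=
  dual_sign F shaded edge_dir (unshaded_side shaded (turn 1 (tail c))).

Lemma edge_sign_atP c : sgn_unit (edge_sign_at c).
Proof. exact: edge_signP. Qed.
Lemma dual_sign_atP c : sgn_unit (dual_sign_at c).
Proof. exact: dual_signP. Qed.

Lemma theta_sub S x x' :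
  tred S (vsproj (reduced F S) (circle_through F S x - circle_through F S x')) =
  zetaT (ts S) x - zetaT (ts S) x'.
Proof.
rewrite /theta_red vsprojK ?(circle_through_sub_reduced F shaded) //.
by rewrite linearB /= !(theta_circle_through g_nu y_next y_jump).
Qed.

(** The vector of a splitting at c goes to the jump at c, which is the vector that
    the arrangement complex multiplies by: pH nu_c or qW e_c, as one of the two
    components vanishes. *)
Lemma theta_split_vec S c : tred S (vsproj (reduced F S) (split_vec F arrows c S)) =
  ((edge_sign_at c * lam c) *: pH (ts S) (nu c), dual_sign_at c *: qW (ts S) (basisv F c)).
Proof.
rewrite theta_sub; have -> : turn 3 (tail c) = turn 2 (turn 1 (tail c)).
  by rewrite turn_turn.
exact: (zeta_jumpE g_nu y_jump).
Qed.

(** If c merges two circles, both ends of the arrow are on the new circle. *)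
Lemma split_vec_eq0_theta S c : c \notin S ->
  (split_vec F arrows c (c |: S) == 0) = ~~ splits c S.
Proof.
move=> cS; set S' := c |: S.
have -> : (split_vec F arrows c S' == 0) =
    (tred S' (vsproj (reduced F S') (split_vec F arrows c S')) == 0).
  rewrite -(linear0 (tred S')) (inj_eq (bij_inj (theta_red_bij g_nu g_surj lam_neq0 y_next y_jump S'))).
  by rewrite -{1}(vsprojK (split_vec_reduced F shaded arrows c S')) -(inj_eq (@subvs_inj _ _ _)).
rewrite theta_split_vec -[0 in LHS]/((0, 0) : HW _) xpair_eqE !scaler_eq0 mulf_eq0.
rewrite (negPf (sgn_unit_neq0 (edge_sign_atP c))) (negPf (sgn_unit_neq0 (dual_sign_atP c))).
rewrite (negPf (lam_neq0 c)) /= (splitsE g_nu g_surj lam_neq0 y_next y_jump cS).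
case: ifP => cp.
  rewrite tait_set_pos // pH_nu_in ?setU11 // eqxx qW_basis //.
  by rewrite in_tait_set cp (negPf cS).
have cT : c \notin ts S' by rewrite in_tait_set cp setU11.
rewrite (@qW_notin D F charF shaded edge_dir _ _ cT) eqxx andbT pH_nu negbK.
by rewrite (tait_set_neg (negbT cp) cS) setU1K.
Qed.

(** Under a merger the circles are identified, and under a splitting they are
    identified modulo the difference of the two parts. *)
Lemma connect_step_theta S c x x' : c \notin S -> connect (circle_rel S) x x' ->
  exists k, circle_through F (c |: S) x - circle_through F (c |: S) x' =
    k *: split_vec F arrows c (c |: S).
Proof.
move=> cS xx'; set S' := c |: S.
have z := zeta_connect g_nu y_next y_jump xx'.
have vr := circle_through_sub_reduced F shaded S' x x'.
suff [k kE] : exists k, zetaT (ts S') x - zetaT (ts S') x' =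
    k *: tred S' (vsproj (reduced F S') (split_vec F arrows c S')).
  exists k; rewrite -(vsprojK vr) -(vsprojK (split_vec_reduced F shaded arrows c S')).
  rewrite -linearZ; congr vsval; apply: (bij_inj (theta_red_bij g_nu g_surj lam_neq0 y_next y_jump S')).
  by rewrite theta_sub kE linearZ.
rewrite theta_split_vec; have eqs := congr1 (fun p : HW (ts S) => p.1) z.
have eqt := congr1 (fun p : HW (ts S) => p.2) z.
rewrite /zeta /= in eqs eqt *; rewrite /tait_proj in eqs *.
set h := g _ in eqs *; set h' := g _ in eqs *.
set u := y _ in eqt *; set u' := y _ in eqt *.
case: (boolP (c \in pos)) => cp.
  have T'E := tait_set_pos S cp.
  have TT : ts S \subset ts S' by rewrite T'E subsetUr.
  have cT' : c \in ts S' by rewrite T'E setU11.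
  have e1 : pH (ts S') h = pH (ts S') h' by rewrite -(sub_projH h TT) -(sub_projH h' TT) eqs.
  have [k kE] := @sub_inclW D F charF shaded edge_dir (ts S) c u.
  have [k' kE'] := @sub_inclW D F charF shaded edge_dir (ts S) c u'.
  rewrite -T'E in kE kE'.
  have e2 : qW (ts S') u - qW (ts S') u' = (k' - k) *: qW (ts S') (basisv F c).
    have : qW (ts S') u = qW (ts S') u' + k' *: qW (ts S') (basisv F c) - k *: qW (ts S') (basisv F c).
      by rewrite -kE' -eqt kE addrK.
    by move=> ->; rewrite scalerBl addrC addrA addKr.
  exists ((k' - k) / dual_sign_at c).
  rewrite -[LHS]/((pH (ts S') h - pH (ts S') h', qW (ts S') u - qW (ts S') u') : HW (ts S')).
  rewrite e1 e2 subrr; congr (_, _).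
    by rewrite pH_nu_in // !scaler0.
  by rewrite scalerA divfK // sgn_unit_neq0 //; apply: dual_sign_atP.
have TE := tait_set_neg cp cS.
have TT : ts S' \subset ts S by rewrite TE subsetUr.
have cT' : c \notin ts S' by rewrite in_tait_set (negPf cp) setU11.
have e2 : qW (ts S') u = qW (ts S') u' by rewrite -(@sub_projW D F charF shaded edge_dir _ _ u TT) -(@sub_projW D F charF shaded edge_dir _ _ u' TT) eqt.
have [k kE] := @sub_inclH D F charF shaded edge_dir (ts S') c h.
have [k' kE'] := @sub_inclH D F charF shaded edge_dir (ts S') c h'.
rewrite -TE in kE kE'.
have e1 : pH (ts S') h - pH (ts S') h' = (k' - k) *: pH (ts S') (nu c).
  have : pH (ts S') h = pH (ts S') h' + k' *: pH (ts S') (nu c) - k *: pH (ts S') (nu c).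
    by rewrite -kE' -eqs kE addrK.
  by move=> ->; rewrite scalerBl addrC addrA addKr.
exists ((k' - k) / (edge_sign_at c * lam c)).
rewrite -[LHS]/((pH (ts S') h - pH (ts S') h', qW (ts S') u - qW (ts S') u') : HW (ts S')).
rewrite e1 e2 subrr; congr (_, _).
  by rewrite scalerA divfK // mulf_neq0 // sgn_unit_neq0 //; apply: edge_sign_atP.
by rewrite qW_notin // !scaler0.
Qed.

End Steps.

(** * Faces of the odd Khovanov cube *)

Section WedgeNonzero.
Variables (F : fieldType) (V : vectType F).
Implicit Types v w : V.

Lemma wedge_one1 v k : wedge v (ext_one V) [set k] = coord (vbasis {:V}) k v.
Proof.
rewrite ffunE big_set1 (_ : [set j in _ | _] = set0) ?cards0; last first.
  by apply/setP => j; rewrite !inE; case: eqP => // ->; rewrite ltnn.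
by rewrite mul1r setDv basisvE eqxx mulr1.
Qed.

Lemma wedge_one_neq0 v : v != 0 -> wedge v (ext_one V) != 0.
Proof.
apply: contra_neq => v0; rewrite (coord_vbasis (memvf v)) big1 // => k _.
by rewrite -wedge_one1 v0 ffunE scale0r.
Qed.

(** The coefficients of a product of two vectors are 2 x 2 minors. *)
Lemma wedge2_one v w (i j : 'I_(\dim {:V})) : (i < j)%N ->
  wedge v (wedge w (ext_one V)) [set i; j] =
    coord (vbasis {:V}) i v * coord (vbasis {:V}) j w
    - coord (vbasis {:V}) j v * coord (vbasis {:V}) i w.
Proof.
move=> ij; have ne : i != j by rewrite neq_ltn ij.
have c0 : [set k in [set i; j] | (k < i)%N] = set0.
  apply/setP => k; rewrite !inE; case: eqP => [->|_]; first by rewrite ltnn.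
  by case: eqP => // ->; rewrite ltnNge ltnW.
have c1 : [set k in [set i; j] | (k < j)%N] = [set i].
  apply/setP => k; rewrite !inE; case: eqP => [->|_]; first by rewrite ij.
  by case: eqP => // ->; rewrite ltnn.
have d0 : [set i; j] :\ i = [set j].
  by apply/setP => k; rewrite !inE; case: eqP => // ->; rewrite (negPf ne).
have d1 : [set i; j] :\ j = [set i].
  by apply/setP => k; rewrite !inE orbC; case: eqP => // ->; rewrite eq_sym (negPf ne).
rewrite [LHS]ffunE big_setU1 ?inE //= big_set1 c0 c1 d0 d1 !wedge_one1 cards0 cards1.
by rewrite mul1r expr1 !mulNr mul1r.
Qed.

Lemma wedge2_one_neq0 v w : w != 0 -> (forall k, v <> k *: w) ->
  wedge v (wedge w (ext_one V)) != 0.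
Proof.
move=> w0 vw; apply/eqP => E.
pose x k := coord (vbasis {:V}) k.
have det i j : x i v * x j w = x j v * x i w.
  have half (i' j' : 'I_(\dim {:V})) : (i' < j')%N -> x i' v * x j' w = x j' v * x i' w.
    move=> /(wedge2_one v w); rewrite E ffunE => /esym/eqP.
    by rewrite subr_eq0 => /eqP.
  by case: (ltngtP i j) => [/half|/half/esym|/val_inj ->].
have [j jw|z] := pickP (fun j => x j w != 0); last first.
  case/eqP: w0; rewrite (coord_vbasis (memvf w)) big1 // => k _.
  by have /negbFE/eqP := z k; rewrite /x => ->; rewrite scale0r.
apply: (vw (x j v / x j w)).
rewrite [LHS](coord_vbasis (memvf v)) [X in _ *: X](coord_vbasis (memvf w)) scaler_sumr.
apply: eq_bigr => i _; rewrite scalerA; congr (_ *: _).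
have dE := det i j; apply: (mulIf jw).
by transitivity (x j v * x i w); [exact: dE | rewrite [RHS]mulrAC divfK].
Qed.

End WedgeNonzero.

Definition wedge_if (F : fieldType) (V : vectType F) (b : bool) (v : V) (z : ext F V) : ext F V :=
  if b then wedge v z else z.

(** The odd composition along two edges, in the abstract: g v1 may be replaced by v
    and g o f by h, modulo the vector v' that is multiplied last. *)
Lemma wedge_if2 (F : fieldType) (charF : [pchar F] =i pred0) (U V W : vectType F)
    (f : {linear U -> V}) (g : {linear V -> W}) (h : U -> W) (b b' : bool)
    (v1 : V) (v v' : W) (z : ext F U) :
  (~~ b' -> v' = 0) -> (forall u, exists k, g (f u) = h u + k *: v') ->
  (exists k, g v1 = v + k *: v') ->
  wedge_if b' v' (ext_map g (wedge_if b v1 (ext_map f z))) =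
    wedge_if b' v' (wedge_if b v (ext_map h z)).
Proof.
move=> v'0 comp [k kE].
have step : wedge_if b' v' (ext_map g (ext_map f z)) = wedge_if b' v' (ext_map h z).
  rewrite (ext_map_comp charF) /wedge_if; case: ifP => sd.
    exact: wedge_extmul_congr.
  apply: eq_ext_map => u /=; have [l ->] := comp u.
  by rewrite v'0 ?sd // scaler0 addr0.
case: b => //; rewrite [wedge_if true v1 _]/(wedge v1 _) [wedge_if true v _]/(wedge v _).
rewrite (ext_map_wedge charF) kE; move: step; rewrite /wedge_if; case: ifP => sd E; last first.
  by rewrite v'0 ?sd // scaler0 addr0 E.
by rewrite wedgeDl linearD /= wedgeZl linearZ /= (wedgevv charF) scaler0 addr0 wedgeC E -wedgeC.
Qed.

Section Faces.
Variables (D : link_diagram) (F : fieldType).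
Variable charF : [pchar F] =i pred0.
Variables (shaded : checkerboard D) (arrows : 'I_(ncross D) -> bool).
Local Notation n := (ncross D).
Local Notation pos := (positive_edges shaded).
Implicit Types (S T : {set 'I_n}) (c d : 'I_n) (x : dart n).
Local Notation split_vec := (split_vec F arrows).
Local Notation odd_map c S S' := (@odd_map D F arrows c S S').

Lemma split_vec_eq0 S S' c : c \notin S -> S' = c |: S ->
  (split_vec c S' == 0) = ~~ splits c S.
Proof.
move=> cS ->; have [y [y_next y_jump]] := dual_potential charF shaded xpredT.
apply: (@split_vec_eq0_theta D F charF shaded xpredT arrows idfun (fun=> 1) y) => //.
- by move=> e; rewrite scale1r.
- by move=> v; exists v.
- by move=> e; apply: oner_neq0.
Qed.

Lemma connect_step S S' c x x' : c \notin S -> S' = c |: S ->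
  connect (circle_rel S) x x' ->
  exists k, circle_through F S' x - circle_through F S' x' = k *: split_vec c S'.
Proof.
move=> cS ->; have [y [y_next y_jump]] := dual_potential charF shaded xpredT.
apply: (@connect_step_theta D F charF shaded xpredT arrows idfun (fun=> 1) y) => //.
- by move=> e; rewrite scale1r.
- by move=> v; exists v.
- by move=> e; apply: oner_neq0.
Qed.

Lemma transfer_split_vec S S' c d : d \notin S -> S' = d |: S ->
  exists k, transfer S' (split_vec c S) = split_vec c S' + k *: split_vec d S'.
Proof.
move=> dS S'E; rewrite /Defs.split_vec linearB /= !(transfer_circle F shaded).
have step x : exists k, circle_through F S' (fingraph.root (circle_rel S) x) =
    circle_through F S' x + k *: split_vec d S'.
  have [k kE] := connect_step dS S'E (connect_root (circle_rel S) x).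
  exists (- k); rewrite scaleNr -kE opprB addrC subrK //.
have [k ->] := step (turn 1 (tail arrows c)).
have [l ->] := step (turn 3 (tail arrows c)).
by exists (k - l); rewrite opprD addrACA -scalerBl.
Qed.

(** Transferring circles in two steps or at once differs only in the choice of a
    part of a split circle. *)
Lemma transfer_comp S S1 S2 d (u : freev F (circle S)) : d \notin S1 -> S2 = d |: S1 ->
  exists k, transfer S2 (transfer S1 u) = transfer S2 u + k *: split_vec d S2.
Proof.
move=> dS S2E.
suff /vlineP[k kE] : transfer S2 (transfer S1 u) - transfer S2 u \in <[split_vec d S2]>%VS.
  by exists k; rewrite -kE addrC subrK.
have E1 : transfer S2 (transfer S1 u) =
    \sum_a (u a : F) *: transfer S2 (circle_image F S1 a).
  rewrite (transferE S1 u) (linear_sum (@transfer D F S1 S2)); apply: eq_bigr => a _.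
  exact: (linearZ_LR (@transfer D F S1 S2)).
rewrite E1 (transferE S2 u) -(sumrB (index_enum (circle S)) predT).
under eq_bigr => a _ do rewrite -scalerBr.
apply: memv_suml => a _; apply: memvZ; case: a => [z|i] /=; last first.
  by rewrite transfer_basis subrr mem0v.
rewrite (transfer_circle F shaded).
have [k kE] := connect_step dS S2E (connect_root (circle_rel S1) (val z)).
by rewrite -memvN opprB kE; apply: memvZ; apply: memv_line.
Qed.

(** Both edges contribute their own vector, taken at the far corner, to a transfer
    that does not depend on the path: the two compositions along a face can
    now be compared case by case. *)
Lemma odd_map2E S S1 T c d (z : ext F (freev F (circle S))) :
  c \notin S -> S1 = c |: S -> d \notin S1 -> T = d |: S1 ->
  odd_map d S1 T (odd_map c S S1 z) =
    wedge_if (splits d S1) (split_vec d T)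
      (wedge_if (splits c S) (split_vec c T) (ext_map (@transfer D F S T) z)).
Proof.
move=> cS S1E dS1 TE.
apply: (@wedge_if2 F charF _ _ _ (@transfer D F S S1) (@transfer D F S1 T)
  (@transfer D F S T) (splits c S) (splits d S1) (split_vec c S1)).
- by move=> sd; apply/eqP; rewrite (split_vec_eq0 dS1 TE).
- by move=> u; apply: (@transfer_comp S S1 T d u dS1 TE).
- exact: (@transfer_split_vec S1 T c d dS1 TE).
Qed.

(** A smoothing pairs the four half-edges, so each of (c, 1) and (c, 3) is joined to
    one of (c, 0) and (c, 2). *)
Lemma opposite_connect S c :
  connect (circle_rel S) ((c, 1) : dart n) (c, 3) = connect (circle_rel S) ((c, 0) : dart n) (c, 2).
Proof.
have cs := circle_rel_sym shaded S.
have e0 := connect_smooth S ((c, 0) : dart n).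
have e2 := connect_smooth S ((c, 2) : dart n).
have t3 : -1 = 3 :> 'Z_4 by apply: val_inj.
have t1 : 2 - 1 = 1 :> 'Z_4 by apply: val_inj.
have t3' : 2 + 1 = 3 :> 'Z_4 by apply: val_inj.
move: e0 e2; rewrite /smooth /turn /= add0r; case: (c \in S) => /=; rewrite ?t1 ?t3 ?t3' => e0 e2.
  have -> : connect (circle_rel S) ((c, 0) : dart n) (c, 2) = connect (circle_rel S) ((c, 3) : dart n) (c, 1).
    by rewrite (same_connect cs e0) (same_connect_r cs e2).
  by rewrite cs.
by rewrite (same_connect cs e0) (same_connect_r cs e2).
Qed.

Lemma split_vec_connect S c :
  (split_vec c S == 0) = connect (circle_rel S) ((c, 0) : dart n) (c, 2).
Proof.
rewrite subr_eq0 (circle_through_connect F shaded) -opposite_connect /tail.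
case: (arrows c); first by rewrite !turn_at.
have t3' : 2 + 1 = 3 :> 'Z_4 by apply: val_inj.
have t1 : 2 + 3 = 1 :> 'Z_4 by apply: val_inj.
by rewrite /turn /= t3' t1 (circle_rel_sym shaded).
Qed.

(** This follows from [card_circle_step] in either direction of the edge, as c may be
    added to or removed from the subgraph. *)
Lemma card_circle_flip S S' c : c \notin S -> S' = c |: S ->
  (#|circle S'| + (~~ splits c S).*2 = #|circle S| + 1)%N.
Proof.
move=> cS S'E; have sE : splits c S = connect (circle_rel S) ((c, 0) : dart n) (c, 2).
  exact: (root_connect (circle_rel_sym shaded S)).
have [cp|cp] := boolP (c \in pos).
  rewrite sE; apply: (@card_circle_step D shaded S S' c); first by rewrite S'E tait_set_pos.
  by rewrite in_tait_set cp (negPf cS).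
have step : (#|circle S| + (~~ connect (circle_rel S') ((c, 0%R) : dart n) (c, 2%R)).*2 =
    #|circle S'| + 1)%N.
  apply: (@card_circle_step D shaded S' S c); first by rewrite S'E; apply: tait_set_neg.
  by rewrite in_tait_set (negPf cp) S'E setU11.
have E : connect (circle_rel S') ((c, 0) : dart n) (c, 2) = ~~ splits c S.
  by rewrite -split_vec_connect (split_vec_eq0 cS S'E).
rewrite E negbK in step; have arith (a b : nat) (s : bool) :
    (a + s.*2 = b + 1 -> b + (~~ s).*2 = a + 1)%N by case: s => /=; lia.
exact: arith step.
Qed.

(** The coordinates of the two vectors are 0, 1 and -1. *)
Lemma basis_diff_prop (J : finType) (a b a' b' : J) (k : F) :
  basisv F a - basisv F b = k *: (basisv F a' - basisv F b') -> a' != b' ->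
  basisv F a != basisv F b -> sgn_unit k.
Proof.
move=> E ab' ab; have := congr1 (fun v : freev F J => v a') E.
rewrite !ffunE eqxx (negPf ab') subr0 => /esym; rewrite -[LHS]/(k * 1) mulr1.
have k0 : k != 0.
  by apply: contra ab => /eqP k0; rewrite -subr_eq0 E k0 scale0r.
move=> kE; move: k0; rewrite kE; case: (a' == a); case: (a' == b); rewrite ?subrr ?eqxx ?subr0 ?sub0r.
- by [].
- by left.
- by right.
- by [].
Qed.

Lemma basis_diff_neq0 (J : finType) (a b : J) : basisv F a - basisv F b != 0 -> a != b.
Proof. by apply: contra_neq => ->; rewrite subrr. Qed.

Lemma splits_connect S c j k : splits c S -> connect (circle_rel S) ((c, j) : dart n) (c, k).
Proof.
move=> sc; have cs := circle_rel_sym shaded S.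
have e02 : connect (circle_rel S) ((c, 0) : dart n) (c, 2).
  by rewrite -(root_connect cs).
have e13 : connect (circle_rel S) ((c, 1) : dart n) (c, 3) by rewrite opposite_connect.
have e01 : connect (circle_rel S) ((c, 0) : dart n) (c, 1).
  have := connect_smooth S ((c, 0) : dart n).
  rewrite /smooth /turn /= add0r; case: (c \in S) => //=.
  have -> : -1 = 3 :> 'Z_4 by apply: val_inj.
  by move=> e03; apply: connect_trans e03 _; rewrite cs.
have all0 l : connect (circle_rel S) ((c, 0) : dart n) (c, l).
  case: l => l; do 4?[case: l => [|l]] => // ltl.
  - by have -> : Ordinal ltl = 0 by apply: val_inj.
  - by have -> : Ordinal ltl = 1 by apply: val_inj.
  - by have -> : Ordinal ltl = 2 by apply: val_inj.
  - by have -> : Ordinal ltl = 3; [apply: val_inj | apply: connect_trans e01 e13].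
by apply: connect_trans (all0 k); rewrite cs.
Qed.

(** If c lies on one circle of S, another smoothing of c can only cut that circle. *)
Lemma connect_coarser S S' c x x' : S' = c |: S -> splits c S ->
  connect (circle_rel S') x x' -> connect (circle_rel S) x x'.
Proof.
move=> S'E sc /connectP[p pp ->]; elim: p x pp => //= z p IH x /andP[xz /IH].
apply: connect_trans; case/orP: xz => /eqP ->; last exact: connect_glue.
have [xc|xc] := eqVneq x.1 c.
  by rewrite /smooth /turn; case: x xc => xc j /= ->; apply: splits_connect.
have -> : smooth S' x = smooth S x by rewrite /smooth S'E in_setU1 (negPf xc).
exact: connect_smooth.
Qed.

(** The transfer back to S, where d lies on a single circle, kills the vector of d
    but not that of c. *)
Lemma split_vec_independent S S' c d : d \notin S -> S' = d |: S -> splits d S ->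
  split_vec c S != 0 -> forall k, split_vec c S' <> k *: split_vec d S'.
Proof.
move=> dS S'E sd vc0 k E.
have back x : transfer S (circle_through F S' x) = circle_through F S x.
  rewrite (transfer_circle F shaded); apply/eqP.
  rewrite (circle_through_connect F shaded) (circle_rel_sym shaded).
  by apply: (connect_coarser S'E sd); apply: connect_root.
have backv e : transfer S (split_vec e S') = split_vec e S.
  apply: etrans (linearB (@transfer D F S' S) _ _) _.
  by apply: congr2; [apply: back | congr (- _); apply: back].
have vd0 : split_vec d S = 0.
  by apply/eqP; rewrite split_vec_connect; apply: splits_connect.
have E1 := etrans (esym (backv c)) (congr1 (@transfer D F S' S) E).
have E2 := linearZ_LR (@transfer D F S' S) k (split_vec d S').
have E3 := congr1 (GRing.scale k) (etrans (backv d) vd0).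
by case/eqP: vc0; apply: etrans E1 (etrans E2 (etrans E3 (scaler0 _ k))).
Qed.

(** Both paths split a circle and merge it again. Then both compositions vanish,
    and the face puts no condition on the scalars of the arrangement. *)
Definition exceptional_face S c d :=
  [&& splits c S, ~~ splits d (c |: S), splits d S & ~~ splits c (d |: S)].

(** For s = 1 this is a face of type C, and for s = -1 one of type A. *)
Definition face_sign S c d (s : F) :=
  let T := c |: (d |: S) in
  (forall z, @odd_map2 D F arrows c d S T z = s *: @odd_map2 D F arrows d c S T z) /\
  @odd_map2 D F arrows d c S T (ext_one (freev F (circle S))) != 0.

(** Both paths have as many splittings, by the number of circles. With the
    vectors v_c and v_d of [odd_map2E], the compositions are products of the
    common transfer with both vectors, in opposite orders, or with one of them;
    if a merger precedes a splitting on both paths, then v_c = v_d up to the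
    sign. *)
Lemma face_signP S c d : c \notin S -> d \notin S -> c != d ->
  ~~ exceptional_face S c d -> exists2 s, sgn_unit s & face_sign S c d s.
Proof.
move=> cS dS cd; set T := c |: (d |: S).
have dSc : d \notin c |: S by rewrite !inE negb_or eq_sym cd.
have cSd : c \notin d |: S by rewrite !inE negb_or cd.
have TEc : T = c |: (d |: S) by [].
have TEd : T = d |: (c |: S) by rewrite /T setUCA.
pose E z : ext F (freev F (circle T)) := ext_map (@transfer D F S T) z.
have E1 : E (ext_one _) = ext_one _ by apply: ext_map1.
have Ecd z := @odd_map2E S (c |: S) T c d z cS erefl dSc TEd.
have Edc z := @odd_map2E S (d |: S) T d c z dS erefl cSd TEc.
have cnt : (splits c S + splits d (c |: S) = splits d S + splits c (d |: S))%N.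
  have arith (a b b' t : nat) (p1 p2 q1 q2 : bool) :
      (b + (~~ p1).*2 = a + 1 -> t + (~~ p2).*2 = b + 1 ->
       b' + (~~ q1).*2 = a + 1 -> t + (~~ q2).*2 = b' + 1 -> p1 + p2 = q1 + q2)%N.
    have nb (p : bool) : (nat_of_bool (~~ p) + nat_of_bool p = 1)%N by case: p.
    move: (nb p1) (nb p2) (nb q1) (nb q2).
    move: (nat_of_bool (~~ p1)) (nat_of_bool (~~ p2)) (nat_of_bool (~~ q1)) (nat_of_bool (~~ q2)).
    by move: (nat_of_bool p1) (nat_of_bool p2) (nat_of_bool q1) (nat_of_bool q2) => *; lia.
  exact: (arith _ _ _ _ _ _ _ _ (card_circle_flip cS erefl) (card_circle_flip dSc TEd)
    (card_circle_flip dS erefl) (card_circle_flip cSd TEc)).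
have vd0 := split_vec_eq0 dSc TEd.
have vc0 := split_vec_eq0 cSd TEc.
have Tc := @transfer_split_vec (c |: S) T c d dSc TEd.
have Sc0 := split_vec_eq0 cS (erefl (c |: S)).
rewrite /exceptional_face /face_sign /odd_map2 -/T; move: Ecd Edc cnt vd0 vc0 Sc0.
case p1: (splits c S); case p2: (splits d (c |: S)); case q1: (splits d S);
  case q2: (splits c (d |: S)) => //= Ecd Edc _ vd0 vc0 Sc0 _.
- (* two splits on each side *)
  exists (-1); first by right.
  split=> [z|]; first by rewrite Ecd Edc wedgeC scaleN1r.
  rewrite Edc -/(E _) E1 wedge2_one_neq0 //; first by rewrite vd0.
  exact: (@split_vec_independent (c |: S) T c d dSc TEd p2 (negbT Sc0)).
- (* one split on each side, after a merger *)
  exists 1; first by left.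
  split=> [z|]; first by rewrite Ecd Edc scale1r.
  by rewrite Edc -/(E _) E1 wedge_one_neq0 // vc0.
- exists 1; first by left.
  split=> [z|]; first by rewrite Ecd Edc scale1r.
  by rewrite Edc -/(E _) E1 wedge_one_neq0 // vd0.
- (* a merger, then a split: the two vectors agree up to the sign *)
  have [k kE] := Tc; have vcE : split_vec c T = (- k) *: split_vec d T.
    move: kE; rewrite (eqP Sc0) linear0 scaleNr => /esym/eqP.
    by rewrite addr_eq0 => /eqP.
  have ks : sgn_unit (- k).
    move: vcE vd0 vc0; rewrite /Defs.split_vec !(circle_throughE F shaded) => vcE vd0 vc0.
    apply: basis_diff_prop vcE _ _; first by apply: basis_diff_neq0; rewrite vd0.
    by rewrite -subr_eq0 vc0.
  exists (- k) => //; split=> [z|]; last by rewrite Edc -/(E _) E1 wedge_one_neq0 // vc0.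
  rewrite Ecd Edc vcE wedgeZl scalerA.
  by have -> : - k * - k = 1; [case: ks => ->; rewrite ?mulr1 ?mulrNN ?mulr1 | rewrite scale1r].
- exists 1; first by left.
  split=> [z|]; first by rewrite Ecd Edc scale1r.
  rewrite Edc -/(E _) E1; apply/eqP => /ffunP/(_ set0)/eqP.
  by rewrite basisvE eqxx ffunE oner_eq0.
Qed.

End Faces.

(** * The isomorphism along an edge of the cube *)

Lemma dim_subvs (F : fieldType) (V : vectType F) (U : {vspace V}) :
  \dim {: subvs_of U} = \dim U.
Proof. by rewrite dimvf. Qed.

Section SubMapsLinear.
Variables (F : fieldType) (n : nat) (A : signed_arrangement F n).
Implicit Types S T : {set 'I_n}.

Fact sub_proj_H_is_linear S T : linear (@sub_proj_H F n A S T).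
Proof. by move=> a u v; rewrite /sub_proj_H !linearP. Qed.
HB.instance Definition _ S T := GRing.isLinear.Build F (subvs_of (sa_H A S))
  (subvs_of (sa_H A T)) *:%R (@sub_proj_H F n A S T) (@sub_proj_H_is_linear S T).

Fact sub_incl_H_is_linear S T : linear (@sub_incl_H F n A S T).
Proof. by move=> a u v; rewrite /sub_incl_H !linearP. Qed.
HB.instance Definition _ S T := GRing.isLinear.Build F (subvs_of (sa_H A S))
  (subvs_of (sa_H A T)) *:%R (@sub_incl_H F n A S T) (@sub_incl_H_is_linear S T).

Fact sub_proj_W_is_linear S T : linear (@sub_proj_W F n A S T).
Proof. by move=> a u v; rewrite /sub_proj_W !linearP. Qed.
HB.instance Definition _ S T := GRing.isLinear.Build F (subvs_of (sa_W A S))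
  (subvs_of (sa_W A T)) *:%R (@sub_proj_W F n A S T) (@sub_proj_W_is_linear S T).

Fact sub_incl_W_is_linear S T : linear (@sub_incl_W F n A S T).
Proof. by move=> a u v; rewrite /sub_incl_W !linearP. Qed.
HB.instance Definition _ S T := GRing.isLinear.Build F (subvs_of (sa_W A S))
  (subvs_of (sa_W A T)) *:%R (@sub_incl_W F n A S T) (@sub_incl_W_is_linear S T).

Variables (r : 'I_n) (S T : {set 'I_n}) (z : freev F (sa_basis A S)).
Local Notation S' := (sa_tilde A S).
Local Notation T' := (sa_tilde A T).

Lemma sa_delta_pos_in : r \in sa_pos A -> sa_vec A r \in sa_span A S' ->
  @sa_delta F n A r S T z = tensor_map (ext_map (@sub_proj_H F n A S' T'))
    (wedge (vsproj (sa_W A T') (sa_coproj (sa_W A T') (sa_dual A r)))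
       \o ext_map (@sub_incl_W F n A S' T')) z.
Proof. by move=> rp rs; rewrite /sa_delta rp rs. Qed.

Lemma sa_delta_pos_notin : r \in sa_pos A -> sa_vec A r \notin sa_span A S' ->
  @sa_delta F n A r S T z = tensor_map (ext_map (@sub_proj_H F n A S' T'))
    (ext_map (@sub_incl_W F n A S' T')) z.
Proof. by move=> rp rs; rewrite /sa_delta rp rs. Qed.

Lemma sa_delta_neg_in : r \notin sa_pos A -> sa_vec A r \in sa_span A (S' :\ r) ->
  @sa_delta F n A r S T z = tensor_map (ext_map (@sub_incl_H F n A S' T'))
    (ext_map (@sub_proj_W F n A S' T')) z.
Proof. by move=> rp rs; rewrite /sa_delta (negPf rp) rs. Qed.

Lemma sa_delta_neg_notin : r \notin sa_pos A -> sa_vec A r \notin sa_span A (S' :\ r) ->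
  @sa_delta F n A r S T z = tensor_map
    (wedge (vsproj (sa_H A T') (orth_proj (sa_form A) (sa_H A T') (sa_vec A r)))
       \o ext_map (@sub_incl_H F n A S' T'))
    (ext_map (@sub_proj_W F n A S' T')) z.
Proof. by move=> rp rs; rewrite /sa_delta (negPf rp) (negPf rs). Qed.

End SubMapsLinear.

Section ChainIso.
Variables (D : link_diagram) (F : fieldType).
Variable charF : [pchar F] =i pred0.
Variables (shaded : checkerboard D) (edge_dir : 'I_(ncross D) -> bool).
Variable arrows : 'I_(ncross D) -> bool.
Local Notation n := (ncross D).
Local Notation edge := (@edge_vec D F shaded edge_dir).
Local Notation source := (edge_source shaded edge_dir).
Local Notation A := (link_arrangement charF shaded edge_dir).
Local Notation V := (sa_space A).
Local Notation nu := (@sa_vec F n A).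
Local Notation pH := (@pH D F charF shaded edge_dir).
Local Notation qW := (@qW D F charF shaded edge_dir).
Local Notation ts := (tait_set shaded).
Local Notation next := (next_sector (@glue D)).
Local Notation pos := (positive_edges shaded).
Implicit Types (S T : {set 'I_n}) (e c r : 'I_n) (x : dart n).

Variables (g : {linear V -> V}) (lam : 'I_n -> F) (y : dart n -> freev F 'I_n).
Hypothesis g_nu : forall e, g (nu e) = lam e *: nu e.
Hypothesis g_surj : forall v, exists u, v = g u.
Hypothesis lam_neq0 : forall e, lam e != 0.
Hypothesis y_next : forall x, y (next x) = y x.
Hypothesis y_jump : forall c w, relation edge w ->
  dotp (y (turn 1 (source c)) - y (turn 3 (source c))) w = w c.

Local Notation HW := (@HW D F charF shaded edge_dir).
Local Notation tred S := (@theta_red D F charF shaded edge_dir g y S).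
Local Notation split_red r S := (vsproj (reduced F S) (split_vec F arrows r S)).
Local Notation rtr S S' := (@reduced_transfer D F S S').
Local Notation edge_sign_at := (edge_sign_at F shaded edge_dir arrows).
Local Notation dual_sign_at := (dual_sign_at F shaded edge_dir arrows).

Lemma theta_redE S v : tred S v = theta (charF := charF) (edge_dir := edge_dir) g y (vsval v).
Proof. by []. Qed.

(** Inverse of theta on differences of circles. *)
Definition theta_inv S : HW (ts S) -> subvs_of (reduced F S) := (linfun (tred S))^-1%VF.
HB.instance Definition _ S := GRing.Linear.on (@theta_inv S).

Lemma theta_redK S p : tred S (theta_inv p) = p.
Proof.
have [v ->] := theta_red_surj g_nu g_surj y_next y_jump p.
rewrite /theta_inv -[tred S v](lfunE (tred S)) -[LHS](lfunE (tred S)).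
exact: (limg_lfunVK (memv_img _ (memvf v))).
Qed.

Lemma tred_inj S : injective (tred S).
Proof. exact: bij_inj (theta_red_bij g_nu g_surj lam_neq0 y_next y_jump S). Qed.

(** The images of H_T and W_T in the reduced space of circles. *)
Definition Fmap S (u : subvs_of (sa_H A (ts S))) : subvs_of (reduced F S) :=
  @theta_inv S (u, 0).
Fact Fmap_is_linear S : linear (@Fmap S).
Proof.
move=> a u v; rewrite /Fmap -linearP; congr theta_inv.
by rewrite [RHS]surjective_pairing /= scaler0 addr0.
Qed.
HB.instance Definition _ S := GRing.isLinear.Build F (subvs_of (sa_H A (ts S)))
  (subvs_of (reduced F S)) *:%R (@Fmap S) (@Fmap_is_linear S).

Definition Gmap S (w : subvs_of (sa_W A (ts S))) : subvs_of (reduced F S) :=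
  @theta_inv S (0, w).
Fact Gmap_is_linear S : linear (@Gmap S).
Proof.
move=> a u v; rewrite /Gmap -linearP; congr theta_inv.
by rewrite [RHS]surjective_pairing /= scaler0 addr0.
Qed.
HB.instance Definition _ S := GRing.isLinear.Build F (subvs_of (sa_W A (ts S)))
  (subvs_of (reduced F S)) *:%R (@Gmap S) (@Gmap_is_linear S).

(** The tensor factors of T_S commute, while their images anticommute. The sign
    makes up for it: the binomial accounts for the products with vectors of H,
    and the linear term for those with vectors of W, whose dimension grows by
    one at each such edge; the number of negative edges corrects for the
    inclusions in the other direction. *)
Definition sign_exp S i : nat :=
  ('C(i, 2) + i * (\dim (sa_W A (ts S)) + #|S :\: pos|))%N.

(** The tensor product of exterior algebras becomes the exterior algebra of H_T + W_T,
    which theta identifies with the reduced space of circles. *)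
Definition chain_iso S (z : freev F (sa_basis A S)) : freev F (reduced_basis F S) :=
  tens_ext (@Fmap S) (@Gmap S) (sign_exp S) z.
Fact chain_iso_is_linear S : linear (@chain_iso S).
Proof. by move=> a u v; apply: (linearP (tens_ext (@Fmap S) (@Gmap S) (sign_exp S))). Qed.
HB.instance Definition _ S := GRing.isLinear.Build F (freev F (sa_basis A S))
  (freev F (reduced_basis F S)) *:%R (@chain_iso S) (@chain_iso_is_linear S).

Lemma chain_iso_bij S : bijective (@chain_iso S).
Proof.
apply: (@tens_ext_bij F charF _ _ _ (@Fmap S) (@Gmap S) (sign_exp S)).
  move=> e; exists (tred S e).1, (tred S e).2.
  apply: (@tred_inj S); rewrite linearD /= !theta_redK [LHS]surjective_pairing.
  by congr (_, _); rewrite /= ?addr0 ?add0r.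
have [a _] := circle_nonempty shaded S.
rewrite !dim_subvs; have := dim_reduced F a.
rewrite -[S in #|circle S|](tait_setK shaded).
by rewrite (card_circle_HW g_nu g_surj lam_neq0 y_next y_jump) => -[].
Qed.

Section Edge.
Variables (S : {set 'I_n}) (r : 'I_n).
Hypothesis rS : r \notin S.
Local Notation S' := (r |: S).

Lemma tred_transfer (v : subvs_of (reduced F S)) :
  tred S' (rtr S S' v) = theta_at (charF := charF) (edge_dir := edge_dir) g y (ts S') (vsval v).
Proof.
have E := congr1 (@theta D F charF shaded edge_dir g y S')
  (@vsval_reduced_transfer D F shaded S S' v).
have E2 := @theta_transfer D F charF shaded edge_dir g lam y g_nu y_next y_jump S S' (vsval v).
apply: etrans (theta_redE (rtr S S' v)) _.
apply: etrans E _.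
exact: E2.
Qed.

Lemma split_redE : tred S' (split_red r S') =
  ((edge_sign_at r * lam r) *: pH (ts S') (nu r), dual_sign_at r *: qW (ts S') (basisv F r)).
Proof. exact: theta_split_vec. Qed.

Lemma pos_mem : r \in pos -> r \in ts S'.
Proof. by move=> rp; rewrite tait_set_pos // setU11. Qed.

Lemma neg_mem : r \notin pos -> r \notin ts S'.
Proof. by move=> rp; rewrite in_tait_set setU11 (negPf rp). Qed.

Lemma unit_sq (s : F) : sgn_unit s -> s * s = 1.
Proof. by case=> ->; rewrite ?mulrNN mulr1. Qed.

(** At a positive crossing r is an edge of the new subgraph, so pH nu_r = 0 and the
    vector of the splitting lies in the image of W. *)
Lemma pos_Gmap : r \in pos ->
  Gmap (qW (ts S') (basisv F r)) = dual_sign_at r *: split_red r S'.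
Proof.
move=> rp; apply: (@tred_inj S').
rewrite /Gmap theta_redK linearZ /= split_redE pH_nu_in ?pos_mem //.
have bb := unit_sq (dual_sign_atP F shaded edge_dir arrows r).
by congr (_, _); rewrite /= ?scaler0 // scalerA bb scale1r.
Qed.

(** At a negative crossing r leaves the subgraph, so the vector lies in the image of
    H. This is where the scaling lam enters. *)
Lemma neg_Fmap : r \notin pos ->
  Fmap (pH (ts S') (nu r)) = (edge_sign_at r / lam r) *: split_red r S'.
Proof.
move=> rp; apply: (@tred_inj S').
rewrite /Fmap theta_redK linearZ /= split_redE (@qW_notin D F charF shaded edge_dir _ _ (neg_mem rp)).
have bb := unit_sq (edge_sign_atP F shaded edge_dir arrows r).
by congr (_, _); rewrite /= ?scaler0 // scalerA mulrACA bb mul1r mulVf // scale1r.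
Qed.

(** An equation in the coordinates of theta, read back in the space of circles. *)
Lemma theta_inv_lift (u' : HW (ts S')) (v : subvs_of (reduced F S)) :
  (exists k, u' = tred S' (rtr S S' v) + k *: tred S' (split_red r S')) ->
  exists k, theta_inv u' = rtr S S' v + k *: split_red r S'.
Proof.
case=> k kE; exists k; apply: (@tred_inj S'); rewrite theta_redK kE.
apply/esym; apply: etrans (linearD (tred S') _ _) _; congr (_ + _).
exact: (linearZ_LR (tred S')).
Qed.

Lemma pos_FG (rp : r \in pos) u w :
  (exists k, Fmap (sub_proj_H (ts S') u) = rtr S S' (Fmap u) + k *: split_red r S') /\
  (exists k, Gmap (sub_incl_W (ts S') w) = rtr S S' (Gmap w) + k *: split_red r S').
Proof.
have T'E : ts S' = r |: ts S := tait_set_pos S rp.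
have TT : ts S \subset ts S' by rewrite T'E subsetUr.
have key (v : subvs_of (reduced F S)) : exists k, tred S' (rtr S S' v) =
    (sub_proj_H (ts S') (tred S v).1, sub_incl_W (ts S') (tred S v).2) -
      k *: tred S' (split_red r S').
  rewrite tred_transfer split_redE pH_nu_in ?pos_mem // scaler0.
  have [k] := @theta_at_inclW D F charF shaded edge_dir g y (ts S) r S (vsval v).
  rewrite -T'E -[theta_at _ _ (ts S) _]/(tred S v) => kE.
  have bb := unit_sq (dual_sign_atP F shaded edge_dir arrows r).
  exists (k * dual_sign_at r); rewrite [LHS]surjective_pairing; congr (_, _) => /=.
    by rewrite scaler0 subr0 (theta_at_H _ _ _ TT).
  by rewrite scalerA -mulrA bb mulr1 kE addrK.
split; apply: theta_inv_lift.
  have [k kE] := key (Fmap u); exists k; rewrite kE subrK /Fmap theta_redK.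
  by congr (_, _); rewrite -[RHS]/(sub_incl_W (ts S') (0 : subvs_of (sa_W A (ts S)))) linear0.
have [k kE] := key (Gmap w); exists k; rewrite kE subrK /Gmap theta_redK.
by congr (_, _); rewrite -[RHS]/(sub_proj_H (ts S') (0 : subvs_of (sa_H A (ts S)))) linear0.
Qed.

Lemma neg_FG (rp : r \notin pos) u w :
  (exists k, Fmap (sub_incl_H (ts S') u) = rtr S S' (Fmap u) + k *: split_red r S') /\
  (exists k, Gmap (sub_proj_W (ts S') w) = rtr S S' (Gmap w) + k *: split_red r S').
Proof.
have TE : ts S = r |: ts S' := tait_set_neg rp rS.
have TT : ts S' \subset ts S by rewrite TE subsetUr.
have key (v : subvs_of (reduced F S)) : exists k, tred S' (rtr S S' v) =
    (sub_incl_H (ts S') (tred S v).1, sub_proj_W (ts S') (tred S v).2) -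
      k *: tred S' (split_red r S').
  rewrite tred_transfer split_redE (@qW_notin D F charF shaded edge_dir _ _ (neg_mem rp)) scaler0.
  have [k] := @theta_at_inclH D F charF shaded edge_dir g y (ts S') r S (vsval v).
  rewrite -TE -[theta_at _ _ (ts S) _]/(tred S v) => kE.
  have nz : edge_sign_at r * lam r != 0.
    by rewrite mulf_neq0 // sgn_unit_neq0 //; apply: edge_sign_atP.
  exists (k / (edge_sign_at r * lam r)); rewrite [LHS]surjective_pairing; congr (_, _) => /=.
    by rewrite scalerA divfK // kE addrK.
  by rewrite scaler0 subr0 (theta_at_W _ _ _ TT).
split; apply: theta_inv_lift.
  have [k kE] := key (Fmap u); exists k; rewrite kE subrK /Fmap theta_redK.
  by congr (_, _); rewrite -[RHS]/(sub_proj_W (ts S') (0 : subvs_of (sa_W A (ts S)))) linear0.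
have [k kE] := key (Gmap w); exists k; rewrite kE subrK /Gmap theta_redK.
by congr (_, _); rewrite -[RHS]/(sub_incl_H (ts S') (0 : subvs_of (sa_H A (ts S)))) linear0.
Qed.

Lemma split_red_eq0 : ~~ splits r S -> split_red r S' = 0.
Proof.
by rewrite -(split_vec_eq0 charF shaded arrows rS erefl) => /eqP ->; rewrite linear0.
Qed.

Lemma card_HW S0 : #|circle S0| = (\dim (sa_H A (ts S0)) + \dim (sa_W A (ts S0))).+1.
Proof.
rewrite -(card_circle_HW g_nu g_surj lam_neq0 y_next y_jump (ts S0)).
by rewrite tait_setK.
Qed.

Lemma splits_nu : splits r S =
  if r \in pos then nu r \in sa_span A (ts S) else nu r \notin sa_span A (ts S :\ r).
Proof. exact: (splitsE g_nu g_surj lam_neq0 y_next y_jump rS). Qed.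

(** The number of circles is dim H + dim W + 1. A splitting adds one circle, and r
    lies in the span of T, so H does not change; a merger removes one. *)
Lemma dim_W_pos : r \in pos ->
  \dim (sa_W A (ts S')) = (\dim (sa_W A (ts S)) + splits r S)%N.
Proof.
move=> rp; have c := card_HW S; have c' := card_HW S'.
have fl := card_circle_flip charF shaded arrows rS erefl.
have T'E : ts S' = r |: ts S := tait_set_pos S rp.
have hle := @dim_sa_H_step D F charF shaded edge_dir (ts S) r.
have wle : (\dim (sa_W A (ts S)) <= \dim (sa_W A (ts S')))%N.
  by apply: dimvS; apply: sa_W_mono; rewrite T'E subsetUr.
have heq : splits r S -> \dim (sa_H A (ts S')) = \dim (sa_H A (ts S)).
  by rewrite splits_nu rp T'E => /sa_H_eq ->.
rewrite -T'E in hle; move: heq fl; case: (splits r S) => heq fl.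
  have arith (a b h w h' w' : nat) : (b + (~~ true).*2 = a + 1 -> a = (h + w).+1 ->
    b = (h' + w').+1 -> h' = h -> w' = w + true)%N by rewrite /=; lia.
  exact: (arith _ _ _ _ _ _ fl c c' (heq isT)).
have arith (a b h w h' w' : nat) : (b + (~~ false).*2 = a + 1 -> a = (h + w).+1 ->
  b = (h' + w').+1 -> h <= h'.+1 -> w <= w' -> w' = w + false)%N by rewrite /=; lia.
exact: (arith _ _ _ _ _ _ fl c c' hle wle).
Qed.

Lemma dim_W_neg : r \notin pos ->
  \dim (sa_W A (ts S)) = (\dim (sa_W A (ts S')) + ~~ splits r S)%N.
Proof.
move=> rp; have c := card_HW S; have c' := card_HW S'.
have fl := card_circle_flip charF shaded arrows rS erefl.
have TE : ts S = r |: ts S' := tait_set_neg rp rS.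
have TD : ts S :\ r = ts S' by rewrite TE setU1K // neg_mem.
have hle := @dim_sa_H_step D F charF shaded edge_dir (ts S') r.
have wle : (\dim (sa_W A (ts S')) <= \dim (sa_W A (ts S)))%N.
  by apply: dimvS; apply: sa_W_mono; rewrite TE subsetUr.
have heq : ~~ splits r S -> \dim (sa_H A (ts S)) = \dim (sa_H A (ts S')).
  by rewrite splits_nu (negPf rp) negbK TD => /sa_H_eq <-; rewrite TE.
rewrite -TE in hle; move: heq fl; case: (splits r S) => heq fl.
  have arith (a b h w h' w' : nat) : (b + (~~ true).*2 = a + 1 -> a = (h + w).+1 ->
    b = (h' + w').+1 -> h' <= h.+1 -> w' <= w -> w = w' + ~~ true)%N by rewrite /=; lia.
  exact: (arith _ _ _ _ _ _ fl c c' hle wle).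
have arith (a b h w h' w' : nat) : (b + (~~ false).*2 = a + 1 -> a = (h + w).+1 ->
  b = (h' + w').+1 -> h = h' -> w = w' + ~~ false)%N by rewrite /=; lia.
exact: (arith _ _ _ _ _ _ fl c c' (heq isT)).
Qed.

Lemma setD_pos : r \in pos -> S' :\: pos = S :\: pos.
Proof.
move=> rp; apply/setP => e; rewrite !in_setD in_setU1.
by case: eqP => // ->; rewrite rp.
Qed.

Lemma card_setD_neg : r \notin pos -> #|S' :\: pos| = #|S :\: pos|.+1.
Proof.
move=> rp; have -> : S' :\: pos = r |: (S :\: pos).
  by apply/setP => e; rewrite !in_setU1 !in_setD in_setU1; case: eqP => // ->; rewrite rp.
by rewrite cardsU1 in_setD (negPf rS) andbF.
Qed.

(** The part of the scalar that does not depend on g and lam. This allows the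
    scalars to be compared first with g = 1, and g to be chosen afterwards. *)
Definition usign : F :=
  if splits r S then
    if r \in pos then dual_sign_at r
    else (-1) ^+ (\dim (sa_W A (ts S)) + #|S :\: pos|).+1 * edge_sign_at r
  else 1.

Lemma usignP : sgn_unit usign.
Proof.
rewrite /usign; case: ifP => _; last by left.
case: ifP => _; first exact: dual_sign_atP.
have [->|->] := edge_sign_atP F shaded edge_dir arrows r; rewrite ?mulr1 ?mulrN1.
  by rewrite -signr_odd; case: (odd _); [right|left].
by rewrite -signr_odd; case: (odd _); [left; rewrite opprK|right].
Qed.

Definition edge_scalar : F := usign * (if (r \notin pos) && splits r S then (lam r)^-1 else 1).

Lemma reduced_mapE z : @reduced_map D F arrows r S S' z =
  wedge_if (splits r S) (split_red r S') (ext_map (rtr S S') z).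
Proof. by []. Qed.

Let pHm := @sub_proj_H F n A (ts S) (ts S').
Let iWm := @sub_incl_W F n A (ts S) (ts S').
Let iHm := @sub_incl_H F n A (ts S) (ts S').
Let pWm := @sub_proj_W F n A (ts S) (ts S').

Lemma signr_add2 (a b q : nat) : a = (b + 2 * q)%N -> (-1) ^+ a = (-1) ^+ b :> F.
Proof. by move=> ->; rewrite exprD exprM sqrrN !expr1n mulr1. Qed.

Let fS := @Fmap S.
Let gS := @Gmap S.
Let fS' := @Fmap S'.
Let gS' := @Gmap S'.
Let tS := @reduced_transfer D F S S'.

Lemma chain_iso_pos_split (z : freev F (sa_basis A S)) : r \in pos -> splits r S ->
  @chain_iso S' (tensor_map (ext_map pHm) (wedge (qW (ts S') (basisv F r)) \o ext_map iWm) z) =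
  dual_sign_at r *: wedge (split_red r S') (ext_map tS (@chain_iso S z)).
Proof.
move=> rp sr; rewrite -[dual_sign_at r]mul1r.
apply: (@tens_ext_split_r F _ _ _ _ _ _ fS gS fS' gS' pHm iWm tS (sign_exp S) (sign_exp S')
  charF (split_red r S') (dual_sign_at r) 1).
- by move=> u; have [+ _] := pos_FG rp u 0.
- by move=> w; have [_ +] := pos_FG rp 0 w.
- exact: pos_Gmap.
- move=> k; rewrite mul1r -exprD; apply: (@signr_add2 _ _ k).
  by rewrite /sign_exp (setD_pos rp) (dim_W_pos rp) sr /=; lia.
Qed.

Lemma chain_iso_pos_merge (z : freev F (sa_basis A S)) : r \in pos -> ~~ splits r S ->
  @chain_iso S' (tensor_map (ext_map pHm) (ext_map iWm) z) = ext_map tS (@chain_iso S z).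
Proof.
move=> rp sr; have sz := split_red_eq0 sr.
apply: (@tens_ext_merge F _ _ _ _ _ _ fS gS fS' gS' pHm iWm tS (sign_exp S) (sign_exp S') charF).
- by move=> u; have [[k kE] _] := pos_FG rp u 0; rewrite sz scaler0 addr0 in kE.
- by move=> w; have [_ [k kE]] := pos_FG rp 0 w; rewrite sz scaler0 addr0 in kE.
- by move=> k; rewrite /sign_exp (setD_pos rp) (dim_W_pos rp) (negPf sr) addn0.
Qed.

Lemma chain_iso_neg_merge (z : freev F (sa_basis A S)) : r \notin pos -> ~~ splits r S ->
  @chain_iso S' (tensor_map (ext_map iHm) (ext_map pWm) z) = ext_map tS (@chain_iso S z).
Proof.
move=> rp sr; have sz := split_red_eq0 sr.
apply: (@tens_ext_merge F _ _ _ _ _ _ fS gS fS' gS' iHm pWm tS (sign_exp S) (sign_exp S') charF).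
- by move=> u; have [[k kE] _] := neg_FG rp u 0; rewrite sz scaler0 addr0 in kE.
- by move=> w; have [_ [k kE]] := neg_FG rp 0 w; rewrite sz scaler0 addr0 in kE.
- move=> k; rewrite /sign_exp (card_setD_neg rp) (dim_W_neg rp) (negPf sr).
  by congr (_ ^+ _); rewrite /=; lia.
Qed.

Lemma chain_iso_neg_split (z : freev F (sa_basis A S)) : r \notin pos -> splits r S ->
  @chain_iso S' (tensor_map (wedge (pH (ts S') (nu r)) \o ext_map iHm) (ext_map pWm) z) =
  ((-1) ^+ (\dim (sa_W A (ts S)) + #|S :\: pos|).+1 * (edge_sign_at r / lam r)) *:
    wedge (split_red r S') (ext_map tS (@chain_iso S z)).
Proof.
move=> rp sr.
apply: (@tens_ext_split_l F _ _ _ _ _ _ fS gS fS' gS' iHm pWm tS (sign_exp S) (sign_exp S')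
  charF (split_red r S')).
- by move=> u; have [+ _] := neg_FG rp u 0.
- by move=> w; have [_ +] := neg_FG rp 0 w.
- exact: neg_Fmap.
- move=> k; rewrite -exprD; apply: (@signr_add2 _ _ k).
  by rewrite /sign_exp (card_setD_neg rp) (dim_W_neg rp) sr binS bin1 /=; lia.
Qed.

(** One of the four preceding lemmas applies, according to the sign of r and to
    whether a circle splits at r. *)
Theorem chain_isoE (z : freev F (sa_basis A S)) :
  @chain_iso S' (@sa_delta F n A r S S' z) =
  edge_scalar *: @reduced_map D F arrows r S S' (@chain_iso S z).
Proof.
have sE := splits_nu; rewrite reduced_mapE /edge_scalar /usign /wedge_if.
have [rp|rp] := boolP (r \in pos); rewrite ?rp ?(negPf rp) in sE.
  have [sr|sr] := boolP (splits r S); rewrite ?sr ?(negPf sr) in sE.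
    rewrite /= mulr1; apply: etrans (chain_iso_pos_split z rp sr).
    apply: congr1; apply: etrans (@sa_delta_pos_in F n A r S S' z rp (esym sE)) _.
    by rewrite (@sa_dualE D F charF shaded edge_dir).
  rewrite /= mulr1 scale1r; apply: etrans (chain_iso_pos_merge z rp sr).
  by apply: congr1; apply: (@sa_delta_pos_notin F n A r S S' z rp); rewrite -sE.
have [sr|sr] := boolP (splits r S); rewrite ?sr ?(negPf sr) in sE.
  rewrite /= -mulrA; apply: etrans (chain_iso_neg_split z rp sr).
  by apply: congr1; apply: (@sa_delta_neg_notin F n A r S S' z rp (esym sE)).
rewrite /= mulr1 scale1r; apply: etrans (chain_iso_neg_merge z rp sr).
by apply: congr1; apply: (@sa_delta_neg_in F n A r S S' z rp); apply/negPn; rewrite -sE.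
Qed.

End Edge.

End ChainIso.

(** * Scalars around a face *)

Section ScaledAutomorphism.
Variables (F : fieldType) (I : finType) (V : vectType F) (vec : I -> V).

Definition comb (w : freev F I) : V := \sum_i (w i : F) *: vec i.
Fact comb_is_linear : linear comb.
Proof. exact: linear_comb_is_linear. Qed.
HB.instance Definition _ := GRing.isLinear.Build F (freev F I) V *:%R comb comb_is_linear.

Lemma comb_basis e : comb (basisv F e) = vec e.
Proof.
rewrite /comb (bigD1 e) //= basisvE eqxx scale1r big1 ?addr0 // => i ie.
by rewrite basisvE (negPf ie) scale0r.
Qed.

Variable lam : I -> F.
Hypothesis lam_neq0 : forall e, lam e != 0.
Hypothesis lam_rel : forall w, relation vec w -> relation vec [ffun e => (lam e * w e : F) : F^o].

Definition diag_scale (w : freev F I) : freev F I := [ffun e => (lam e * w e : F) : F^o].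
Fact diag_scale_is_linear : linear diag_scale.
Proof.
move=> a u v; apply/ffunP => e; rewrite !ffunE mulrDr; congr (_ + _).
by rewrite -[LHS]/(lam e * (a * u e)) mulrCA.
Qed.
HB.instance Definition _ :=
  GRing.isLinear.Build F (freev F I) (freev F I) *:%R diag_scale diag_scale_is_linear.

(** Scaling the coordinates by lam preserves the relations, so it induces a map on
    the span of the vectors; extend it by the identity on a complement. It is
    onto, hence bijective, and g is its inverse. *)
Lemma scaled_automorphism : exists g : {linear V -> V},
  (forall e, g (vec e) = (lam e)^-1 *: vec e) /\ (forall v, exists u, v = g u).
Proof.
pose N := linfun comb; pose U := limg N.
pose h : 'End(V) := (linfun comb \o linfun diag_scale \o N^-1 \o projv U + (\1 - projv U))%VF.
have hE v : h v = comb (diag_scale ((N^-1)%VF (projv U v))) + (v - projv U v).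
  by rewrite add_lfunE add_lfunE opp_lfunE id_lfunE !comp_lfunE !lfunE.
have NE w : N w = comb w by rewrite lfunE.
have combE w : relation vec w = (comb w == 0) by [].
have h_vec e : h (vec e) = lam e *: vec e.
  have eU : vec e \in U by rewrite -comb_basis -NE memv_img ?memvf.
  rewrite hE projv_id // subrr addr0; set w := (N^-1)%VF _.
  have wE : comb w = vec e by rewrite -NE /w limg_lfunVK.
  have rw : relation vec (w - basisv F e) by rewrite combE linearB /= wE comb_basis subrr.
  have := lam_rel rw; rewrite combE -[finfun _]/(diag_scale _) linearB linearB /= subr_eq0 => /eqP ->.
  have -> : diag_scale (basisv F e) = lam e *: basisv F e.
    apply/ffunP => i; rewrite !ffunE -[RHS]/(lam e * _).
    by case: eqP => [->|_] //; rewrite !mulr0.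
  by rewrite linearZ /= comb_basis.
have h_surj v : exists u, v = h u.
  suff /memv_imgP[u _ ->] : v \in limg h by exists u.
  rewrite -[v](subrK (projv U v)) memvD //.
    have -> : v - projv U v = h (v - projv U v); last by rewrite memv_img ?memvf.
    rewrite hE linearB /= projv_proj subrr subr0.
    by rewrite !linear0 add0r.
  have [w _ ->] := memv_imgP (memv_proj U v).
  rewrite NE memv_suml // => e _; rewrite memvZ //.
  have -> : vec e = h ((lam e)^-1 *: vec e) by rewrite linearZ /= h_vec scalerA mulVf ?scale1r.
  by rewrite memv_img ?memvf.
have [h' hK h'K] : bijective h by apply: surj_dim_bij.
have h'lin : linear h'.
  by move=> a u v; apply: (can_inj hK); rewrite h'K linearP /= !h'K.
pose h'L := GRing.isLinear.Build F V V _ h' h'lin.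
pose g : {linear V -> V} := HB.pack h' h'L.
exists g; split=> [e|v]; last by exists (h v); rewrite [RHS]hK.
apply: (can_inj hK); rewrite [LHS]h'K linearZ /= h_vec scalerA mulVf ?scale1r //.
Qed.
End ScaledAutomorphism.

Lemma ext_map_square (F : fieldType) (charF : [pchar F] =i pred0) (U V V' W : vectType F)
    (f : {linear U -> V}) (g : {linear V -> W}) (f' : {linear U -> V'}) (g' : {linear V' -> W}) z :
  (forall u, g (f u) = g' (f' u)) ->
  ext_map g (ext_map f z) = ext_map g' (ext_map f' z).
Proof. by move=> E; rewrite !(ext_map_comp charF); apply: eq_ext_map => u; apply: E. Qed.

(** Anticommutation on one side of an isomorphism psi of complexes, seen on a single
    non-zero element Q on the other side. *)
Lemma face_transport (F : fieldType) (M N O : lmodType F) (psi : {linear M -> N})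
    (inc : {linear N -> O}) (a b a' b' s : F) u v p q P Q :
  a *: u + b *: v = 0 -> a *: psi u = a' *: p -> b *: psi v = b' *: q ->
  inc p = P -> inc q = Q -> P = s *: Q -> Q != 0 -> a' * s + b' = 0.
Proof.
move=> H0 K1 K2 ip iq fs nz.
have H1 : a' *: p + b' *: q = 0 by rewrite -K1 -K2 -!linearZ -linearD H0 linear0.
have := congr1 inc H1; rewrite linearD !linearZ /= linear0 ip iq fs.
by rewrite scalerA -scalerDl => /eqP; rewrite scaler_eq0 (negPf nz) orbF => /eqP.
Qed.

Section Flatness.
Variables (D : link_diagram) (F : fieldType).
Variable charF : [pchar F] =i pred0.
Variables (shaded : checkerboard D) (edge_dir : 'I_(ncross D) -> bool).
Variable arrows : 'I_(ncross D) -> bool.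
Local Notation n := (ncross D).
Local Notation edge := (@edge_vec D F shaded edge_dir).
Local Notation source := (edge_source shaded edge_dir).
Local Notation A := (link_arrangement charF shaded edge_dir).
Local Notation V := (sa_space A).
Local Notation nu := (@sa_vec F n A).
Local Notation next := (next_sector (@glue D)).
Local Notation rmap r S S' := (@reduced_map D F arrows r S S').
Implicit Types (S T : {set 'I_n}) (c d e r : 'I_n).

Variables (eps : {set 'I_n} -> 'I_n -> F) (kind : bool) (sgn : {set 'I_n} -> 'I_n -> bool).
Hypothesis Heps : anticommuting_scalars (sa_cube A) eps.
Hypothesis Hsgn : edge_assignment F arrows kind sgn.

Local Notation usign S r := (@usign D F charF shaded edge_dir arrows S r).

Variable y : dart n -> freev F 'I_n.
Hypothesis y_next : forall x, y (next x) = y x.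
Hypothesis y_jump : forall c w, relation edge w ->
  dotp (y (turn 1 (source c)) - y (turn 3 (source c))) w = w c.

(** The reduced complex is a subcomplex of the full one, on which edge assignments
    are defined. *)
Lemma ext_map_reduced r S S' z :
  ext_map (@vsval F _ (reduced F S')) (rmap r S S' z) =
  @odd_map D F arrows r S S' (ext_map (@vsval F _ (reduced F S)) z).
Proof.
have E : ext_map (@vsval F _ (reduced F S')) (ext_map (@reduced_transfer D F S S') z) =
    ext_map (@transfer D F S S') (ext_map (@vsval F _ (reduced F S)) z).
  apply: (@ext_map_square F charF _ _ _ _ (@reduced_transfer D F S S')
    (@vsval F _ (reduced F S')) (@vsval F _ (reduced F S)) (@transfer D F S S')) => v.
  exact: (@vsval_reduced_transfer D F shaded S S' v).
rewrite -[rmap r S S' z]/(wedge_if (splits r S)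
  (vsproj (reduced F S') (split_vec F arrows r S')) (ext_map (@reduced_transfer D F S S') z)).
rewrite -[RHS]/(wedge_if (splits r S) (split_vec F arrows r S') _) /wedge_if.
case: ifP => _; last exact: E.
apply: etrans (ext_map_wedge charF _ _ _) _; apply: congr2; last exact: E.
exact: (vsprojK (split_vec_reduced F shaded arrows r S')).
Qed.

(** The product of the scalars along one of the two paths of the face. *)
Definition face_prod (t : {set 'I_n} -> 'I_n -> F) S c d := t S c * t (c |: S) d.

Lemma sgn_face S c d s : c \notin S -> d \notin S -> c != d -> sgn_unit s ->
  face_sign arrows S c d s ->
  face_prod (fun S c => (-1) ^+ sgn S c) S c d * s +
  face_prod (fun S c => (-1) ^+ sgn S c) S d c = 0.
Proof.
move=> cS dS cd su [fs nz]; have [HA HC _ _] := Hsgn cS dS cd.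
rewrite /face_prod -!signr_addb.
case: su => sE; rewrite {}sE in fs *.
  have : face_type_C F arrows S c d.
    split=> [x|]; first by rewrite fs scale1r.
    by exists (ext_one _); rewrite fs scale1r.
  move=> /HC; rewrite -addbA mulr1.
  by case: (sgn S c (+) _) (sgn S d (+) _) => [] [] //= _; rewrite ?expr1 ?expr0 ?subrr ?addNr.
have : face_type_A F arrows S c d.
  split=> [x|]; first by rewrite fs scaleN1r.
  by exists (ext_one _); rewrite fs scaleN1r oppr_eq0.
move=> /HA; rewrite -addbA mulrN1.
by case: (sgn S c (+) _) (sgn S d (+) _) => [] [] //= _; rewrite ?expr1 ?expr0 ?subrr ?addNr ?opprK.
Qed.

(** The scalars of the arrangement complex, transported to the reduced odd Khovanov
    complex by [chain_iso] with g = 1. *)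
Definition chain_scalar S r := eps S r * usign S r.

Lemma chain_scalar_neq0 S r : r \notin S -> chain_scalar S r != 0.
Proof.
move=> rS; rewrite mulf_neq0 ?Heps.1 //.
exact/sgn_unit_neq0/usignP.
Qed.

Let unit_nu e : (idfun : {linear V -> V}) (nu e) = 1 *: nu e.
Proof. by rewrite scale1r. Qed.
Let unit_surj (v : V) : exists u, v = (idfun : {linear V -> V}) u.
Proof. by exists v. Qed.
Let unit_neq0 (e : 'I_n) : 1 != 0 :> F.
Proof. exact: oner_neq0. Qed.

Let psi S := @chain_iso D F charF shaded edge_dir idfun y S.

Lemma psi_step S S' r z : r \notin S -> S' = r |: S ->
  @psi S' (@sa_delta F n A r S S' z) = usign S r *: rmap r S S' (@psi S z).
Proof.
move=> rS ->.
have E := @chain_isoE D F charF shaded edge_dir arrows idfun (fun=> 1) y unit_nu unit_surj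
  unit_neq0 y_next y_jump S r rS z.
rewrite /edge_scalar invr1 if_same mulr1 in E.
exact: E.
Qed.

Lemma reduced_map_is_linear r S S' : linear (rmap r S S').
Proof.
move=> a u v; rewrite /reduced_map; case: ifP => _; first by rewrite !linearP.
exact: linearP.
Qed.

Lemma psi_step2 S S1 T c d z : c \notin S -> S1 = c |: S -> d \notin S1 -> T = d |: S1 ->
  (eps S c * eps S1 d) *:
     @psi T (@sa_delta F n A d S1 T (@sa_delta F n A c S S1 z)) =
  (chain_scalar S c * chain_scalar S1 d) *: rmap d S1 T (rmap c S S1 (@psi S z)).
Proof.
move=> cS S1E dS1 TE.
rewrite (psi_step _ dS1 TE) (psi_step _ cS S1E).
pose rL := GRing.isLinear.Build F _ _ _ (rmap d S1 T) (@reduced_map_is_linear d S1 T).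
pose rl : {linear _ -> _} := HB.pack (rmap d S1 T) rL.
have -> w : rmap d S1 T (usign S c *: w) = usign S c *: rmap d S1 T w := linearZ_LR rl _ w.
have arith (p q a b : F) : p * q * b * a = p * a * (q * b).
  by rewrite -mulrA [b * a]mulrC mulrACA.
by rewrite !scalerA; congr (_ *: _); apply: arith.
Qed.

Lemma face_sign_one S c d s T : face_sign arrows S c d s -> T = c |: (d |: S) ->
  let one := ext_one (freev F (circle S)) in
  let far c d := @odd_map D F arrows d (c |: S) T (@odd_map D F arrows c S (c |: S) one) in
  far c d = s *: far d c /\ far d c != 0.
Proof. by case=> fs nz -> /=; split; [exact: fs | exact: nz]. Qed.

(** Both paths of the face are applied to 1, on which they do not vanish. *)
Lemma chain_face S c d s : c \notin S -> d \notin S -> c != d ->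
  face_sign arrows S c d s ->
  face_prod chain_scalar S c d * s + face_prod chain_scalar S d c = 0.
Proof.
move=> cS dS cd fs; set T := d |: (c |: S).
have dSc : d \notin c |: S by rewrite !inE negb_or eq_sym cd.
have cSd : c \notin d |: S by rewrite !inE negb_or cd.
have TE : T = c |: (d |: S) by rewrite /T setUCA.
have [fs1 nz] := face_sign_one fs TE.
have [psi' psiK psi'K] := @chain_iso_bij D F charF shaded edge_dir idfun (fun=> 1) y unit_nu
  unit_surj unit_neq0 y_next y_jump S.
set one := ext_one (subvs_of (reduced F S)).
have H0 : (eps S c * eps (c |: S) d) *:
      @sa_delta F n A d (c |: S) T (@sa_delta F n A c S (c |: S) (psi' one)) +
    (eps S d * eps (d |: S) c) *:
      @sa_delta F n A c (d |: S) T (@sa_delta F n A d S (d |: S) (psi' one)) = 0.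
  exact: (Heps.2 S c d cS dS cd (psi' one)).
have K1 := psi_step2 (psi' one) cS erefl dSc (erefl T).
have K2 := psi_step2 (psi' one) dS erefl cSd TE.
have pK : psi (psi' one) = one := psi'K one.
rewrite (congr1 (fun w => rmap d (c |: S) T (rmap c S (c |: S) w)) pK) in K1.
rewrite (congr1 (fun w => rmap c (d |: S) T (rmap d S (d |: S) w)) pK) in K2.
have i2 S1 a b : ext_map (@vsval F _ (reduced F T)) (rmap b S1 T (rmap a S S1 one)) =
    @odd_map D F arrows b S1 T (@odd_map D F arrows a S S1 (ext_one (freev F (circle S)))).
  rewrite (@ext_map_reduced b S1 T) (@ext_map_reduced a S S1).
  by do 2!apply: congr1; apply: ext_map1.
exact: (@face_transport F _ _ _ (@psi T) (ext_map (@vsval F _ (reduced F T)))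
  _ _ _ _ s _ _ _ _ _ _ H0 K1 K2 (i2 _ _ _) (i2 _ _ _) fs1 nz).
Qed.

End Flatness.

(** * The isomorphism of cubes *)

Section CubeIso.
Variables (D : link_diagram) (F : fieldType).
Variable charF : [pchar F] =i pred0.
Variables (shaded : checkerboard D) (edge_dir : 'I_(ncross D) -> bool).
Variable arrows : 'I_(ncross D) -> bool.
Local Notation n := (ncross D).
Local Notation edge := (@edge_vec D F shaded edge_dir).
Local Notation source := (edge_source shaded edge_dir).
Local Notation A := (link_arrangement charF shaded edge_dir).
Local Notation V := (sa_space A).
Local Notation nu := (@sa_vec F n A).
Local Notation ts := (tait_set shaded).
Local Notation next := (next_sector (@glue D)).
Local Notation pos := (positive_edges shaded).
Local Notation rmap r S S' := (@reduced_map D F arrows r S S').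
Implicit Types (S T : {set 'I_n}) (c d e f r : 'I_n).

Variables (eps : {set 'I_n} -> 'I_n -> F) (kind : bool) (sgn : {set 'I_n} -> 'I_n -> bool).
Hypothesis Heps : anticommuting_scalars (sa_cube A) eps.
Hypothesis Hsgn : edge_assignment F arrows kind sgn.

Local Notation usign S r := (@usign D F charF shaded edge_dir arrows S r).

Variable y : dart n -> freev F 'I_n.
Hypothesis y_next : forall x, y (next x) = y x.
Hypothesis y_jump : forall c w, relation edge w ->
  dotp (y (turn 1 (source c)) - y (turn 3 (source c))) w = w c.

Let unit_nu e : (idfun : {linear V -> V}) (nu e) = 1 *: nu e.
Proof. by rewrite scale1r. Qed.
Let unit_surj (v : V) : exists u, v = (idfun : {linear V -> V}) u.
Proof. by exists v. Qed.
Let unit_neq0 (e : 'I_n) : 1 != 0 :> F.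
Proof. exact: oner_neq0. Qed.

Local Notation mu := (@chain_scalar D F charF shaded edge_dir arrows eps).
Local Notation sg S r := ((-1) ^+ sgn S r : F).

Lemma mu_neq0 S r : r \notin S -> mu S r != 0.
Proof. exact: (chain_scalar_neq0 arrows Heps). Qed.

(** The cochain that has to be written as a coboundary. *)
Definition ratio S r : F := sg S r / mu S r.

Lemma ratio_neq0 S r : r \notin S -> ratio S r != 0.
Proof. by move=> rS; rewrite mulf_neq0 ?signr_eq0 // invr_neq0 // mu_neq0. Qed.

(** By [sgn_face] and [chain_face] both families of scalars have the same holonomy
    around a face that is not exceptional. *)
Lemma ratio_flat S c d : c \notin S -> d \notin S -> c != d ->
  ~~ exceptional_face S c d -> ratio S c * ratio (c |: S) d = ratio S d * ratio (d |: S) c.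
Proof.
move=> cS dS cd nx.
have [s su fs] := face_signP charF shaded arrows cS dS cd nx.
have E1 := sgn_face Hsgn cS dS cd su fs.
have E2 := chain_face Heps y_next y_jump cS dS cd fs.
have dSc : d \notin c |: S by rewrite !inE negb_or eq_sym cd.
have cSd : c \notin d |: S by rewrite !inE negb_or cd.
have := mu_neq0 cS; have := mu_neq0 dS; have := mu_neq0 dSc; have := mu_neq0 cSd.
have s0 := sgn_unit_neq0 su.
move: E1 E2; rewrite /ratio /face_prod.
move: (mu S c) (mu S d) (mu (c |: S) d) (mu (d |: S) c) => m1 m2 m3 m4.
move: (sg S c) (sg S d) (sg (c |: S) d) (sg (d |: S) c) => g1 g2 g3 g4.
move=> /eqP; rewrite addr_eq0 => /eqP E1 /eqP; rewrite addr_eq0 => /eqP E2 n4 n3 n2 n1.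
rewrite mulf_div [RHS]mulf_div.
have -> : g2 * g4 = - (g1 * g3 * s) by rewrite E1 opprK.
have -> : m2 * m4 = - (m1 * m3 * s) by rewrite E2 opprK.
by rewrite invrN mulrNN -[RHS]mulf_div divff // mulr1.
Qed.

Lemma splits_span S r : r \notin S -> splits r S =
  if r \in pos then nu r \in vspan nu (ts S) else nu r \notin vspan nu (ts S :\ r).
Proof. exact: (splitsE unit_nu unit_surj unit_neq0 y_next y_jump). Qed.

Lemma vspan_sub T e v : v \in vspan nu T -> v \in vspan nu (e |: T).
Proof.
apply: (subvP _ v); apply/subv_sumP => s sT.
by apply: (sumv_sup s); rewrite ?subvv // in_setU1 sT orbT.
Qed.

(** The same cochain on the cube of subgraphs of the Tait graph, where the edges of
    the cube at negative crossings are reversed. *)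
Definition graph_ratio T e : F :=
  if e \in pos then ratio (ts T) e else (ratio (ts (e |: T)) e)^-1.

Lemma notin_ts_pos T e : e \in pos -> e \notin T -> e \notin ts T.
Proof. by move=> ep eT; rewrite in_tait_set ep (negPf eT). Qed.

Lemma notin_ts_neg T e : e \notin pos -> e \notin ts (e |: T).
Proof. by move=> ep; rewrite in_tait_set setU11 (negPf ep). Qed.

Lemma graph_ratio_neq0 T e : e \notin T -> graph_ratio T e != 0.
Proof.
move=> eT; rewrite /graph_ratio; case: (boolP (e \in pos)) => ep.
  by rewrite ratio_neq0 // notin_ts_pos.
by rewrite invr_neq0 // ratio_neq0 // notin_ts_neg.
Qed.

(** At directions of opposite signs the exceptional faces are those of parallel
    edges. *)
Lemma graph_ratio_mixed T e f : e \notin T -> f \notin T -> e != f ->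
  e \in pos -> f \notin pos -> ~~ parallel nu T e f -> trivial_face graph_ratio T e f.
Proof.
move=> eT fT ef ep fp np.
have feT : f \notin e |: T by rewrite in_setU1 negb_or eq_sym ef.
set S := ts (f |: T).
have fS : f \notin S := notin_ts_neg T fp.
have eS : e \notin S by rewrite notin_ts_pos // in_setU1 negb_or ef.
have E1 : ts T = f |: S := tait_set_neg fp fT.
have E2 : ts (f |: (e |: T)) = e |: S by rewrite setUCA tait_set_pos.
have eSf : e \notin f |: S by rewrite in_setU1 negb_or ef.
have fSe : f \notin e |: S by rewrite in_setU1 negb_or eq_sym ef.
have nx : ~~ exceptional_face S e f.
  apply: contra np => /and4P[].
  rewrite !splits_span // ep (negPf fp) !negbK => _.
  rewrite (tait_set_pos S ep) -E1 !tait_setK.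
  have -> : (e |: (f |: T)) :\ f = e |: T by rewrite setUCA setU1K.
  by rewrite setU1K // /parallel => -> -> ->.
have := ratio_flat eS fS ef nx.
rewrite /trivial_face /graph_ratio ep (negPf fp) E1 E2 -/S => E.
have n1 := ratio_neq0 fS; have n2 := ratio_neq0 fSe.
apply: (mulIf n2); apply: (mulfI n1).
by rewrite divfK // mulrA mulVKf // [RHS]mulrC.
Qed.

(** For two directions of the same sign no face is exceptional: the span of T only
    grows with T. *)
Lemma graph_ratio_flat : flat_off nu graph_ratio pos.
Proof.
move=> T e f eT fT ef.
have feT : f \notin e |: T by rewrite in_setU1 negb_or eq_sym ef.
have efT : e \notin f |: T by rewrite in_setU1 negb_or ef.
case: (boolP (e \in pos)) => ep; case: (boolP (f \in pos)) => fp //= np.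
- have eS := notin_ts_pos ep eT; have fS := notin_ts_pos fp fT.
  rewrite /trivial_face /graph_ratio ep fp !tait_set_pos //.
  apply: ratio_flat => //; apply/negP => /and4P[].
  rewrite !splits_span ?in_setU1 ?negb_or ?(eq_sym f) ?ef // ep fp !tait_set_pos // !tait_setK.
  by move=> _ fn fin _; rewrite vspan_sub in fn.
- exact: graph_ratio_mixed.
- apply/esym/graph_ratio_mixed => //; first by rewrite eq_sym.
  by apply: contra np => pfe; apply: (parallelC fT eT _ pfe); rewrite eq_sym.
set S := ts (f |: (e |: T)).
have fS : f \notin S := notin_ts_neg (e |: T) fp.
have SE : S = ts (e |: (f |: T)) by rewrite /S setUCA.
have eS : e \notin S by rewrite SE notin_ts_neg.
have E1 : ts (e |: T) = f |: S := tait_set_neg fp feT.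
have E2 : ts (f |: T) = e |: S by rewrite SE; apply: tait_set_neg ep efT.
have nx : ~~ exceptional_face S e f.
  apply/negP => /and4P[].
  rewrite !splits_span ?in_setU1 ?negb_or ?(eq_sym f) ?ef // (negPf ep) (negPf fp) !negbK.
  rewrite -E1 -E2 !tait_setK setU1K // setU1K // setUCA setU1K //.
  by move=> _ fin fn _; rewrite vspan_sub in fn.
have := ratio_flat eS fS ef nx.
rewrite /trivial_face /graph_ratio (negPf ep) (negPf fp) -SE -/S E1 E2 => E.
by rewrite -!invfM mulrC -E mulrC.
Qed.

(** [gauge], carried back to the cube of smoothings. The factor lam r appears at the
    negative edges where nu_r is not in the span, which are the splittings. *)
Lemma gauged_scalars : exists lam : 'I_n -> F, exists u : {set 'I_n} -> F,
  [/\ forall e, lam e != 0, forall S, u S != 0,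
      forall w, relation nu w -> relation nu [ffun e => (lam e * w e : F) : F^o] &
      forall S r, r \notin S ->
        sg S r * u S = u (r |: S) * (mu S r * (if (r \notin pos) && splits r S then lam r else 1))].
Proof.
have [lam [u [lam0 u0 rel uE]]] := gauge charF (@unimodular_nu D F charF shaded edge_dir)
  graph_ratio_neq0 graph_ratio_flat.
exists lam, (fun S => u (ts S)); split=> // S r rS.
have sg0 : sg S r != 0 by rewrite signr_eq0.
have mu0 := mu_neq0 rS; case: (boolP (r \in pos)) => rp.
  have rT : r \notin ts S := notin_ts_pos rp rS.
  have := uE _ _ rT; rewrite -tait_set_pos // rp /= !mulr1 /graph_ratio rp tait_setK => ->.
  by rewrite /ratio mulrA divfK // mulrC.
have rT : r \notin ts (r |: S) := notin_ts_neg S rp.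
have TE : r |: ts (r |: S) = ts S := esym (tait_set_neg rp rS).
have := uE _ _ rT; rewrite TE /graph_ratio (negPf rp) TE tait_setK /= => ->.
rewrite splits_span // (negPf rp) -TE setU1K // mulrCA; congr (_ * _).
by rewrite /ratio invf_div mulrA mulrCA divff // mulr1.
Qed.

(** [chain_iso] for the automorphism g that scales nu_r by the inverse of lam r,
    multiplied by u at each vertex. *)
Theorem cube_iso_aux : exists Phi : forall S, {linear freev F (sa_basis A S) -> freev F (reduced_basis F S)},
  [/\ forall S, bijective (Phi S),
      forall S (b : sa_basis A S), homogeneous (#|b.1| + #|b.2|) (Phi S (basisv F b)) &
      forall S r z, r \notin S ->
        eps S r *: Phi (r |: S) (@sa_delta F n A r S (r |: S) z) =
          sg S r *: rmap r S (r |: S) (Phi S z)].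
Proof.
have [lam [u [lam0 u0 rel uE]]] := gauged_scalars.
have [g [g_nu g_surj]] := scaled_automorphism lam0 rel.
have lamV0 e : (lam e)^-1 != 0 by rewrite invr_neq0.
pose psi S : {linear freev F (sa_basis A S) -> freev F (reduced_basis F S)} :=
  @chain_iso D F charF shaded edge_dir g y S.
pose Phi S : {linear freev F (sa_basis A S) -> freev F (reduced_basis F S)} := u S \*: psi S.
exists Phi; split=> [S|S b|S r z rS].
- have [psi' psiK psi'K] := chain_iso_bij g_nu g_surj lamV0 y_next y_jump S.
  exists (fun w => psi' ((u S)^-1 *: w)) => w.
    by rewrite -[RHS]psiK; congr psi'; rewrite /Phi /= scalerA mulVf ?scale1r.
  by rewrite /Phi /= -[X in u S *: X]/(chain_iso g y _) psi'K scalerA mulfV ?scale1r.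
- apply: homogeneousZ; exact: homogeneous_tens_ext.
pose rL := GRing.isLinear.Build F _ _ _ (rmap r S (r |: S)) (@reduced_map_is_linear D F arrows r S (r |: S)).
pose rl : {linear _ -> _} := HB.pack (rmap r S (r |: S)) rL.
have E := @chain_isoE D F charF shaded edge_dir arrows g (fun e => (lam e)^-1) y g_nu g_surj
  lamV0 y_next y_jump S r rS z.
have rZ w : rmap r S (r |: S) (u S *: w) = u S *: rmap r S (r |: S) w := linearZ_LR rl _ w.
rewrite -[Phi S z]/(u S *: chain_iso g y z) rZ scalerA uE // -[Phi (r |: S) _]/(u (r |: S) *: chain_iso g y _).
rewrite E !scalerA; congr (_ *: _).
rewrite /edge_scalar invrK /chain_scalar.
by rewrite [eps S r * _]mulrC -!mulrA.
Qed.

End CubeIso.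

Theorem cube_iso (D : link_diagram) (F : fieldType) (charF : [pchar F] =i pred0)
    (shaded : checkerboard D) (edge_dir arrows : 'I_(ncross D) -> bool)
    (eps : {set 'I_(ncross D)} -> 'I_(ncross D) -> F) (kind : bool)
    (sgn : {set 'I_(ncross D)} -> 'I_(ncross D) -> bool) :
  let A := link_arrangement charF shaded edge_dir in
  anticommuting_scalars (sa_cube A) eps -> edge_assignment F arrows kind sgn ->
  exists Phi : forall S, {linear freev F (sa_basis A S) -> freev F (reduced_basis F S)},
  [/\ forall S, bijective (Phi S),
      forall S (b : sa_basis A S), homogeneous (#|b.1| + #|b.2|) (Phi S (basisv F b)) &
      forall (S : {set 'I_(ncross D)}) r z, r \notin S ->
        eps S r *: Phi (r |: S) (@sa_delta F _ A r S (r |: S) z) =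
          (-1) ^+ sgn S r *: @reduced_map D F arrows r S (r |: S) (Phi S z)].
Proof.
move=> A Heps Hsgn; have [y [y_next y_jump]] := dual_potential charF shaded edge_dir.
exact: (cube_iso_aux Heps Hsgn y_next y_jump).
Qed.

(** * Maps of subquotients *)

Section QuotientMap.
Variables (F : fieldType).
Local Open Scope quotient_scope.

Lemma quotv_eq (V : vectType F) (U : {vspace V}) x y :
  (\pi_(quotv U) x == \pi_(quotv U) y) = (x - y \in U).
Proof. by rewrite (Quotient.idealrBE (pred_of_vspace U)). Qed.

Variables (V V' : vectType F) (U : {vspace V}) (U' : {vspace V'}) (h : {linear V -> V'}).
Hypothesis hU : forall v, v \in U -> h v \in U'.

(** The map induced on quotients by h. *)
Definition quotv_map (q : quotv U) : quotv U' := \pi_(quotv U') (h (repr q)).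

Lemma quotv_mapE v : quotv_map (\pi_(quotv U) v) = \pi_(quotv U') (h v).
Proof.
apply/eqP; rewrite quotv_eq -linearB hU // -quotv_eq.
exact/eqP/reprK.
Qed.

Lemma quotv_map_is_linear : linear quotv_map.
Proof.
move=> a; elim/quotW=> x; elim/quotW=> y.
have E (W : vectType F) (U0 : {vspace W}) (u v : W) :
    a *: (\pi_(quotv U0) u : quotv U0) + (\pi_(quotv U0) v : quotv U0) =
    \pi_(quotv U0) (a *: u + v).
  by rewrite quotv_piD -quotv_piE.
by rewrite E !quotv_mapE E linearP.
Qed.

End QuotientMap.

Section SubquotientMap.
Variables (F : fieldType) (V V' : vectType F).
Variables (Z B : {vspace V}) (Z' B' : {vspace V'}).
Variables (P : {linear V -> V'}) (P' : {linear V' -> V}).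
Hypothesis PK : cancel P P'.
Hypothesis P'K : cancel P' P.
Hypothesis PZ : forall v, v \in Z -> P v \in Z'.
Hypothesis P'Z : forall v, v \in Z' -> P' v \in Z.
Hypothesis PB : forall v, v \in B -> P v \in B'.
Hypothesis P'B : forall v, v \in B' -> P' v \in B.

(** An isomorphism that matches cycles with cycles and boundaries with boundaries. *)
Lemma subquotient_iso :
  exists f : {linear subquotient Z B -> subquotient Z' B'}, bijective f.
Proof.
pose h (v : subvs_of Z) : subvs_of Z' := vsproj Z' (P (vsval v)).
pose h' (v : subvs_of Z') : subvs_of Z := vsproj Z (P' (vsval v)).
have hlin : linear h by move=> a u v; rewrite /h !linearP.
have h'lin : linear h' by move=> a u v; rewrite /h' !linearP.
pose hL := GRing.isLinear.Build F _ _ _ h hlin.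
pose hl : {linear subvs_of Z -> subvs_of Z'} := HB.pack h hL.
pose h'L := GRing.isLinear.Build F _ _ _ h' h'lin.
pose h'l : {linear subvs_of Z' -> subvs_of Z} := HB.pack h' h'L.
have hv v : vsval (h v) = P (vsval v) by rewrite vsprojK // PZ // subvsP.
have h'v v : vsval (h' v) = P' (vsval v) by rewrite vsprojK // P'Z // subvsP.
have hB v : v \in (linfun (@vsval F V Z) @^-1: B)%VS ->
    hl v \in (linfun (@vsval F V' Z') @^-1: B')%VS.
  by rewrite -!memv_preim !lfunE /= hv; apply: PB.
have h'B v : v \in (linfun (@vsval F V' Z') @^-1: B')%VS ->
    h'l v \in (linfun (@vsval F V Z) @^-1: B)%VS.
  by rewrite -!memv_preim !lfunE /= h'v; apply: P'B.
pose fL := GRing.isLinear.Build F (subquotient Z B) (subquotient Z' B') _ _ (quotv_map_is_linear hB).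
pose f : {linear subquotient Z B -> subquotient Z' B'} := HB.pack (quotv_map _ hl) fL.
have fE v := quotv_mapE hB v; have gE v := quotv_mapE h'B v.
exists f, (quotv_map (linfun (@vsval F V Z) @^-1: B)%VS h'l); elim/quotW=> v.
  apply: etrans (congr1 (quotv_map _ h'l) (fE v)) _; apply: etrans (gE _) _.
  by congr (\pi _)%qT; apply: val_inj; rewrite /= h'v hv PK.
apply: etrans (congr1 f (gE v)) _; apply: etrans (fE _) _.
by congr (\pi _)%qT; apply: val_inj; rewrite /= hv h'v P'K.
Qed.
End SubquotientMap.

(** * Homology of isomorphic cubes *)

Section GradedMaps.
Variables (F : fieldType) (J J' : finType) (f : {linear freev F J -> freev F J'}).

Lemma freev_mapE x j' : f x j' = \sum_j (x j : F) * (f (basisv F j) j' : F).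
Proof.
rewrite {1}[x]freev_sum linear_sum sum_ffunE; apply: eq_bigr => j _.
by rewrite linearZ ffunE.
Qed.

Variables (deg : J -> rat * rat) (deg' : J' -> rat * rat) (a b : rat).
Local Notation sh d := (d.1 - a, d.2 - b).
Hypothesis f_deg : forall j j', f (basisv F j) j' != 0 -> deg' j' = sh (deg j).

Lemma sh_inj (d d' : rat * rat) : sh d = sh d' -> d = d'.
Proof. by case: d d' => [d1 d2] [e1 e2] [/addIr -> /addIr ->]. Qed.

(** The map f commutes with the projections to the part of a given degree, so its
    inverse does. *)
Lemma graded_inv (f' : {linear freev F J' -> freev F J}) : cancel f f' -> cancel f' f ->
  forall j' j, f' (basisv F j') j != 0 -> deg' j' = sh (deg j).
Proof.
move=> fK f'K j' j nz; set x := f' (basisv F j').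
pose res : freev F J := [ffun i => if deg i == deg j then x i else 0].
apply/eqP; apply: contraNT nz => ne.
suff res0 : res = 0.
  by have := congr1 (fun v : freev F J => v j) res0; rewrite !ffunE eqxx => ->.
rewrite -[res]fK; suff -> : f res = 0 by rewrite linear0.
apply/ffunP => i'; rewrite ffunE freev_mapE.
have fx i : f x i = (i == j')%:R by rewrite /x f'K basisvE.
have [E|E] := eqVneq (deg' i') (sh (deg j)).
  have i'j : i' != j' by apply: contraNneq ne => <-; rewrite E.
  have z0 : f x i' = 0 by rewrite fx (negPf i'j).
  rewrite -[RHS]z0 freev_mapE; apply: eq_bigr => i _.
  rewrite ffunE; case: eqP => // di.
  have [->|/f_deg] := eqVneq (f (basisv F i) i') 0; first by rewrite !mulr0.
  by rewrite E => /sh_inj/esym.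
rewrite big1 // => i _; rewrite ffunE; case: eqP => di; last by rewrite mul0r.
have [->|/f_deg] := eqVneq (f (basisv F i) i') 0; first by rewrite mulr0.
by rewrite di => /eqP; rewrite (negPf E).
Qed.

End GradedMaps.

Section TotalMap.
Variables (F : fieldType) (n : nat) (C C' : cube F n).
Variable f : forall S, {linear freev F (cube_basis C S) -> freev F (cube_basis C' S)}.

(** Reasoning one vertex of the cube at a time avoids transport between the bases at
    different vertices. *)
Lemma total_eq (K : cube F n) (x y : freev F (total_basis K)) :
  (forall S, component x S = component y S) -> x = y.
Proof.
move=> E; apply/ffunP => -[S j]; have := congr1 (fun v : freev F _ => v j) (E S).
by rewrite !ffunE.
Qed.

Fact component_is_linear (K : cube F n) S : linear (fun x => @component F n K x S).
Proof. by move=> a x y; apply/ffunP => j; rewrite !ffunE. Qed.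

Definition total_map (x : freev F (total_basis C)) : freev F (total_basis C') :=
  [ffun u => f (tag u) (component x (tag u)) (tagged u)].

Lemma component_total_map x S : component (total_map x) S = f S (component x S).
Proof. by apply/ffunP => j; rewrite !ffunE. Qed.

Fact total_map_is_linear : linear total_map.
Proof.
move=> a x y; apply: total_eq => S.
by rewrite component_total_map !component_is_linear linearP !component_total_map.
Qed.
HB.instance Definition _ := GRing.isLinear.Build F (freev F (total_basis C))
  (freev F (total_basis C')) *:%R total_map total_map_is_linear.

Lemma mem_chains (K : cube F n) h q (x : freev F (total_basis K)) :
  reflect (forall u, x u != 0 -> cube_deg (tagged u) = (h, q)) (x \in chains K h q).
Proof.
apply: (iffP idP) => [xc u|xd].
  apply: contra_neq_eq => ne.
  pose ev (z : freev F (total_basis K)) : F^o := z u.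
  have evlin : linear ev by move=> a v w; rewrite /ev !ffunE.
  pose eL := GRing.isLinear.Build F _ _ _ ev evlin.
  pose el : {linear freev F (total_basis K) -> F^o} := HB.pack ev eL.
  have sub : (chains K h q <= lker (linfun el))%VS.
    apply/span_subvP => _ /imageP[v vd ->]; rewrite memv_ker lfunE /= /ev basisvE.
    by case: (eqVneq u v) => [uv|_]; [move: vd; rewrite inE -uv (negPf ne) | exact: eqxx].
  by have := subvP sub _ xc; rewrite memv_ker lfunE => /eqP.
rewrite [x]freev_sum memv_suml // => u _.
have [->|/xd ud] := eqVneq (x u) 0; first by rewrite scale0r mem0v.
by rewrite memvZ // memv_span // image_f // inE ud.
Qed.

Variables (a b : rat).
Hypothesis f_deg : forall S j j', f S (basisv F j) j' != 0 ->
  cube_deg j' = ((cube_deg j).1 - a, (cube_deg j).2 - b).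

Lemma total_map_chains h q x : x \in chains C h q -> total_map x \in chains C' (h - a) (q - b).
Proof.
move/mem_chains => xd; apply/mem_chains => -[S j'].
rewrite ffunE freev_mapE /=; apply: contra_neq_eq => ne.
rewrite big1 // => j _.
have [->|/f_deg] := eqVneq (f S (basisv F j) j') 0; first by rewrite mulr0.
have [-> _|] := eqVneq (component x S j) 0; first by rewrite mul0r.
by rewrite ffunE => /xd /= ->  E; rewrite E eqxx in ne.
Qed.

Variables (eps eps' : {set 'I_n} -> 'I_n -> F).
Hypothesis f_comm : forall (S : {set 'I_n}) r z, r \notin S ->
  eps S r *: f (r |: S) (cube_map C r (r |: S) z) =
    eps' S r *: cube_map C' r (r |: S) (f S z).

Lemma component_differential (K : cube F n) t x S :
  component (differential (C := K) t x) S =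
    \sum_(r in S) t (S :\ r) r *: cube_map K r S (component x (S :\ r)).
Proof.
apply/ffunP => j; rewrite !ffunE sum_ffunE; apply: eq_bigr => r _.
by rewrite ffunE.
Qed.

Lemma total_map_differential x :
  total_map (differential eps x) = differential eps' (total_map x).
Proof.
apply: total_eq => S; rewrite component_total_map !component_differential linear_sum.
apply: eq_bigr => r rS; rewrite linearZ component_total_map /=.
have comm (S' S0 : {set 'I_n}) z : r \notin S' -> S0 = r |: S' -> eps S' r *: f S0 (cube_map C r S0 z) =
    eps' S' r *: cube_map C' r S0 (f S' z).
  by move=> rS' ->; apply: f_comm.
by apply: comm; rewrite ?setD1K // !inE eqxx.
Qed.

Lemma differential_is_linear (K : cube F n) t :
  (forall r S T, linear (@cube_map F n K r S T)) -> linear (@differential F n K t).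
Proof.
move=> lin k x y; apply: total_eq => S.
rewrite component_is_linear !component_differential scaler_sumr -big_split.
apply: eq_bigr => r _; rewrite component_is_linear lin scalerDr; congr (_ + _).
by rewrite !scalerA mulrC.
Qed.

End TotalMap.

(** The isomorphisms at the vertices assemble to an isomorphism of complexes that
    shifts the degrees by a constant. *)
Theorem cube_homology_iso (F : fieldType) (n : nat) (C C' : cube F n)
    (eps eps' : {set 'I_n} -> 'I_n -> F) (a b : rat)
    (f : forall S, {linear freev F (cube_basis C S) -> freev F (cube_basis C' S)}) :
  (forall r S T, linear (@cube_map F n C r S T)) ->
  (forall r S T, linear (@cube_map F n C' r S T)) ->
  (forall S, bijective (f S)) ->
  (forall S j j', f S (basisv F j) j' != 0 ->
     cube_deg j' = ((cube_deg j).1 - a, (cube_deg j).2 - b)) ->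
  (forall (S : {set 'I_n}) r z, r \notin S ->
     eps S r *: f (r |: S) (cube_map C r (r |: S) z) =
       eps' S r *: cube_map C' r (r |: S) (f S z)) ->
  bigraded_iso (cube_homology C eps) (shift (cube_homology C' eps') a b).
Proof.
move=> lin lin' f_bij f_deg f_comm h q.
pose f' S : {linear freev F (cube_basis C' S) -> freev F (cube_basis C S)} := (linfun (f S))^-1%VF.
have fK S : cancel (f S) (f' S).
  have ker : lker (linfun (f S)) == 0%VS.
    by apply/lker0P => x y; rewrite !lfunE; apply: (bij_inj (f_bij S)).
  by move=> x; rewrite /f' /= -[f S x]lfunE lker0_lfunK.
have f'K S : cancel (f' S) (f S).
  by have [g gK g'K] := f_bij S; move=> x; rewrite -[x]g'K fK.
have f'_deg S j' j : f' S (basisv F j') j != 0 ->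
    cube_deg j = ((cube_deg j').1 - - a, (cube_deg j').2 - - b).
  move=> nz; have -> := graded_inv (f_deg S) (fK S) (f'K S) nz.
  by rewrite /= !opprK !subrK; case: (cube_deg j).
pose P := total_map f; pose P' := total_map f'.
have PK : cancel P P' by move=> x; apply: total_eq => S; rewrite !component_total_map fK.
have P'K : cancel P' P by move=> x; apply: total_eq => S; rewrite !component_total_map f'K.
have f'_comm (S : {set 'I_n}) r z : r \notin S ->
    eps' S r *: f' (r |: S) (cube_map C' r (r |: S) z) =
      eps S r *: cube_map C r (r |: S) (f' S z).
  move=> rS; apply: (bij_inj (f_bij (r |: S))).
  by rewrite !linearZ /= f'K (f_comm S r (f' S z) rS) f'K.
have dlin := differential_is_linear eps lin; have d'lin := differential_is_linear eps' lin'.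
pose dL := GRing.isLinear.Build F _ _ _ _ dlin.
pose d : {linear freev F (total_basis C) -> freev F (total_basis C)} := HB.pack (differential eps) dL.
pose d'L := GRing.isLinear.Build F _ _ _ _ d'lin.
pose d' : {linear freev F (total_basis C') -> freev F (total_basis C')} := HB.pack (differential eps') d'L.
have Pd := total_map_differential f_comm; have P'd := total_map_differential f'_comm.
have back r s : chains C (r - a - - a) (s - b - - b) = chains C r s by rewrite !opprK !subrK.
have chP r s x : x \in chains C r s -> P x \in chains C' (r - a) (s - b).
  exact: total_map_chains.
have chP' r s x : x \in chains C' (r - a) (s - b) -> P' x \in chains C r s.
  by rewrite -back; apply: total_map_chains.
have cyE (K : cube F n) t (lt : linear (@differential F n K t)) r s x :
    (x \in @cycles F n K t r s) = (x \in chains K r s) && (differential t x == 0).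
  pose tL := GRing.isLinear.Build F _ _ _ _ lt.
  pose tl : {linear freev F (total_basis K) -> freev F (total_basis K)} := HB.pack (differential t) tL.
  by rewrite memv_cap memv_ker -[linfun _]/(linfun tl) lfunE.
apply: (@subquotient_iso F _ _ _ _ _ _ P P' PK P'K).
- move=> x; rewrite !cyE //; case/andP => /chP -> /eqP dx.
  by rewrite -Pd dx linear0 eqxx.
- move=> x; rewrite !cyE //; case/andP => /chP' -> /eqP dx.
  by rewrite -P'd dx linear0 eqxx.
- move=> _ /memv_imgP[x xc ->]; rewrite -[linfun _]/(linfun d) lfunE /= Pd.
  rewrite -[differential eps' (P x)]/(d' (P x)) -lfunE memv_img // addrAC; exact: chP.
move=> _ /memv_imgP[x xc ->]; rewrite -[linfun _]/(linfun d') lfunE /= P'd.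
rewrite -[differential eps (P' x)]/(d (P' x)) -lfunE memv_img //; apply: chP'.
by rewrite addrAC.
Qed.

(** * Odd Khovanov homology of a link *)

Lemma card_circle_dims (D : link_diagram) (F : fieldType) (charF : [pchar F] =i pred0)
    (shaded : checkerboard D) (edge_dir : 'I_(ncross D) -> bool) (S : {set 'I_(ncross D)}) :
  let A := link_arrangement charF shaded edge_dir in
  #|circle S| = (\dim (sa_H A (sa_tilde A S)) + \dim (sa_W A (sa_tilde A S))).+1.
Proof.
move=> A; have [y [y_next y_jump]] := dual_potential charF shaded edge_dir.
have nu1 e : (idfun : {linear sa_space A -> sa_space A}) (sa_vec A e) = 1 *: sa_vec A e.
  by rewrite scale1r.
have surj (v : sa_space A) : exists u, v = (idfun : {linear sa_space A -> sa_space A}) u.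
  by exists v.
have nz (e : 'I_(ncross D)) : 1 != 0 :> F by apply: oner_neq0.
rewrite -(card_circle_HW nu1 surj nz y_next y_jump (tait_set shaded S)).
by rewrite tait_setK.
Qed.

Lemma sa_delta_is_linear (F : fieldType) (n : nat) (A : signed_arrangement F n) r S T :
  linear (@sa_delta F n A r S T).
Proof.
by move=> a u v; rewrite /sa_delta; case: ifP => _; case: ifP => _; apply: linearP.
Qed.

Theorem proposition3p14 (F : fieldType) (charF : [pchar F] =i pred0)
  (D : link_diagram)
  (* the link vector arrangement: colouring and edge orientations *)
  (shaded : checkerboard D) (edge_dir : 'I_(ncross D) -> bool)
  (* the scalars in the differential of the arrangement complex *)
  (eps : {set 'I_(ncross D)} -> 'I_(ncross D) -> F)
  (Heps : anticommuting_scalars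
            (sa_cube (link_arrangement charF shaded edge_dir)) eps)
  (* the choices in the odd Khovanov complex: arrows and edge assignment *)
  (arrows : 'I_(ncross D) -> bool) (kind : bool)
  (sgn : {set 'I_(ncross D)} -> 'I_(ncross D) -> bool)
  (Hsgn : edge_assignment F arrows kind sgn) :
  bigraded_iso
    (arrangement_homology (link_arrangement charF shaded edge_dir) eps)
    (shift (reduced_odd_Kh F arrows sgn)
       (- (writhe D / 2)) (- (3 * writhe D / 2))).
Proof.
have [Phi [Phi_bij Phi_hom Phi_comm]] := cube_iso Heps Hsgn.
apply: (@cube_homology_iso F _ (sa_cube (link_arrangement charF shaded edge_dir))
  (reduced_cube F arrows) eps (fun S c => (-1) ^+ sgn S c) _ _ Phi).
- exact: sa_delta_is_linear.
- exact: reduced_map_is_linear.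
- exact: Phi_bij.
- move=> S j j' /(Phi_hom S j j') kE.
  have nE : (ncross D)%:R = (num_pos D)%:R + (num_neg D)%:R :> rat.
    by rewrite -natrD /num_pos /num_neg cardsC card_ord.
  rewrite /= /reduced_deg /sa_deg kE (card_circle_dims charF shaded edge_dir).
  rewrite /writhe nE -natr1 !natrD /=.
  congr (_, _); by field.
exact: Phi_comm.
Qed.
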